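(* If $\mathfrak b\in[\mathbb H^\infty_d]_1$ is NC rational, then either $\mathfrak b$ is inner or $\mathfrak b$ is not column-extreme. If $\mathfrak b$ is non-column-extreme, then its Sarason outer function $\mathfrak a\in[\mathbb H^\infty_d]_1$ is also NC rational and $\mathfrak c:=\begin{pmatrix} \mathfrak b \\ \mathfrak a \end{pmatrix}$ is inner, so that $T:=I-\mathfrak b(R)^*\mathfrak b(R)=\mathfrak a(R)^*\mathfrak a(R)$ is factorable.
   Context: Fix $d\in\mathbb N$. $\mathbb F^d$ is the free monoid of words in the letters $1,\dots,d$ with unit the empty word $\emptyset$; $\omega^{\mathrm t}$ is the reversed word of $\omega$. For $\omega=i_1\cdots i_n$ and operators $T_1,\dots,T_d$, $T^\omega:=T_{i_1}\cdots T_{i_n}$, $T^\emptyset:=I$. $\mathbb H^2_d$ (full Fock space) is the Hilbert space of formal power series $h=\sum_\omega\hat h_\omega\mathfrak z^\omega$ in non-commuting variables $\mathfrak z_1,\dots,\mathfrak z_d$ with $\sum|\hat h_\omega|^2<\infty$ and orthonormal basis $\{\mathfrak z^\omega\}$; $h(0):=\hat h_\emptyset$. Inner products are conjugate-linear in the first argument. $h^{\mathrm t}:=\sum\hat h_\omega\mathfrak z^{\omega^{\mathrm t}}$, $U_{\mathrm t}h:=h^{\mathrm t}$. $L_k$, $R_k$ are left and right multiplication by $\mathfrak z_k$. $\mathbb H^\infty_d$ is the algebra of power series $F$ such that left multiplication $F(L):h\mapsto Fh$ is bounded on $\mathbb H^2_d$; $[\mathbb H^\infty_d]_1$ is its closed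 unit ball; $F(R):=U_{\mathrm t}F(L)U_{\mathrm t}$ is right multiplication by $F^{\mathrm t}$. $F$ is inner if $F(R)$ (equivalently $F(L)$) is an isometry, outer if it has dense range; a column $\begin{pmatrix} b \\ a \end{pmatrix}$ is contractive/inner if $\begin{pmatrix} b(R) \\ a(R) \end{pmatrix}:\mathbb H^2_d\to\mathbb H^2_d\otimes\mathbb C^2$ is a contraction/isometry. $T\ge 0$ is factorable if $T=f(R)^*f(R)$ with $f\in\mathbb H^\infty_d$. $b\in[\mathbb H^\infty_d]_1$ is column-extreme (CE) if there is no non-zero $e\in\mathbb H^\infty_d$ such that the column $\begin{pmatrix} b \\ e \end{pmatrix}$ is contractive. $\mathscr H^{\mathrm t}(b)$ is $\mathrm{Ran}\sqrt{I-b(R)b(R)^*}$ with the Hilbert norm $\|\cdot\|_b$ making $\sqrt{I-b(R)b(R)^*}$ a co-isometry onto it; it is $L_k^*$-invariant, contains each $L_k^*b^{\mathrm t}$, and contains $b^{\mathrm t}$ if $b$ is non-CE. With $X_k:=L_k^*|_{\mathscr H^{\mathrm t}(b)}$, the Sarason (outer) function of a non-CE $b$ is the power series $a$ with $a(0)>0$, $a(0)^2=1-|b(0)|^2-\sum_k\|L_k^*b^{\mathrm t}\|_b^2>0$, and $\hat a_\omega=-a(0)\langle b^{\mathrm t},X^\omega b^{\mathrm t}\rangle_b$ for $\omega\ne\emptyset$; then $a\in[\mathbb H^\infty_d]_1$ is outer. An NC rational expression is a syntactically valid combination of $\mathfrak z_1,\dots,\mathfrak z_d$, complex scalars, $+$,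 $\cdot$, ${}^{-1}$ and parentheses; its domain is the set of all $d$-tuples of complex $n\times n$ matrices, $n\in\mathbb N$, at which it is defined, and it is valid if its domain is non-empty. An NC rational function is an equivalence class of valid expressions, two being equivalent if they agree on the intersection of their domains; its domain is the union of the domains of its representatives. An NC rational function whose domain contains $0$ is identified with its power series at $0$; an element of $\mathbb H^\infty_d$ is NC rational if it is such a power series. *)

(* Defs.v *)
From HB Require Import structures.
From mathcomp Require Import all_boot all_order all_algebra.
From mathcomp Require Import complex.
From mathcomp Require Import all_classical all_reals all_analysis.

Set Implicit Arguments.
Unset Strict Implicit.
Unset Printing Implicit Defensive.

Import Order.TTheory GRing.Theory Num.Theory.
Import numFieldNormedType.Exports.
Local Open Scope classical_set_scope.
Local Open Scope ring_scope.

Definition word (d : nat) := seq 'I_d.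

(* The coefficient family [w |-> h w] of a formal power series. *)
Definition fps (R : realType) (d : nat) := word d -> R[i].

Section FockSpace.
Variables (R : realType) (d : nat).
Local Notation C := R[i].
Local Notation word := (word d).
Local Notation fps := (fps R d).
Implicit Types (f g h F b a e : fps) (w : word) (k : 'I_d).
Implicit Types (T D : fps -> fps).

Definition smul f g : fps :=
  fun w => \sum_(i < (size w).+1) f (take i w) * g (drop i w).

Definition smono w : fps := fun v => (v == w)%:R.

Definition str h : fps := fun w => h (rev w).

Definition absq (z : C) : R := complex.Re z ^+ 2 + complex.Im z ^+ 2.

Definition normsq h : \bar R := (\esum_(w in [set: word]) (absq (h w))%:E)%E.

Definition fock h : Prop := (normsq h < +oo)%E.

(* Unordered sum of an absolutely summable family, as positive minus negative
   part (an esum is only meaningful for nonnegative terms). *)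
Definition wsum (u : word -> R) : R :=
  fine (\esum_(w in [set: word]) (Num.max (u w) 0)%:E)%E
  - fine (\esum_(w in [set: word]) (Num.max (- u w) 0)%:E)%E.

(* Conjugate-linear in the first argument. *)
Definition dot f g : C :=
  Complex (wsum (fun w => complex.Re ((f w)^*%C * g w)))
          (wsum (fun w => complex.Im ((f w)^*%C * g w))).

(* Operators are total functions on formal power series; only their values on
   [fock] matter. *)
Definition bounded_op T : Prop :=
  exists M : R, forall h, fock h -> (normsq (T h) <= M%:E * normsq h)%E.

Definition linear_op T : Prop :=
  forall (c : C) f g, fock f -> fock g ->
    T (fun w => c * f w + g w) = (fun w => c * T f w + T g w).

Definition isometry_op T : Prop :=
  forall h, fock h -> normsq (T h) = normsq h.

Definition positive_op T : Prop :=
  forall h, fock h -> 0 <= dot h (T h).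

(* The Hilbert space adjoint of a bounded T, by its coordinates in the
   orthonormal basis: <w, T^* g> = <T w, g>. *)
Definition adj T : fps -> fps := fun g w => dot (T (smono w)) g.

Definition opL F : fps -> fps := fun h => smul F h.
Definition opR F : fps -> fps := fun h => str (opL F (str h)).

Definition shiftL k : fps -> fps := opL (smono [:: k]).

Definition Hinf F : Prop := bounded_op (opL F).
Definition Hinf1 F : Prop :=
  forall h, fock h -> (normsq (opL F h) <= normsq h)%E.

Definition inner F : Prop := isometry_op (opR F).

Definition column_contractive b e : Prop :=
  forall h, fock h -> (normsq (opR b h) + normsq (opR e h) <= normsq h)%E.

Definition column_inner b a : Prop :=
  forall h, fock h -> (normsq (opR b h) + normsq (opR a h) = normsq h)%E.

Definition column_extreme b : Prop :=
  ~ exists e, [/\ Hinf e, e <> (fun=> 0) & column_contractive b e].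

Definition factorable T : Prop :=
  positive_op T /\
  exists2 f, Hinf f & forall h, fock h -> T h = adj (opR f) (opR f h).

Definition is_positive_sqrt T D : Prop :=
  [/\ bounded_op D, linear_op D, positive_op D &
      forall h, fock h -> D (D h) = T h].

(* A positive bounded T has exactly one such square root on [fock]. *)
Definition opsqrt T : fps -> fps :=
  xget (fun h : fps => h) [set D | is_positive_sqrt T D].

Definition dBR_sqrt b : fps -> fps :=
  opsqrt (fun h => h - opR b (adj (opR b) h)).

Definition dBR b : set fps := [set dBR_sqrt b h | h in fock].

(* [dBR_sqrt b] is a co-isometry onto [dBR b] exactly when it is unitary from
   the orthogonal complement of its kernel; [dBR_lift b] is the inverse of that
   unitary, and is unspecified outside [dBR b]. *)
Definition dBR_lift b f : fps :=
  xget (fun=> 0 : C) [set x : fps | [/\ fock x, dBR_sqrt b x = f &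
    forall y, fock y -> dBR_sqrt b y = (fun=> 0) -> dot y x = 0]].

Definition dBR_dot b f g : C := dot (dBR_lift b f) (dBR_lift b g).
Definition dBR_normsq b f : R := complex.Re (dBR_dot b f f).

(* X^w f for X_k the restriction of L_k^*; [dBR b] is invariant under these. *)
Definition bshift w f : fps := foldr (fun k => adj (shiftL k)) f w.

Definition sarason0 b : R :=
  Num.sqrt (1 - absq (b [::])
              - \sum_(k < d) dBR_normsq b (adj (shiftL k) (str b))).

(* Meaningful when b is not column-extreme: then [str b] lies in [dBR b] and the
   argument of the square root in [sarason0 b] is positive. *)
Definition sarason b : fps := fun w =>
  if w is [::] then (sarason0 b)%:C%C
  else - (sarason0 b)%:C%C * dBR_dot b (str b) (bshift w (str b)).

End FockSpace.

Inductive ncexpr (R : realType) (d : nat) : Type :=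
| NCvar of 'I_d
| NCconst of R[i]
| NCadd of ncexpr R d & ncexpr R d
| NCmul of ncexpr R d & ncexpr R d
| NCinv of ncexpr R d.

Section NCRational.
Variables (R : realType) (d : nat).
Local Notation C := R[i].

(* The size n.+1 excludes 0 x 0 matrices, at which every expression would be
   defined. *)
Fixpoint nc_eval n (X : 'I_d -> 'M[C]_n.+1) (e : ncexpr R d) : 'M[C]_n.+1 :=
  match e with
  | NCvar k => X k
  | NCconst c => c%:M
  | NCadd e1 e2 => nc_eval X e1 + nc_eval X e2
  | NCmul e1 e2 => nc_eval X e1 *m nc_eval X e2
  | NCinv e1 => invmx (nc_eval X e1)
  end.

Fixpoint nc_dom n (X : 'I_d -> 'M[C]_n.+1) (e : ncexpr R d) : bool :=
  match e with
  | NCvar _ | NCconst _ => true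
  | NCadd e1 e2 | NCmul e1 e2 => nc_dom X e1 && nc_dom X e2
  | NCinv e1 => nc_dom X e1 && (nc_eval X e1 \in unitmx)
  end.

Definition series_partial n (s : fps R d) (X : 'I_d -> 'M[C]_n.+1) (N : nat)
    : 'M[C]_n.+1 :=
  \sum_(m < N) \sum_(t : m.-tuple 'I_d) s t *: \prod_(k <- t) X k.

(* s is the power series at 0 of e: for each matrix size, e is defined near 0 and
   is there the sum of the series. *)
Definition nc_power_series_at0 (e : ncexpr R d) (s : fps R d) : Prop :=
  forall n : nat, exists2 eps : R, 0 < eps &
    forall X : 'I_d -> 'M[C]_n.+1,
      (forall k i j, `|X k i j| < eps%:C%C) ->
      nc_dom X e /\
      forall i j, (fun N => series_partial s X N i j : C^o) @ \oo
                    --> (nc_eval X e i j : C^o).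

(* A rational function (a class of valid expressions) has 0 in its domain iff
   some representative e is defined at 0, and such an e is valid and agrees with
   the function near 0, hence has the same power series. *)
Definition nc_rational (s : fps R d) : Prop :=
  exists e : ncexpr R d,
    nc_dom (fun=> 0 : 'M[C]_1) e /\ nc_power_series_at0 e s.

End NCRational.

(* Main.v *)
Require Import Defs.
From HB Require Import structures.
From mathcomp Require Import all_boot all_order all_algebra.
From mathcomp Require Import complex.
From mathcomp Require Import all_classical all_reals all_analysis.
From mathcomp Require Import ring lra.

(** Let [beta] be the reversal of [b].  Then [opR b] is right multiplication by
[beta], a contraction B of the Fock space with adjoint B'.  Let D be the positive
square root of 1 - BB', let S_k be the backward shifts and let (f|h) be the inner
product of the range of D, transported from the closure of this range.  The
operator B' commutes with the S_k, and the constant term of B'g is <beta,g>.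
Therefore

  |Dg|^2 + |<beta,g>|^2 = |g(0)|^2 + sum_k |D S_k g|^2,

which says that the pair of Dg and <beta,g> is mapped isometrically to the
components g(0), D S_1 g, ..., D S_d g.  Computing the adjoint of this isometry
([ip_lift_correction]) leads to the identity [lift_colligation]

  (f|h) = conj f(0) h(0) + sum_k (S_k f|S_k h) + conj phi(f) phi(h),

where phi(f) = sqrt q (beta|f) and q = 1 - |beta(0)|^2 - sum_k (S_k beta|S_k beta)
is non-negative.  The Sarason function has the constant term sqrt q, and its
reversal [alphaF] has the shifts S_k alpha = - Phi(S_k beta), where Phi(f) is the
series with the coefficients phi(S_w f).

Rationality makes the shifts of [beta] by all words span a space of finite
dimension ([nc_rational_recognizable]).  This is used twice.

First, on a space of finite dimension the norm of the range of D is bounded by a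
multiple of the Fock norm ([finite_dim_bounded]).  Iterating the identity above
over words of length N leaves a remainder controlled by the part of f and h
carried by words of length at least N, which tends to zero, so that
(f|h) = <f,h> + <Phi f,Phi h> ([lift_dot]).  Inserting the shifts of [beta] shows
that <beta,S_v beta> + <alpha,S_v alpha> is 1 for the empty word v and 0 for all
others ([column_orthonormal]).  Hence the multiples of the column by distinct words
are orthonormal, and the column is inner ([column_isometry]).  If q = 0 then the
Sarason function vanishes and [b] itself is inner; if q > 0 then the Sarason
function is not zero and shows that [b] is not column-extreme.

Second, Phi commutes with the shifts, so the series [alphaF] lies in a
shift-invariant space of finite dimension.  A basis of this space solves a linear
system with polynomial coefficients, and Gaussian elimination ([rational_system])
turns the solution into a rational expression.

Expressions and series are related through [formal_series]: near the origin an
expression is the sum of its formal series, because the coefficients of the latter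
grow at most geometrically ([nc_power_series_ser]), and evaluation at nilpotent
matrices shows that no other series has this property ([power_series_unique]). *)

Set Implicit Arguments.
Unset Strict Implicit.
Unset Printing Implicit Defensive.

Import Order.TTheory GRing.Theory Num.Theory.
Import numFieldNormedType.Exports.
Local Open Scope classical_set_scope.
Local Open Scope ring_scope.

(** * Sums over words *)

Section LevelSums.
Variables (d : nat) (V : nmodType).
Implicit Types (u v : word d -> V).

Definition level_sum m u : V := \sum_(t : m.-tuple 'I_d) u t.
Definition trunc_sum N u : V := \sum_(m < N) level_sum m u.

Lemma level_sum0 u : level_sum 0 u = u [::].
Proof.
rewrite /level_sum (big_pred1 [tuple]) // => t /=.
by rewrite tuple0; apply/esym/eqP.
Qed.

Lemma level_sumS m u :
  level_sum m.+1 u = \sum_(k < d) level_sum m (fun w => u (k :: w)).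
Proof.
rewrite /level_sum pair_big /=.
rewrite (reindex (fun p : 'I_d * m.-tuple 'I_d => [tuple of p.1 :: p.2])) //=.
exists (fun t : m.+1.-tuple 'I_d => (thead t, [tuple of behead t])).
  by move=> [k t] _ /=; congr pair; apply: val_inj.
by move=> t _ /=; rewrite [RHS]tuple_eta; apply: val_inj.
Qed.

Lemma trunc_sum0 u : trunc_sum 0 u = 0.
Proof. by rewrite /trunc_sum big_ord0. Qed.

Lemma trunc_sumSr N u : trunc_sum N.+1 u = trunc_sum N u + level_sum N u.
Proof. by rewrite /trunc_sum big_ord_recr. Qed.

(** Splitting off the first letter is the recursion behind all later
inductions: the shifted families are again indexed by words. *)
Lemma trunc_sumS N u :
  trunc_sum N.+1 u = u [::] + \sum_(k < d) trunc_sum N (fun w => u (k :: w)).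
Proof.
rewrite /trunc_sum big_ord_recl level_sum0; congr (_ + _).
by rewrite exchange_big; apply: eq_bigr => m _; rewrite level_sumS.
Qed.

Lemma eq_trunc_sum N u v : (forall w, (size w < N)%N -> u w = v w) ->
  trunc_sum N u = trunc_sum N v.
Proof.
move=> uv; apply: eq_bigr => m _; apply: eq_bigr => t _.
by apply: uv; rewrite size_tuple.
Qed.

Lemma trunc_sumD N u v :
  trunc_sum N (fun w => u w + v w) = trunc_sum N u + trunc_sum N v.
Proof.
by rewrite -big_split; apply: eq_bigr => m _; rewrite -big_split.
Qed.

Lemma level_sum_rev m u : level_sum m (fun w => u (rev w)) = level_sum m u.
Proof.
rewrite /level_sum [RHS](reindex (fun t : m.-tuple 'I_d => [tuple of rev t])) //=.
by exists (fun t : m.-tuple 'I_d => [tuple of rev t]) => t _;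
  apply: val_inj; rewrite /= revK.
Qed.

Lemma trunc_sum_rev N u : trunc_sum N (fun w => u (rev w)) = trunc_sum N u.
Proof. by apply: eq_bigr => m _; exact: level_sum_rev. Qed.

End LevelSums.

Lemma raddf_level_sum (d : nat) (V W : nmodType) (F : V -> W) m u :
  F 0 = 0 -> {morph F : x y / x + y} ->
  F (level_sum m u) = level_sum m (fun w : word d => F (u w)).
Proof. by move=> F0 FD; rewrite /level_sum (big_morph F FD F0). Qed.

Lemma raddf_trunc_sum (d : nat) (V W : nmodType) (F : V -> W) N u :
  F 0 = 0 -> {morph F : x y / x + y} ->
  F (trunc_sum N u) = trunc_sum N (fun w : word d => F (u w)).
Proof.
move=> F0 FD; rewrite /trunc_sum (big_morph F FD F0).
by apply: eq_bigr => m _; exact: raddf_level_sum.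
Qed.

Section RealSums.
Variables (R : realType) (d : nat).
Implicit Types (u v : word d -> R).

Lemma level_sum_ge0 m u : (forall w, 0 <= u w) -> 0 <= level_sum m u.
Proof. by move=> u0; apply: sumr_ge0. Qed.

Lemma trunc_sum_ge0 N u : (forall w, 0 <= u w) -> 0 <= trunc_sum N u.
Proof. by move=> u0; apply: sumr_ge0 => m _; exact: level_sum_ge0. Qed.

Lemma le_level_sum m u v : (forall w, u w <= v w) ->
  level_sum m u <= level_sum m v.
Proof. by move=> uv; apply: ler_sum. Qed.

Lemma le_trunc_sum N u v : (forall w, u w <= v w) ->
  trunc_sum N u <= trunc_sum N v.
Proof. by move=> uv; apply: ler_sum => m _; exact: le_level_sum. Qed.

Lemma trunc_sum_nd u : (forall w, 0 <= u w) ->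
  nondecreasing_seq (fun N => trunc_sum N u).
Proof.
move=> u0; apply/nondecreasing_seqP => N.
by rewrite trunc_sumSr lerDl level_sum_ge0.
Qed.

(** Words of bounded length are finitely many, so sums over words ordered by
length compute the unordered sums of nonnegative families. *)
Lemma esum_trunc u : (forall w, 0 <= u w) ->
  (fun N => (trunc_sum N u)%:E) @ \oo -->
    (\esum_(w in [set: word d]) (u w)%:E)%E.
Proof.
move=> u0.
pose J m : set (word d) := [set w | size w = m].
have tJ : trivIset setT J by move=> i j _ _ [w [<- <-]].
have -> : [set: word d] = \bigcup_m J m.
  by apply/seteqP; split => // w _; exists (size w).
rewrite esum_bigcupT; [|exact: tJ|by move=> w; rewrite lee_fin].
rewrite -nneseries_esumT; last by move=> m; apply: esum_ge0 => w _; rewrite /= lee_fin.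
have eJ m : (\esum_(w in J m) (u w)%:E = (level_sum m u)%:E)%E.
  have eJ : J m = [set val t | t in [set: m.-tuple 'I_d]].
    apply/seteqP; split=> w /=; last by move=> [t _ <-]; exact: size_tuple.
    by move=> wm; exists (Tuple (introT eqP wm)).
  rewrite eJ esum_image; last by move=> x y _ _; exact: val_inj.
  rewrite esum_fset; [|exact: finite_finset|by move=> t _; rewrite lee_fin].
  rewrite /level_sum -sumEFin (fsbig_seq _ _ (index_enum_uniq _)).
  congr (\sum_(t \in _) _)%E.
  by apply/seteqP; split=> t //= _; exact: mem_index_enum.
have cvgS := @is_cvg_nneseries R (fun m => \esum_(w in J m) (u w)%:E)%E predT 0.
have esJ0 k : (0 <= \esum_(w in J k) (u w)%:E)%E.
  by apply: esum_ge0 => w _; rewrite /= lee_fin.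
apply: cvg_trans; last exact: (cvgS (fun m _ _ => esJ0 m)).
apply: near_eq_cvg; apply: nearW => N /=.
rewrite big_mkord /trunc_sum -sumEFin.
by apply: eq_bigr => m _; rewrite eJ.
Qed.

End RealSums.

(** * Complex numbers and the inner product of the Fock space *)

Section ComplexFacts.
Variable R : realType.
Local Notation C := R[i].
Implicit Types (z w : C) (x : R).

Lemma absq_ge0 z : 0 <= absq z.
Proof. by rewrite addr_ge0 ?sqr_ge0. Qed.

Lemma absqE z : (absq z)%:C%C = z^*%C * z.
Proof. by case: z => a b; rewrite /absq; simpc; congr Complex => /=; ring. Qed.

Lemma absq0 : absq (0 : C) = 0.
Proof. by rewrite /absq /=; ring. Qed.

Lemma absq_eq0 z : absq z = 0 -> z = 0.
Proof.
case: z => a b /eqP; rewrite /absq /= paddr_eq0 ?sqr_ge0 //.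
by rewrite !sqrf_eq0 => /andP[/eqP -> /eqP ->].
Qed.

Lemma absqM z w : absq (z * w) = absq z * absq w.
Proof. by case: z w => a b [c e]; rewrite /absq /=; ring. Qed.

Lemma absqN z : absq (- z) = absq z.
Proof. by case: z => a b; rewrite /absq /=; ring. Qed.

Lemma absqJ z : absq z^*%C = absq z.
Proof. by case: z => a b; rewrite /absq /=; ring. Qed.

Lemma absqR x : absq x%:C%C = x ^+ 2.
Proof. by rewrite /absq /=; ring. Qed.

Lemma ReD z w : complex.Re (z + w) = complex.Re z + complex.Re w.
Proof. by case: z w => a b []. Qed.

Lemma ImD z w : complex.Im (z + w) = complex.Im z + complex.Im w.
Proof. by case: z w => a b []. Qed.

Lemma ReN z : complex.Re (- z) = - complex.Re z. Proof. by case: z. Qed.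

Lemma ReM z w : complex.Re (z * w) =
  complex.Re z * complex.Re w - complex.Im z * complex.Im w.
Proof. by case: z w => a b []. Qed.

Lemma ImM z w : complex.Im (z * w) =
  complex.Re z * complex.Im w + complex.Im z * complex.Re w.
Proof. by case: z w => a b []. Qed.

Lemma ImJ z : complex.Im z^*%C = - complex.Im z. Proof. by case: z. Qed.

Lemma ReJ z : complex.Re z^*%C = complex.Re z. Proof. by case: z. Qed.

Lemma ReZ x z : complex.Re (x%:C%C * z) = x * complex.Re z.
Proof. by case: z => a b /=; ring. Qed.

Lemma complex_eqP z w :
  complex.Re z = complex.Re w -> complex.Im z = complex.Im w -> z = w.
Proof. by case: z w => a b [a' b'] /= -> ->. Qed.

Lemma conjcM z w : (z * w)^*%C = z^*%C * w^*%C.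
Proof. exact: rmorphM. Qed.

Lemma conjcD z w : (z + w)^*%C = z^*%C + w^*%C.
Proof. exact: rmorphD. Qed.

Lemma le_Re_absq z w :
  `|complex.Re (z^*%C * w)| <= absq z + absq w.
Proof.
case: z w => a b [c e]; rewrite /absq /= ler_norml.
have := (sqr_ge0 (a + c), sqr_ge0 (a - c), sqr_ge0 (b + e), sqr_ge0 (b - e)).
by move=> [[[h1 h2] h3] h4]; apply/andP; split; nra.
Qed.

Lemma le_Im_absq z w :
  `|complex.Im (z^*%C * w)| <= absq z + absq w.
Proof.
case: z w => a b [c e]; rewrite /absq /= ler_norml.
have := (sqr_ge0 (a + e), sqr_ge0 (a - e), sqr_ge0 (b + c), sqr_ge0 (b - c)).
by move=> [[[h1 h2] h3] h4]; apply/andP; split; nra.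
Qed.

(** Convergence of complex sequences is handled componentwise, because the
inner product is given by its real and imaginary parts. *)
Definition cvgC (u : nat -> C) z :=
  (fun n => complex.Re (u n)) @ \oo --> complex.Re z /\
  (fun n => complex.Im (u n)) @ \oo --> complex.Im z.

Lemma cvgC_unique u z w : cvgC u z -> cvgC u w -> z = w.
Proof.
move=> [uz1 uz2] [uw1 uw2].
by apply: complex_eqP; [apply: cvg_unique uz1 uw1|apply: cvg_unique uz2 uw2];
  exact: norm_hausdorff.
Qed.

Lemma cvgC_cst z : cvgC (fun=> z) z.
Proof. by split; exact: cvg_cst. Qed.

Lemma cvgCD u v z w : cvgC u z -> cvgC v w -> cvgC (fun n => u n + v n) (z + w).
Proof.
move=> [uz1 uz2] [vw1 vw2]; split.
  by under eq_fun do rewrite ReD; rewrite ReD; exact: cvgD.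
by under eq_fun do rewrite ImD; rewrite ImD; exact: cvgD.
Qed.

Lemma cvgCZ c u z : cvgC u z -> cvgC (fun n => c * u n) (c * z).
Proof.
move=> [uz1 uz2]; split.
  under eq_fun do rewrite ReM; rewrite ReM.
  by apply: cvgB; apply: cvgMr.
under eq_fun do rewrite ImM; rewrite ImM.
by apply: cvgD; apply: cvgMr.
Qed.

Lemma cvgCJ u z : cvgC u z -> cvgC (fun n => (u n)^*%C) z^*%C.
Proof.
move=> [uz1 uz2]; split.
  by under eq_fun do rewrite ReJ; rewrite ReJ.
by under eq_fun do rewrite ImJ; rewrite ImJ; exact: cvgN.
Qed.

Lemma cvgC_sum (I : Type) (r : seq I) (u : I -> nat -> C) (z : I -> C) :
  (forall i, cvgC (u i) (z i)) ->
  cvgC (fun n => \sum_(i <- r) u i n) (\sum_(i <- r) z i).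
Proof.
move=> uz; elim: r => [|i r IHr].
  rewrite big_nil; under eq_fun do rewrite big_nil.
  exact: cvgC_cst.
rewrite big_cons; under eq_fun do rewrite big_cons.
exact: cvgCD.
Qed.

Lemma cvgC_real (u : nat -> R) x : u @ \oo --> x ->
  cvgC (fun n => (u n)%:C%C) x%:C%C.
Proof. by move=> ux; split => //=; exact: cvg_cst. Qed.

Lemma cvgC_shift u z : cvgC u z -> cvgC (fun n => u n.+1) z.
Proof. by move=> [u1 u2]; split; rewrite (cvg_shiftS (fun n => _ (u n))). Qed.

End ComplexFacts.

Section FockSums.
Variables (R : realType) (d : nat).
Local Notation C := R[i].
Local Notation fps := (fps R d).
Implicit Types f g h : fps.

Definition dotn N f g : C := trunc_sum N (fun w => (f w)^*%C * g w).
Definition nsqn N f : R := trunc_sum N (fun w => absq (f w)).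
Definition nsq f : R := fine (normsq f).
Definition lshift (k : 'I_d) f : fps := fun w => f (k :: w).

Lemma nsqn_nd f : nondecreasing_seq (fun N => nsqn N f).
Proof. by apply: trunc_sum_nd => w; exact: absq_ge0. Qed.

Lemma normsq_ge0 f : (0 <= normsq f)%E.
Proof. by apply: esum_ge0 => w _; rewrite lee_fin absq_ge0. Qed.

Lemma cvg_normsq f : (fun N => (nsqn N f)%:E) @ \oo --> normsq f.
Proof. by apply: esum_trunc => w; exact: absq_ge0. Qed.

Lemma normsqE f : fock f -> normsq f = (nsq f)%:E.
Proof.
move=> ff; rewrite /nsq fineK // fin_numE; apply/andP; split.
  by rewrite gt_eqF // (lt_le_trans _ (normsq_ge0 f)) // ltNy0.
by rewrite lt_eqF.
Qed.

Lemma nsq_ge0 f : 0 <= nsq f.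
Proof. by rewrite /nsq fine_ge0 // normsq_ge0. Qed.

Lemma cvg_nsq f : fock f -> (fun N => nsqn N f) @ \oo --> nsq f.
Proof.
move=> ff; have := @cvg_normsq f; rewrite normsqE //.
by move/fine_cvg.
Qed.

Lemma nsqn_le N f : fock f -> nsqn N f <= nsq f.
Proof.
move=> ff; rewrite -(cvg_lim (@norm_hausdorff _ _) (cvg_nsq ff)).
apply: nondecreasing_cvgn_le; first exact: nsqn_nd.
by apply/cvg_ex; exists (nsq f); exact: cvg_nsq.
Qed.

Lemma fock_bounded f M : (forall N, nsqn N f <= M) -> fock f.
Proof.
move=> fM; apply: (@le_lt_trans _ _ M%:E); last exact: ltry.
rewrite -(cvg_lim (@ereal_hausdorff R) (@cvg_normsq f)).
apply: lime_le; first by apply/cvg_ex; exists (normsq f); exact: cvg_normsq.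
by apply: nearW => N; rewrite lee_fin.
Qed.

Lemma nsq_bounded f M : (forall N, nsqn N f <= M) -> nsq f <= M.
Proof.
move=> fM; have ff := fock_bounded fM.
rewrite -(cvg_lim (@norm_hausdorff _ _) (cvg_nsq ff)).
apply: limr_le; first by apply/cvg_ex; exists (nsq f); exact: cvg_nsq.
exact: nearW.
Qed.

(** Splitting a summable family into its positive and negative parts, the
truncated sums converge to the signed sum whatever the order of summation. *)
Lemma cvg_wsum (u : word d -> R) M :
  (forall N, trunc_sum N (fun w => `|u w|) <= M) ->
  (fun N => trunc_sum N u) @ \oo --> wsum u.
Proof.
move=> uM.
have part (v : word d -> R) : (forall w, 0 <= v w <= `|u w|) ->
    (fun N => trunc_sum N v) @ \oo --> fine (\esum_(w in [set: word d]) (v w)%:E)%E.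
  move=> vu; have v0 w : 0 <= v w by have /andP[] := vu w.
  have ev := esum_trunc v0.
  have fv : \esum_(w in [set: word d]) (v w)%:E \is a fin_num.
    rewrite fin_numE; apply/andP; split.
      rewrite gt_eqF // (@lt_le_trans _ _ 0%E) ?ltNy0 //.
      by apply: esum_ge0 => w _; rewrite lee_fin.
    rewrite lt_eqF // (@le_lt_trans _ _ M%:E) ?ltry //.
    rewrite -(cvg_lim (@ereal_hausdorff R) ev).
    apply: lime_le; first by apply/cvg_ex; eexists; exact: ev.
    apply: nearW => N; rewrite lee_fin (le_trans _ (uM N)) //.
    by apply: le_trunc_sum => w; have /andP[] := vu w.
  by move: ev; rewrite -{1}(fineK fv) => /fine_cvg.
have h1 := part (fun w => Num.max (u w) 0); have h2 := part (fun w => Num.max (- u w) 0).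
have -> : (fun N => trunc_sum N u) = (fun N => trunc_sum N (fun w => Num.max (u w) 0)
   - trunc_sum N (fun w => Num.max (- u w) 0)).
  apply/funext => N; apply/esym/eqP; rewrite subr_eq -trunc_sumD; apply/eqP.
  apply: eq_trunc_sum => w _.
  have [u0|/ltW u0] := leP 0 (u w).
    by rewrite max_r ?addr0 // oppr_le0.
  by rewrite max_l ?subrr // oppr_ge0.
apply: cvgB; [apply: h1|apply: h2] => w;
  rewrite ge_max le_max lexx orbT ?normrN ?ler_norm ?normr_ge0 //=.
by rewrite -normrN ler_norm.
Qed.

Lemma dotn_Re N f g : complex.Re (dotn N f g) =
  trunc_sum N (fun w => complex.Re ((f w)^*%C * g w)).
Proof. by apply: raddf_trunc_sum => //; exact: ReD. Qed.

Lemma dotn_Im N f g : complex.Im (dotn N f g) =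
  trunc_sum N (fun w => complex.Im ((f w)^*%C * g w)).
Proof. by apply: raddf_trunc_sum => //; exact: ImD. Qed.

(** Every identity for [dot] is obtained from the finite sums [dotn] by
passing to the limit. *)
Lemma cvg_dot f g : fock f -> fock g -> cvgC (fun N => dotn N f g) (dot f g).
Proof.
move=> ff fg; split => /=.
  under eq_fun do rewrite dotn_Re.
  apply: (@cvg_wsum _ (nsq f + nsq g)) => N.
  apply: le_trans (lerD (nsqn_le N ff) (nsqn_le N fg)).
  by rewrite -trunc_sumD; apply: le_trunc_sum => w; exact: le_Re_absq.
under eq_fun do rewrite dotn_Im.
apply: (@cvg_wsum _ (nsq f + nsq g)) => N.
apply: le_trans (lerD (nsqn_le N ff) (nsqn_le N fg)).
by rewrite -trunc_sumD; apply: le_trunc_sum => w; exact: le_Im_absq.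
Qed.

Lemma dotn_nsqn N f : dotn N f f = (nsqn N f)%:C%C.
Proof.
rewrite /nsqn raddf_trunc_sum //; last by move=> x y; rewrite rmorphD.
by apply: eq_trunc_sum => w _; rewrite absqE.
Qed.

Lemma dot_nsq f : fock f -> dot f f = (nsq f)%:C%C.
Proof.
move=> ff; apply: cvgC_unique (cvg_dot ff ff) _.
by under eq_fun do rewrite dotn_nsqn; apply: cvgC_real; exact: cvg_nsq.
Qed.

Lemma dotnJ N f g : dotn N g f = (dotn N f g)^*%C.
Proof.
rewrite /dotn [RHS](@raddf_trunc_sum d C C) ?conjc0 //; last exact: rmorphD.
by apply: eq_trunc_sum => w _; rewrite rmorphM /= conjcK mulrC.
Qed.

Lemma dotJ f g : fock f -> fock g -> dot g f = (dot f g)^*%C.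
Proof.
move=> ff fg; apply: cvgC_unique (cvg_dot fg ff) _.
by under eq_fun do rewrite dotnJ; apply: cvgCJ; exact: cvg_dot.
Qed.

Lemma absqD_le (z w : C) : absq (z + w) <= 2 * absq z + 2 * absq w.
Proof.
case: z w => a b [c e]; rewrite /absq /=.
by have := (sqr_ge0 (a - c), sqr_ge0 (b - e)) => -[]; lra.
Qed.

Lemma nsqnZ N c f : nsqn N (fun w => c * f w) = absq c * nsqn N f.
Proof.
rewrite /nsqn [RHS](@raddf_trunc_sum d R R) ?mulr0 //; last exact: mulrDr.
by apply: eq_trunc_sum => w _; rewrite absqM.
Qed.

Lemma nsqnD_le N f g :
  nsqn N (fun w => f w + g w) <= 2 * nsqn N f + 2 * nsqn N g.
Proof.
rewrite {2 3}/nsqn (@raddf_trunc_sum d R R (fun x => 2 * x)) ?mulr0 //;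
  last exact: mulrDr.
rewrite (@raddf_trunc_sum d R R (fun x => 2 * x)) ?mulr0 //; last exact: mulrDr.
by rewrite -trunc_sumD; apply: le_trunc_sum => w; exact: absqD_le.
Qed.

Lemma fock_lin c f g : fock f -> fock g -> fock (fun w => c * f w + g w).
Proof.
move=> ff fg; apply: (@fock_bounded _ (2 * (absq c * nsq f) + 2 * nsq g)) => N.
apply: (le_trans (nsqnD_le _ _ _)); rewrite nsqnZ.
by rewrite lerD // ler_pM2l // ?ler_wpM2l ?absq_ge0 // nsqn_le.
Qed.

Lemma fock0 : fock ((fun=> 0) : fps).
Proof.
apply: (@fock_bounded _ 0) => N; rewrite /nsqn /trunc_sum big1 // => m _.
by rewrite /level_sum big1 // => t _; rewrite absq0.
Qed.

Lemma nsqnS N f : nsqn N.+1 f = absq (f [::]) + \sum_(k < d) nsqn N (lshift k f).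
Proof. exact: trunc_sumS. Qed.

Lemma dotnS N f g : dotn N.+1 f g =
  (f [::])^*%C * g [::] + \sum_(k < d) dotn N (lshift k f) (lshift k g).
Proof. exact: trunc_sumS. Qed.

Lemma nsqn_ge0 N f : 0 <= nsqn N f.
Proof. by apply: trunc_sum_ge0 => w; exact: absq_ge0. Qed.

Lemma fock_lshift k f : fock f -> fock (lshift k f).
Proof.
move=> ff; apply: (@fock_bounded _ (nsq f)) => N.
apply: le_trans (nsqn_le N.+1 ff); rewrite nsqnS (bigD1 k) //=.
rewrite addrCA lerDl addr_ge0 ?absq_ge0 //.
by apply: sumr_ge0 => j _; exact: nsqn_ge0.
Qed.

Lemma dotn_lin N c f g h :
  dotn N f (fun w => c * g w + h w) = c * dotn N f g + dotn N f h.
Proof.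
rewrite /dotn [c * _](@raddf_trunc_sum d C C) ?mulr0 //; last exact: mulrDr.
rewrite -trunc_sumD; apply: eq_trunc_sum => w _; ring.
Qed.

Lemma dot_lin c f g h : fock f -> fock g -> fock h ->
  dot f (fun w => c * g w + h w) = c * dot f g + dot f h.
Proof.
move=> ff fg fh; apply: cvgC_unique (cvg_dot ff (fock_lin c fg fh)) _.
under eq_fun do rewrite dotn_lin.
by apply: cvgCD; [apply: cvgCZ|]; exact: cvg_dot.
Qed.

(** Words are empty or begin with a letter, so the Fock space is the sum of the
constants and of [d] copies of itself. *)
Lemma dot_shift f g : fock f -> fock g -> dot f g =
  (f [::])^*%C * g [::] + \sum_(k < d) dot (lshift k f) (lshift k g).
Proof.
move=> ff fg; apply: cvgC_unique (cvgC_shift (cvg_dot ff fg)) _.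
under eq_fun do rewrite dotnS.
apply: cvgCD; first exact: cvgC_cst.
by apply: cvgC_sum => k; apply: cvg_dot; exact: fock_lshift.
Qed.

Lemma absq_le_nsq f w : fock f -> absq (f w) <= nsq f.
Proof.
move=> ff; apply: le_trans (nsqn_le (size w).+1 ff).
rewrite /nsqn trunc_sumSr /level_sum.
have -> : w = (tval (in_tuple w)) by [].
rewrite (bigD1 (in_tuple w)) //= addrCA lerDl addr_ge0 ?nsqn_ge0 //.
by apply: sumr_ge0 => t _; exact: absq_ge0.
Qed.

End FockSums.

(** * Hilbert spaces and square roots *)

Section LinearFunctions.
Variables (K : pzRingType) (V W : lmodType K) (T : V -> W).
Hypothesis T_lin : linear T.

Lemma lin0 : T 0 = 0.
Proof. by have := T_lin (-1) 0 0; rewrite scaler0 addr0 scaleN1r addNr. Qed.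

Lemma linZ c x : T (c *: x) = c *: T x.
Proof. by have := T_lin c x 0; rewrite !addr0 lin0 addr0. Qed.

Lemma linD x y : T (x + y) = T x + T y.
Proof. by have := T_lin 1 x y; rewrite !scale1r. Qed.

Lemma linB x y : T (x - y) = T x - T y.
Proof. by rewrite -scaleN1r linD linZ scaleN1r. Qed.

End LinearFunctions.

Record hilbert (R : realType) := Hilbert {
  hcarrier :> lmodType R[i];
  ip : hcarrier -> hcarrier -> R[i];
  ip_linr : forall c x y z, ip x (c *: y + z) = c * ip x y + ip x z;
  ipC : forall x y, ip y x = (ip x y)^*%C;
  ip_ge0 : forall x, 0 <= complex.Re (ip x x);
  ip_eq0 : forall x, complex.Re (ip x x) = 0 -> x = 0;
  ip_complete : forall u : nat -> hcarrier,
    (forall e, 0 < e -> exists N, forall m n, (N <= m)%N -> (N <= n)%N ->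
       complex.Re (ip (u m - u n) (u m - u n)) < e) ->
    exists x, forall e, 0 < e -> exists N, forall n, (N <= n)%N ->
       complex.Re (ip (u n - x) (u n - x)) < e }.

#[global] Arguments ip : simpl never.

Section HilbertTheory.
Variables (R : realType) (H : hilbert R).
Local Notation C := R[i].
Implicit Types (x y z : H) (c : C).

Definition sq x : R := complex.Re (ip x x).
Definition hn x : R := Num.sqrt (sq x).

Lemma ipDr x y z : ip x (y + z) = ip x y + ip x z.
Proof. by have := ip_linr 1 x y z; rewrite scale1r mul1r. Qed.

Lemma ip0r x : ip x 0 = 0.
Proof. by apply: (@addrI _ (ip x 0)); rewrite -ipDr !addr0. Qed.

Lemma ipZr c x y : ip x (c *: y) = c * ip x y.
Proof. by have := ip_linr c x y 0; rewrite ip0r !addr0. Qed.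

Lemma ipNr x y : ip x (- y) = - ip x y.
Proof. by rewrite -scaleN1r ipZr mulN1r. Qed.

Lemma ipBr x y z : ip x (y - z) = ip x y - ip x z.
Proof. by rewrite ipDr ipNr. Qed.

Lemma ipDl x y z : ip (x + y) z = ip x z + ip y z.
Proof. by rewrite ipC ipDr rmorphD /= -!ipC. Qed.

Lemma ipZl c x y : ip (c *: x) y = c^*%C * ip x y.
Proof. by rewrite ipC ipZr rmorphM /= -ipC. Qed.

Lemma ip0l x : ip 0 x = 0.
Proof. by rewrite ipC ip0r conjc0. Qed.

Lemma ipNl x y : ip (- x) y = - ip x y.
Proof. by rewrite ipC ipNr rmorphN /= -ipC. Qed.

Lemma ipBl x y z : ip (x - y) z = ip x z - ip y z.
Proof. by rewrite ipDl ipNl. Qed.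

Lemma ip_sumr (I : Type) (r : seq I) (P : pred I) x (F : I -> H) :
  ip x (\sum_(i <- r | P i) F i) = \sum_(i <- r | P i) ip x (F i).
Proof. exact: (big_morph (ip x) (ipDr x) (ip0r x)). Qed.

Lemma sq_ge0 x : 0 <= sq x. Proof. exact: ip_ge0. Qed.

Lemma ip_sq x : ip x x = (sq x)%:C%C.
Proof.
apply: complex_eqP => //=.
have := congr1 (@complex.Im R) (ipC x x); rewrite ImJ => /eqP.
by rewrite -addr_eq0 -mulr2n mulrn_eq0 /= => /eqP.
Qed.

Lemma sqZ c x : sq (c *: x) = absq c * sq x.
Proof.
rewrite /sq ipZl ipZr ip_sq mulrA -absqE.
by rewrite -rmorphM.
Qed.

Lemma sqN x : sq (- x) = sq x.
Proof. by rewrite /sq ipNl ipNr opprK. Qed.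

Lemma sqD x y : sq (x + y) = sq x + 2 * complex.Re (ip x y) + sq y.
Proof. rewrite /sq ipDl !ipDr !ReD [ip y x]ipC ReJ; ring. Qed.

Lemma sqB x y : sq (x - y) = sq x - 2 * complex.Re (ip x y) + sq y.
Proof. rewrite sqD sqN ipNr ReN; ring. Qed.

Lemma sq0 : sq 0 = 0. Proof. by rewrite /sq ip0r. Qed.

Lemma cauchy_schwarz x y : absq (ip x y) <= sq x * sq y.
Proof.
have [y0|y0] := eqVneq (sq y) 0.
  by rewrite (ip_eq0 y0) ip0r absq0 sq0 mulr0.
have yp : 0 < sq y by rewrite lt_def y0 sq_ge0.
have := sq_ge0 ((sq y)%:C%C *: x - ip y x *: y).
rewrite sqB !sqZ ipZl ipZr [ip y x]ipC absqJ absqR conjc_real.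
rewrite -absqE -rmorphM /=.
have -> : sq y ^+ 2 * sq x - 2 * (sq y * absq (ip x y)) + absq (ip x y) * sq y
  = sq y * (sq x * sq y - absq (ip x y)) by ring.
by rewrite pmulr_rge0 // subr_ge0.
Qed.

Lemma hn_ge0 x : 0 <= hn x. Proof. exact: sqrtr_ge0. Qed.

Lemma hn_sq x : hn x ^+ 2 = sq x.
Proof. by rewrite sqr_sqrtr ?sq_ge0. Qed.

Lemma hn0 : hn 0 = 0. Proof. by rewrite /hn sq0 sqrtr0. Qed.

Lemma hn_eq0 x : hn x = 0 -> x = 0.
Proof. by move=> x0; apply: ip_eq0; rewrite -/(sq x) -hn_sq x0 expr0n. Qed.

Lemma hnN x : hn (- x) = hn x. Proof. by rewrite /hn sqN. Qed.

Lemma hn_distC x y : hn (x - y) = hn (y - x).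
Proof. by rewrite -hnN opprB. Qed.

Lemma hnZ c x : hn (c *: x) = Num.sqrt (absq c) * hn x.
Proof. by rewrite /hn sqZ sqrtrM // absq_ge0. Qed.

Lemma hnZR (a : R) x : hn (a%:C%C *: x) = `|a| * hn x.
Proof. by rewrite hnZ absqR sqrtr_sqr. Qed.

Lemma sqrt_absq_ip x y : Num.sqrt (absq (ip x y)) <= hn x * hn y.
Proof.
by rewrite /hn -sqrtrM ?sq_ge0 // ler_wsqrtr // cauchy_schwarz.
Qed.

Lemma normRe_le c : `|complex.Re c| <= Num.sqrt (absq c).
Proof.
by rewrite -sqrtr_sqr ler_wsqrtr // /absq lerDl sqr_ge0.
Qed.

Lemma normRe_ip x y : `|complex.Re (ip x y)| <= hn x * hn y.
Proof. exact: le_trans (normRe_le _) (sqrt_absq_ip _ _). Qed.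

Lemma hnD x y : hn (x + y) <= hn x + hn y.
Proof.
rewrite -(@ler_pXn2r _ 2) ?nnegrE ?addr_ge0 ?hn_ge0 //.
rewrite hn_sq sqD sqrrD !hn_sq.
have := le_trans (ler_norm _) (normRe_ip x y).
by move=> ?; lra.
Qed.

Lemma hnB x y : hn (x - y) <= hn x + hn y.
Proof. by rewrite (le_trans (hnD _ _)) // hnN. Qed.

Lemma hn_tri y x z : hn (x - z) <= hn (x - y) + hn (y - z).
Proof. by rewrite (_ : x - z = (x - y) + (y - z)) ?hnD // addrA subrK. Qed.

Lemma le_hn x y : (hn x <= hn y) = (sq x <= sq y).
Proof. by rewrite -!hn_sq ler_pXn2r ?nnegrE ?hn_ge0. Qed.

Lemma ip_ext x y : (forall z, complex.Re (ip z x) = complex.Re (ip z y)) -> x = y.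
Proof.
move=> xy; apply/eqP; rewrite -subr_eq0; apply/eqP/ip_eq0.
by rewrite ipBr ReD ReN xy subrr.
Qed.

Lemma ip_extC x y : (forall z, ip z x = ip z y) -> x = y.
Proof. by move=> xy; apply: ip_ext => z; rewrite xy. Qed.

(** Vectors are compared by bounding the norm of their difference by a fixed
multiple of a sequence that becomes arbitrarily small. *)
Lemma hn_small x (A : R) (r : nat -> R) :
  (forall e, 0 < e -> exists n, r n < e) ->
  0 <= A -> (forall n, hn x <= A * r n) -> x = 0.
Proof.
move=> r0 A0 xr; apply: hn_eq0; apply/eqP; rewrite eq_le hn_ge0 andbT.
apply/ler_addgt0Pr => e e0; rewrite add0r.
have A1 : 0 < A + 1 by lra.
have [n rn] := r0 (e / (A + 1)) (divr_gt0 e0 A1).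
apply: (le_trans (xr n)).
have [rn0|rn0] := leP 0 (r n); last by rewrite (le_trans _ (ltW e0)) // mulr_ge0_le0 // ltW.
apply: (@le_trans _ _ ((A + 1) * r n)); first by nra.
by rewrite mulrC -ler_pdivlMr // ltW.
Qed.

Lemma hn_complete (u : nat -> H) :
  (forall e, 0 < e -> exists N, forall m n, (N <= m)%N -> (N <= n)%N ->
     hn (u m - u n) < e) ->
  exists x, forall e, 0 < e -> exists N, forall n, (N <= n)%N -> hn (u n - x) < e.
Proof.
have sq_lt (y : H) e : 0 < e -> (hn y < e) = (sq y < e ^+ 2).
  by move=> e0; rewrite -hn_sq ltr_pXn2r ?nnegrE ?hn_ge0 // ltW.
move=> uC; have [e e0|x xP] := @ip_complete R H u.
  have [N NP] := uC (Num.sqrt e) (etrans (sqrtr_gt0 e) e0).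
  exists N => m n Nm Nn; have := NP m n Nm Nn.
  by rewrite sq_lt ?sqrtr_gt0 // sqr_sqrtr // ltW.
exists x => e e0; have [N NP] := xP (e ^+ 2) (exprn_gt0 _ e0).
by exists N => n Nn; rewrite sq_lt //; exact: NP.
Qed.

End HilbertTheory.

(** Linear identities between vectors, by testing against all vectors. *)
Ltac vec :=
  let z := fresh "z" in
  apply: ip_extC => z; rewrite ?(ipDr, ipNr, ipZr, ip0r); ring.

Section SquareRoot.
Variables (R : realType) (H : hilbert R) (G : H -> H).
Hypotheses (Glin : linear G) (Gsa : forall x y, ip (G x) y = ip x (G y))
  (Gcontr : forall x, hn (G x) <= hn x).
Local Notation C := R[i].

(** If [Y = (G + Y ^ 2) / 2] then [(1 - Y) ^ 2 = 1 - G], so a square root of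
[1 - G] comes from iterating this equation from [0]. *)
Fixpoint sqrt_iter n (x : H) : H :=
  if n is m.+1 then (2^-1 : R)%:C%C *: (G x + sqrt_iter m (sqrt_iter m x)) else 0.

(** The same iteration for [G = 1] on the line; it dominates the operator
iteration in norm. *)
Fixpoint sqrt_rate n : R := if n is m.+1 then (1 + sqrt_rate m ^+ 2) / 2 else 0.

Local Notation Y := sqrt_iter.
Local Notation t := sqrt_rate.

Lemma sqrt_rate_bound n : 0 <= t n <= 1.
Proof. by elim: n => [|n /andP[t0 t1]] /=; apply/andP; split => //; nra. Qed.

Lemma sqrt_rate_nd n : t n <= t n.+1.
Proof.
have /andP[t0 t1] := sqrt_rate_bound n.
by rewrite /=; have := sqr_ge0 (t n - 1); nra.
Qed.

Lemma sqrt_iter_lin n : linear (Y n).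
Proof.
elim: n => [|n IHn] c x y /=; first by rewrite scaler0 addr0.
rewrite Glin !IHn; vec.
Qed.

Lemma sqrt_iter_sa n x y : ip (Y n x) y = ip x (Y n y).
Proof.
elim: n x y => [|n IHn] x y /=; first by rewrite ip0l ip0r.
by rewrite ipZl ipZr conjc_real ipDl ipDr Gsa !IHn.
Qed.

Lemma normr_half : `|2^-1 : R| = 2^-1.
Proof. by rewrite ger0_norm // invr_ge0. Qed.

Lemma sqrt_iter_bound n x : hn (Y n x) <= t n * hn x.
Proof.
elim: n x => [|n IHn] x /=; first by rewrite hn0 mul0r.
rewrite hnZR normr_half.
have h1 := hnD (G x) (Y n (Y n x)); have h2 := Gcontr x.
have h3 := IHn (Y n x); have h4 := IHn x; have /andP[t0 t1] := sqrt_rate_bound n.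
have h5 : t n * hn (Y n x) <= t n * (t n * hn x) by rewrite ler_wpM2l.
by lra.
Qed.

(** The difference of two consecutive squares factors without any
commutation, as [Y' (Y' - Y) + (Y' - Y) Y], and its norm telescopes along
the scalar iteration. *)
Lemma sqrt_iter_step n x : hn (Y n.+1 x - Y n x) <= (t n.+1 - t n) * hn x.
Proof.
elim: n x => [|n IHn] x.
  rewrite /= subr0 addr0 hnZR normr_half expr0n addr0 subr0 mul1r.
  by rewrite ler_wpM2l ?invr_ge0.
have -> : Y n.+2 x - Y n.+1 x = (2^-1 : R)%:C%C *:
    (Y n.+1 (Y n.+1 x - Y n x) + (Y n.+1 (Y n x) - Y n (Y n x))).
  rewrite (linB (@sqrt_iter_lin _)) addrA subrK [LHS]/= -scalerBr; congr (_ *: _).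
  by rewrite opprD addrACA subrr add0r.
rewrite hnZR normr_half.
have h1 := hnD (Y n.+1 (Y n.+1 x - Y n x)) (Y n.+1 (Y n x) - Y n (Y n x)).
have h2 := sqrt_iter_bound n.+1 (Y n.+1 x - Y n x).
have h3 := IHn x; have h4 := IHn (Y n x); have h5 := sqrt_iter_bound n x.
have /andP[p0 p1] := sqrt_rate_bound n.+1; have h6 := sqrt_rate_nd n.
have h7 := ler_wpM2l p0 h3.
have h8 : (t n.+1 - t n) * hn (Y n x) <= (t n.+1 - t n) * (t n * hn x).
  by rewrite ler_wpM2l // subr_ge0.
have -> : t n.+2 = (1 + t n.+1 ^+ 2) / 2 by [].
have {2}-> : t n.+1 = (1 + t n ^+ 2) / 2 by [].
move: h1 h2 h7 h8 h4; set a := t n.+1; set b := t n; set X := hn x; lra.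
Qed.

Lemma sqrt_iter_cauchy m n x : hn (Y (n + m) x - Y n x) <= (t (n + m) - t n) * hn x.
Proof.
elim: m => [|m IHm]; first by rewrite addn0 !subrr hn0 mul0r.
rewrite addnS; apply: le_trans (hn_tri (Y (n + m) x) _ _) _.
have := sqrt_iter_step (n + m) x; lra.
Qed.

Lemma sqrt_rate_cvg : exists T, (forall n, t n <= T) /\
  (forall e, 0 < e -> exists n, T - t n < e).
Proof.
have tnd : nondecreasing_seq t by apply/nondecreasing_seqP; exact: sqrt_rate_nd.
have tc : cvgn t.
  apply: nondecreasing_is_cvgn => //; exists 1 => _ [n _ <-].
  by have /andP[] := sqrt_rate_bound n.
exists (limn t); split=> [n|e e0]; first exact: nondecreasing_cvgn_le.
have /cvgrPdist_lt/(_ e e0) [N _ NP] := tc.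
by exists N; have := NP N (leqnn N); apply: le_lt_trans; exact: ler_norm.
Qed.

(** The iterates converge in operator norm at the rate of the scalar ones, so
their limit inherits linearity, self-adjointness and the bound [1] on its
norm; the latter makes [1 - Y] positive. *)
Theorem exists_sqrt : exists D : H -> H, [/\ linear D,
  forall x y, ip (D x) y = ip x (D y), forall x, hn (D x) <= 2 * hn x,
  forall x, 0 <= complex.Re (ip x (D x)) & forall x, D (D x) = x - G x].
Proof.
have [T [tT Tt]] := sqrt_rate_cvg.
have limY x : exists y, forall n, hn (y - Y n x) <= (T - t n) * hn x.
  have [|y yP] := @hn_complete _ H (fun n => Y n x).
    move=> e e0; have x1 : 0 < hn x + 1 by have := hn_ge0 x; lra.
    have [N NP] := Tt (e / (hn x + 1)) (divr_gt0 e0 x1).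
    have NPx : (T - t N) * hn x < e.
      apply: (@le_lt_trans _ _ ((T - t N) * (hn x + 1))).
        by have := tT N; nra.
      by rewrite -ltr_pdivlMr.
    exists N => m n.
    wlog nm : m n / (n <= m)%N.
      move=> W Nm Nn; have [|/ltnW] := leqP n m; first by move/W; exact.
      by move/W => /(_ Nn Nm); rewrite hn_distC.
    move=> _ Nn; have := sqrt_iter_cauchy (m - n) n x; rewrite subnKC // => h.
    apply: (le_lt_trans h); apply: le_lt_trans NPx; rewrite ler_wpM2r ?hn_ge0 //.
    have tn : t N <= t n.
      by have /nondecreasing_seqP tnd := sqrt_rate_nd; exact: tnd.
    by have := tT m; lra.
  exists y => n; apply/ler_addgt0Pr => e e0; have [N NP] := yP e e0.
  have := NP (n + N)%N (leq_addl _ _) => /ltW h.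
  apply: (le_trans (hn_tri (Y (n + N) x) _ _)).
  rewrite addrC lerD //; last by rewrite hn_distC.
  apply: (le_trans (sqrt_iter_cauchy _ _ _)); rewrite ler_wpM2r ?hn_ge0 //.
  by rewrite lerD2r.
have [Yl YlP] := choice limY.
have Yl_lin : linear Yl.
  move=> c x y; apply/eqP; rewrite -subr_eq0; apply/eqP.
  apply: (@hn_small _ _ _ (hn (c *: x + y) + Num.sqrt (absq c) * hn x + hn y) _ Tt).
    by rewrite !addr_ge0 ?mulr_ge0 ?sqrtr_ge0 ?hn_ge0.
  move=> n; have -> : Yl (c *: x + y) - (c *: Yl x + Yl y) =
     (Yl (c *: x + y) - Y n (c *: x + y)) - (c *: (Yl x - Y n x) + (Yl y - Y n y)).
    rewrite sqrt_iter_lin; vec.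
  apply: (le_trans (hnB _ _)); have h1 := YlP (c *: x + y) n.
  have h2 := hnD (c *: (Yl x - Y n x)) (Yl y - Y n y).
  have h3 := YlP y n; have := YlP x n; rewrite hnZ in h2.
  by move/(ler_wpM2l (sqrtr_ge0 (absq c))) => h4; lra.
have Yl_bound x : hn (Yl x) <= hn x.
  apply/ler_addgt0Pr => e e0; have x1 : 0 < hn x + 1 by have := hn_ge0 x; lra.
  have [n nP] := Tt (e / (hn x + 1)) (divr_gt0 e0 x1).
  have := YlP x n; have := hnD (Yl x - Y n x) (Y n x); rewrite subrK => h1 h2.
  have := sqrt_iter_bound n x; have /andP[t0 t1] := sqrt_rate_bound n => h3.
  have h4 : (T - t n) * (hn x + 1) < e by rewrite -ltr_pdivlMr.
  by have := hn_ge0 x; have := tT n; nra.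
have Yl_sa x y : ip (Yl x) y = ip x (Yl y).
  suff W x' y' : complex.Re (ip (Yl x') y') = complex.Re (ip x' (Yl y')).
    apply: complex_eqP; first exact: W.
    have ImE (z : C) : complex.Im z = complex.Re (z * - 'i%C) by case: z => a b /=; ring.
    rewrite !ImE ![_ * - 'i%C]mulrC -!ipZr W; congr (complex.Re (ip x _)).
    by have := Yl_lin (- 'i%C) y 0; rewrite addr0 => ->;
       have := Yl_lin (-1) 0 0; rewrite scaler0 addr0 scaleN1r addNr => ->; rewrite addr0.
  apply/eqP; rewrite -subr_eq0 -normr_le0; apply/ler_addgt0Pr => e e0.
  have A0 := mulr_ge0 (hn_ge0 x') (hn_ge0 y'); set A := hn x' * hn y' in A0 *.
  have A1 : 0 < 2 * A + 1 by lra.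
  have [n nP] := Tt (e / (2 * A + 1)) (divr_gt0 e0 A1).
  have -> : complex.Re (ip (Yl x') y') - complex.Re (ip x' (Yl y')) =
     complex.Re (ip (Yl x' - Y n x') y') - complex.Re (ip x' (Yl y' - Y n y')).
    rewrite ipBl ipBr !ReD !ReN sqrt_iter_sa; ring.
  rewrite add0r (le_trans (ler_normB _ _)) //.
  have h1 := normRe_ip (Yl x' - Y n x') y'; have h2 := normRe_ip x' (Yl y' - Y n y').
  have h3 := ler_wpM2r (hn_ge0 y') (YlP x' n); have h4 := ler_wpM2l (hn_ge0 x') (YlP y' n).
  have h5 : (T - t n) * (2 * A + 1) < e by rewrite -ltr_pdivlMr.
  have h6 := tT n; rewrite /A in A0 A1 h5 *; nra.
have YlE x : (2 : R)%:C%C *: Yl x = G x + Yl (Yl x).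
  apply/eqP; rewrite -subr_eq0; apply/eqP.
  have Tt' e : 0 < e -> exists n, T - t n.+1 + (T - t n) < e.
    move=> e0; have e2 : 0 < e / 2 by lra.
    have [n nP] := Tt _ e2; exists n; have := sqrt_rate_nd n; lra.
  apply: (@hn_small _ _ _ (4 * hn x) _ Tt'); first by have := hn_ge0 x; lra.
  move=> n; have -> : (2 : R)%:C%C *: Yl x - (G x + Yl (Yl x)) =
     (2 : R)%:C%C *: (Yl x - Y n.+1 x) - (Y n (Yl x - Y n x) + (Yl (Yl x) - Y n (Yl x))) + 0.
    rewrite addr0 scalerBr /= scalerA -rmorphM divff ?pnatr_eq0 // scale1r.
    rewrite (linB (@sqrt_iter_lin _)); vec.
  rewrite addr0; apply: (le_trans (hnB _ _)); rewrite hnZR.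
  have h0 : `|2 : R| = 2 by rewrite ger0_norm.
  have h1 := hnD (Y n (Yl x - Y n x)) (Yl (Yl x) - Y n (Yl x)).
  have h2 := sqrt_iter_bound n (Yl x - Y n x).
  have h3 := YlP x n; have h4 := YlP x n.+1; have h5 := YlP (Yl x) n.
  have h6 := Yl_bound x; have h7 := hn_ge0 (Yl x - Y n x); have h8 := tT n; have h9 := tT n.+1.
  have /andP[t0 t1] := sqrt_rate_bound n; rewrite h0.
  have h10 := hn_ge0 x; nra.
exists (fun x => x - Yl x); split.
- by move=> c x y; rewrite Yl_lin scalerBr opprD addrACA.
- by move=> x y; rewrite ipBl ipBr Yl_sa.
- by move=> x; have := hnB x (Yl x); have := Yl_bound x; lra.
- move=> x; rewrite ipBr ReD ReN -/(sq x) -hn_sq.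
  have := le_trans (ler_norm _) (normRe_ip x (Yl x)).
  by have := Yl_bound x; have := hn_ge0 x; nra.
- move=> x; have YB : Yl (x - Yl x) = Yl x - Yl (Yl x).
    by rewrite -scaleN1r addrC Yl_lin scaleN1r addrC.
  rewrite YB; have := YlE x; rewrite rmorph_nat scaler_nat mulr2n => /eqP.
  rewrite -subr_eq => /eqP <-.
  vec.
Qed.

End SquareRoot.

(** * The range space of an operator and its colligation *)

(** Equalities of inner products are proved by letting an approximation parameter tend to zero. *)
Lemma le0_of_eps (R : realType) (x A : R) :
  0 <= A -> (forall e, 0 < e -> x <= A * e ^+ 2) -> x <= 0.
Proof.
move=> A0 xA; apply/ler_addgt0Pr => e e0; rewrite add0r.
have A1 : 0 < A + 1 by lra.
have e1 : 0 < Num.sqrt (e / (A + 1)) by rewrite sqrtr_gt0 divr_gt0.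
apply: (le_trans (xA _ e1)); rewrite sqr_sqrtr; last by rewrite ltW // divr_gt0.
rewrite mulrC mulrAC ler_pdivrMr //; nra.
Qed.

Section RangeSpace.
Variables (R : realType) (H : hilbert R) (D : H -> H).
Hypotheses (Dlin : linear D) (Dsa : forall x y, ip (D x) y = ip x (D y)).
Local Notation C := R[i].
Implicit Types (f g h x y : H).

(** The closure of the range of [D].  For self-adjoint [D] it is the orthogonal
complement of the kernel, so each vector of the range has exactly one
preimage in it. *)
Definition clran x := forall e, 0 < e -> exists g, hn (x - D g) < e.
Definition lifts f x := clran x /\ D x = f.
Definition ran f := exists x, lifts f x.
(** The preimage of [f] that defines the norm of the range space: [D] is
isometric from the closure of its range onto its range, normed by [lift]. *)
Definition lift f : H := xget 0 [set x | lifts f x].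

Lemma clran_lin c x y : clran x -> clran y -> clran (c *: x + y).
Proof.
move=> cx cy e e0; set a := Num.sqrt (absq c).
have a0 : 0 <= a := sqrtr_ge0 _.
have e2 : 0 < e / (a + 1) / 2 by rewrite !divr_gt0 //; lra.
have [g gx] := cx _ e2; have e3 : 0 < e / 2 by lra.
have [h hy] := cy _ e3; exists (c *: g + h).
have -> : c *: x + y - D (c *: g + h) = c *: (x - D g) + (y - D h).
  by rewrite Dlin; vec.
apply: (le_lt_trans (hnD _ _)); rewrite hnZ -/a.
have : a * hn (x - D g) <= (a + 1) * (e / (a + 1) / 2).
  by apply: ler_pM => //; rewrite ?hn_ge0 // ?lerDl // ltW.
rewrite mulrA mulrCA divff ?mulr1; last by rewrite gt_eqF //; lra.
by lra.
Qed.

Lemma clran_orth_ker x y : clran x -> D y = 0 -> ip y x = 0.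
Proof.
move=> cx Dy; apply: absq_eq0; apply/eqP; rewrite eq_le absq_ge0 andbT.
have W e : 0 < e -> absq (ip y x) <= sq y * e ^+ 2.
  move=> e0; have [g gx] := cx e e0.
  have -> : ip y x = ip y (x - D g) by rewrite ipBr -Dsa Dy ip0l subr0.
  apply: (le_trans (cauchy_schwarz _ _)); rewrite ler_wpM2l ?sq_ge0 //.
  by rewrite -hn_sq ler_pXn2r ?nnegrE ?hn_ge0 // ltW.
exact: le0_of_eps (sq_ge0 y) W.
Qed.

Lemma lifts_unique f x y : lifts f x -> lifts f y -> x = y.
Proof.
move=> [cx Dx] [cy Dy]; apply/eqP; rewrite -subr_eq0; apply/eqP/ip_eq0.
rewrite clran_orth_ker ?(linB Dlin) ?Dx ?Dy ?subrr //.
by rewrite -scaleN1r addrC; exact: clran_lin.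
Qed.

Lemma lift_lifts f : ran f -> lifts f (lift f).
Proof. by move=> [x fx]; exact: (@xgetPex _ 0 [set x | lifts f x] (ex_intro _ x fx)). Qed.

Lemma liftE f x : lifts f x -> lift f = x.
Proof. by move=> fx; apply: (lifts_unique _ fx); apply: lift_lifts; exists x. Qed.

Lemma lifts_lin c f g x y : lifts f x -> lifts g y -> lifts (c *: f + g) (c *: x + y).
Proof.
by move=> [cx Dx] [cy Dy]; split; [exact: clran_lin|rewrite Dlin Dx Dy].
Qed.

Lemma lifts0 : lifts 0 0.
Proof. by split; [move=> e e0; exists 0; rewrite (lin0 Dlin) subr0 hn0|exact: lin0]. Qed.

Lemma ran_lin c f g : ran f -> ran g -> ran (c *: f + g).
Proof. by move=> [x fx] [y gy]; exists (c *: x + y); exact: lifts_lin. Qed.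

Lemma lift_lin c f g : ran f -> ran g -> lift (c *: f + g) = c *: lift f + lift g.
Proof. by move=> rf rg; apply/liftE/lifts_lin; exact: lift_lifts. Qed.

Lemma ip_lift f g : ran f -> ip (lift f) (D g) = ip f g.
Proof. by move=> /lift_lifts [_ Df]; rewrite -Dsa Df. Qed.

(** The supremum of this concave functional over [g] is the squared norm of [f]
in the range space; it is finite exactly on the range of [D]. *)
Definition gap f g : R := 2 * complex.Re (ip f g) - sq (D g).

Lemma gapE f g : ran f -> gap f g = sq (lift f) - sq (lift f - D g).
Proof. by move=> rf; rewrite /gap sqB ip_lift //; ring. Qed.

Lemma gap_le f g : ran f -> gap f g <= sq (lift f).
Proof. by move=> rf; rewrite gapE // lerBlDr lerDl sq_ge0. Qed.

Lemma sq_lift_le f c : ran f -> (forall g, gap f g <= c) -> sq (lift f) <= c.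
Proof.
move=> rf fc; apply/ler_addgt0Pr => e e0; have [cl _] := lift_lifts rf.
have [g] := cl (Num.sqrt e) (etrans (sqrtr_gt0 _) e0).
rewrite -(@ltr_pXn2r _ 2) ?nnegrE ?hn_ge0 ?sqrtr_ge0 //.
rewrite hn_sq sqr_sqrtr ?(ltW e0) // => h; have := fc g; rewrite gapE //; lra.
Qed.

(** The lift is the limit of [D u] along a maximizing sequence [u] of [gap f]:
the parallelogram identity makes [D u] a Cauchy sequence, and the first
variation of [gap f] at the limit says that the limit is a preimage of [f]. *)
Lemma gap_bounded_ran f c : (forall g, gap f g <= c) -> ran f.
Proof.
move=> fc.
have [s gs near] : exists2 s, (forall g, gap f g <= s) &
    forall n, exists g, s - gap f g < n.+1%:R^-1.
  pose A := [set gap f g | g in [set: H]].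
  have supA : has_sup A.
    by split; [exists (gap f 0), 0|exists c => _ [g _ <-]].
  exists (sup A); first by move=> g; apply: sup_upper_bound => //; exists g.
  move=> n; have n0 : 0 < n.+1%:R^-1 :> R by rewrite invr_gt0.
  have [_ [g _ <-] sg] := sup_adherent n0 supA; exists g.
  by rewrite ltrBlDr addrC -ltrBlDr.
have [u uP] := choice near.
(* The parallelogram identity, through the value at the midpoint. *)
have mid g h : sq (D g - D h) <= 2 * ((s - gap f g) + (s - gap f h)).
  have := gs ((2^-1 : R)%:C%C *: (g + h)).
  rewrite /gap ipZr (linZ Dlin) sqZ absqR ReZ (linD Dlin) ipDr ReD sqD sqB; lra.
have inv_le N n : (N <= n)%N -> n.+1%:R^-1 <= N.+1%:R^-1 :> R.
  by move=> Nn; rewrite lef_pV2 ?posrE ?ltr0n // ler_nat ltnS.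
have [|x xP] := @ip_complete R H (fun n => D (u n)).
  move=> e e0; have e4 : 0 < e / 4 by lra.
  have [N] := ltr_add_invr e4; rewrite add0r => NP; exists N => m n Nm Nn.
  apply: (le_lt_trans (mid _ _)).
  have h1 := lt_trans (lt_le_trans (uP m) (inv_le _ _ Nm)) NP.
  have h2 := lt_trans (lt_le_trans (uP n) (inv_le _ _ Nn)) NP; lra.
have cx : clran x.
  move=> e e0; have [N NP] := xP _ (exprn_gt0 2 e0); exists (u N).
  rewrite -(@ltr_pXn2r _ 2) ?nnegrE ?hn_ge0 ?(ltW e0) // hn_sq.
  by have := NP N (leqnn N); rewrite -/(sq (D (u N) - x)) -sqN opprB.
(* The first variation in the direction [h] with step [t]. *)
have var h (t : R) : 2 * t * (complex.Re (ip f h) - complex.Re (ip x (D h)))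
    <= t ^+ 2 * sq (D h).
  apply/ler_addgt0Pr => e e0.
  pose B := 2 * `|t| * hn (D h) + 1.
  have B0 : 0 < B by have := hn_ge0 (D h); have := normr_ge0 t; rewrite /B; nra.
  have e2 : 0 < e / 2 by lra.
  have [N] := ltr_add_invr e2; rewrite add0r => NP.
  have [N' N'P] := xP _ (exprn_gt0 2 (divr_gt0 e2 B0)).
  set n := maxn N N'; have := gs (u n + t%:C%C *: h).
  have := N'P n (leq_maxr _ _); rewrite -/(sq (D (u n) - x)) -hn_sq.
  rewrite ltr_pXn2r ?nnegrE ?hn_ge0 ?(ltW (divr_gt0 e2 B0)) // ltr_pdivlMr // => xn.
  rewrite /gap ipDr ReD ipZr ReZ (linD Dlin) (linZ Dlin) sqD sqZ absqR ipZr ReZ.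
  have := lt_trans (lt_le_trans (uP n) (inv_le _ _ (leq_maxl N N'))) NP; rewrite /gap => un su.
  have Dun : complex.Re (ip (D (u n)) (D h)) =
    complex.Re (ip (D (u n) - x) (D h)) + complex.Re (ip x (D h)).
    by rewrite ipBl ReD ReN subrK.
  rewrite {}Dun in su; have zle := normRe_ip (D (u n) - x) (D h).
  move: (complex.Re (ip (D (u n) - x) (D h))) su zle => z su zle.
  have tz : 2 * t * z <= 2 * `|t| * (hn (D (u n) - x) * hn (D h)).
    apply: (le_trans (ler_norm _)); rewrite !normrM (@ger0_norm _ 2) //.
    by rewrite ler_wpM2l // mulr_ge0.
  have h1 : 2 * `|t| * (hn (D (u n) - x) * hn (D h)) <= e / 2.
    apply: le_trans (ltW xn); rewrite /B mulrDr mulr1.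
    by have := hn_ge0 (D (u n) - x); nra.
  by lra.
exists x; split => //; apply: ip_ext => h.
rewrite -Dsa ipC ReJ [ip h f]ipC ReJ.
move: (var h) (sq_ge0 (D h)); move: (sq (D h)) (complex.Re (ip f h)) => Q a.
move: (complex.Re _) => b {}var Q0.
pose T := (Q + 1)^-1.
have T0 : 0 < T by rewrite invr_gt0; lra.
have TQ : T * Q + T = 1 by rewrite /T -[X in _ + X]mulr1 -mulrDr mulVf // gt_eqF //; lra.
have := var ((a - b) * T) => v.
have : (a - b) ^+ 2 * (2 * T - T ^+ 2 * Q) <= 0 by nra.
have -> : 2 * T - T ^+ 2 * Q = T * (1 + T) by rewrite -[X in X + T]TQ; nra.
rewrite pmulr_lle0; last by rewrite mulr_gt0 //; lra.
move=> ab0; have : (a - b) ^+ 2 == 0 by rewrite eq_le ab0 sqr_ge0.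
by rewrite sqrf_eq0 subr_eq0 eq_sym => /eqP.
Qed.

End RangeSpace.

Section Colligation.
Variables (R : realType) (H : hilbert R) (d : nat).
Local Notation C := R[i].
Implicit Types (f g h x y : H) (k : 'I_d) (c : C).
Variables (ev : H -> C) (S : 'I_d -> H -> H) (join : C -> ('I_d -> H) -> H).
Hypotheses (ev_lin : forall c x y, ev (c *: x + y) = c * ev x + ev y)
  (S_lin : forall k, linear (S k))
  (ev_join : forall c v, ev (join c v) = c)
  (S_join : forall c v k, S k (join c v) = v k)
  (ip_split : forall f g,
     ip f g = (ev f)^*%C * ev g + \sum_k ip (S k f) (S k g)).
Variables (D : H -> H) (beta : H).
Hypotheses (Dlin : linear D) (Dsa : forall x y, ip (D x) y = ip x (D y))
  (defect : forall g, sq (D g) =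
     absq (ev g) + \sum_k sq (D (S k g)) - absq (ip beta g)).

Local Notation ran := (ran D).
Local Notation lift := (lift D).

Lemma sq_split g : sq g = absq (ev g) + \sum_k sq (S k g).
Proof.
rewrite {1}/sq ip_split ReD (big_morph _ (@ReD R) (erefl _)) -absqE.
by congr (_ + _).
Qed.

Definition embed k g : H := join 0 (fun j => if j == k then g else 0).

Lemma ip_embed k f g : ip f (embed k g) = ip (S k f) g.
Proof.
rewrite ip_split ev_join mulr0 add0r (bigD1 k) //= S_join eqxx.
rewrite big1 ?addr0 // => j /negbTE jk.
by rewrite S_join jk ip0r.
Qed.

Lemma defect_embed k g : sq (D (embed k g)) = sq (D g) - absq (ip beta (embed k g)).
Proof.
rewrite defect ev_join absq0 add0r (bigD1 k) //= S_join eqxx.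
rewrite big1 ?addr0 // => j /negbTE jk.
by rewrite S_join jk (lin0 Dlin) sq0.
Qed.

(** Embedding [g] as the [k]-th component only decreases [sq (D g)], so the
shifts are contractive for the norm of the range space. *)
Lemma ran_shift k f : ran f -> ran (S k f).
Proof.
move=> rf; apply: (@gap_bounded_ran _ _ _ Dlin Dsa _ (sq (lift f))) => g.
apply: le_trans (gap_le Dsa (embed k g) rf).
by rewrite /gap ip_embed defect_embed opprB; have := absq_ge0 (ip beta (embed k g)); lra.
Qed.

(** The shifts of [beta] lie in the range of [D] even when [beta] does not: a
vector [f] with [f f^* <= D D^*] lies in the range. *)
Lemma ran_shift_beta k : ran (S k beta).
Proof.
apply: (@gap_bounded_ran _ _ _ Dlin Dsa _ 1) => g.
have := sq_ge0 (D (embed k g)); rewrite defect_embed ip_embed /gap.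
set z := ip _ _; case: z => a b; rewrite /absq /= => h.
have := sqr_ge0 (a - 1); have := sqr_ge0 b; lra.
Qed.

Definition shifts_ran f := forall k, ran (S k f).
(** The target of the colligation is the sum of the constants and [d] copies of
the closed range of [D].  [join] realizes it inside [H] itself, where [xi f]
represents [f] and [push g] is the image of the pair of [D g] and
[ip beta g]. *)
Definition xi f : H := join (ev f) (fun k => lift (S k f)).
Definition push g : H := join (ev g) (fun k => D (S k g)).

Lemma ip_xi_push f g : shifts_ran f -> ip (xi f) (push g) = ip f g.
Proof.
move=> rf; rewrite !ip_split !ev_join; congr (_ + _).
by apply: eq_bigr => k _; rewrite !S_join ip_lift.
Qed.

(** By this identity [D g] and [ip beta g] together determine [push g]
isometrically: this is the colligation operator. *)
Lemma defect_push g : sq (D g) = sq (push g) - absq (ip beta g).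
Proof.
rewrite defect sq_split ev_join; congr (_ + _ - _).
by apply: eq_bigr => k _; rewrite S_join.
Qed.

(** The components of [g] are independent, so each of them can be used to
approximate the corresponding component of [xi f]. *)
Lemma push_dense f e : shifts_ran f -> 0 < e -> exists g, hn (xi f - push g) < e.
Proof.
move=> rf e0; have d1 : 0 < d%:R + 1 :> R by rewrite ltr_wpDl.
have e1 : 0 < e / (d%:R + 1) by rewrite divr_gt0.
have /choice[G GP] : forall k, exists g, hn (lift (S k f) - D g) < e / (d%:R + 1).
  by move=> k; have [cl _] := lift_lifts (rf k); exact: cl.
exists (join (ev f) G); rewrite -(@ltr_pXn2r _ 2) ?nnegrE ?hn_ge0 ?(ltW e0) //.
have evB x y : ev (x - y) = ev x - ev y.
  by rewrite -scaleN1r addrC ev_lin mulN1r addrC.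
rewrite {1}hn_sq sq_split evB !ev_join subrr absq0 add0r.
apply: (@le_lt_trans _ _ (\sum_(k < d) (e / (d%:R + 1)) ^+ 2)).
  apply: ler_sum => k _; rewrite (linB (S_lin k)) !S_join -hn_sq.
  by rewrite ler_pXn2r ?nnegrE ?hn_ge0 ?(ltW e1) // ltW.
rewrite sumr_const card_ord -[_ *+ d]mulr_natr expr_div_n mulrAC.
rewrite ltr_pdivrMr ?exprn_gt0 // ltr_pM2l ?exprn_gt0 //.
move: d1; move: (d%:R : R) => a a1; nra.
Qed.

Local Notation eta := (xi beta).

Lemma ip_eta_push g : ip eta (push g) = ip beta g.
Proof. exact: (ip_xi_push _ ran_shift_beta). Qed.

(** Otherwise the right-hand side of [defect_push] would be negative for [push g]
close to [eta]. *)
Lemma sq_eta_le1 : sq eta <= 1.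
Proof.
suff N1 : hn eta <= 1.
  by rewrite -hn_sq expr_le1 ?hn_ge0.
have W e : 0 < e -> hn eta ^+ 2 - hn eta * e <= hn eta + e.
  move=> e0; have [g gP] := push_dense ran_shift_beta e0.
  have h1 : hn (push g) <= hn eta + e.
    rewrite (_ : push g = eta - (eta - push g)); last by vec.
    by apply: (le_trans (hnB _ _)); rewrite lerD2l ltW.
  apply: le_trans h1.
  have h2 : Num.sqrt (absq (ip eta (push g))) <= hn (push g).
    by rewrite ler_wsqrtr // ip_eta_push; have := sq_ge0 (D g); rewrite defect_push; lra.
  apply: le_trans h2; apply: le_trans (le_trans (ler_norm _) (normRe_le _)).
  rewrite (_ : ip eta (push g) = ip eta eta - ip eta (eta - push g)); last first.
    by rewrite ipBr; ring.
  rewrite ReD ReN -/(sq eta) -hn_sq lerD2l lerN2.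
  apply: (le_trans (ler_norm _)); apply: (le_trans (normRe_ip _ _)).
  by rewrite ler_wpM2l ?hn_ge0 // ltW.
rewrite leNgt; apply/negP => N1.
have N0 : 0 < hn eta + 1 by lra.
have := W ((hn eta ^+ 2 - hn eta) / (hn eta + 1) / 2).
set e := _ / _ / _ => /(_ _).
have e0 : 0 < e by rewrite !divr_gt0 //; nra.
have : 2 * e * (hn eta + 1) = hn eta ^+ 2 - hn eta.
  by rewrite /e; field; lra.
by move=> ee /(_ e0); nra.
Qed.

(** Adding the multiple of [beta] completes the square: the gap functional of
the corrected vector is maximal where [push g] equals [xi f], although [f]
itself need not lie in the range of [D]. *)
Lemma ran_correction f : shifts_ran f -> ran (f - ip eta (xi f) *: beta) /\
  forall g, sq (lift (f - ip eta (xi f) *: beta) - D g) <= sq (push g - xi f).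
Proof.
move=> rf; set t := ip eta (xi f); set f' := f - _.
have gapf' g : gap D f' g = sq (xi f) - absq t -
    (sq (push g - xi f) - absq (ip eta (push g - xi f))).
  rewrite /gap defect_push /f' ipBl ipZl -ip_eta_push -(ip_xi_push g rf) sqB.
  rewrite [ip (push g) (xi f)]ipC ReJ ipBr -/t.
  move: (ip (xi f) (push g)) (ip eta (push g)) (t) => [a b] [a' b'] [a'' b''].
  by rewrite /absq /=; ring.
have dom g : absq (ip eta (push g - xi f)) <= sq (push g - xi f).
  apply: (le_trans (cauchy_schwarz _ _)).
  by have := sq_eta_le1; have := sq_ge0 (push g - xi f); nra.
have gaple g : gap D f' g <= sq (xi f) - absq t.
  by rewrite gapf'; have := dom g; lra.
have rf' := gap_bounded_ran Dlin Dsa gaple; split=> // g.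
have := sq_lift_le Dsa rf' gaple; have := gapf' g; rewrite gapE //.
by have := absq_ge0 (ip eta (push g - xi f)); lra.
Qed.

(** The adjoint of the colligation operator sends [xi f] to the lift of the
corrected vector. *)
Lemma ip_lift_correction f h : shifts_ran f -> ran h ->
  ip (lift h) (lift (f - ip eta (xi f) *: beta)) = ip (xi h) (xi f).
Proof.
move=> rf rh; have [rf' close] := ran_correction rf.
have rSh : shifts_ran h by move=> k; exact: ran_shift.
move: rf' close; set f' := f - _ => rf' close.
apply/eqP; rewrite -subr_eq0; apply/eqP/absq_eq0/eqP.
rewrite eq_le absq_ge0 andbT.
apply: (@le0_of_eps _ _ (2 * sq (lift h) + 2 * sq (xi h))).
  by have := sq_ge0 (lift h); have := sq_ge0 (xi h); lra.
move=> e e0; have [g gP] := push_dense rf e0.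
have -> : ip (lift h) (lift f') - ip (xi h) (xi f) =
    ip (lift h) (lift f' - D g) + ip (xi h) (push g - xi f).
  by rewrite !ipBr ip_lift // ip_xi_push //; ring.
apply: (le_trans (absqD_le _ _)).
have h1 := cauchy_schwarz (lift h) (lift f' - D g).
have h2 := cauchy_schwarz (xi h) (push g - xi f).
have h3 : sq (push g - xi f) <= e ^+ 2.
  by rewrite -hn_sq hn_distC ler_pXn2r ?nnegrE ?hn_ge0 ?(ltW e0) // ltW.
have h4 := le_trans (close g) h3.
have h5 := ler_wpM2l (sq_ge0 (lift h)) h4; have h6 := ler_wpM2l (sq_ge0 (xi h)) h3.
lra.
Qed.

(** For the de Branges-Rovnyak space this is the square of the constant term
of the Sarason function. *)
Definition defect_gap : R := 1 - sq eta.
(** If the gap is zero then [beta] may have no lift, and the factor zero makes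
the junk value harmless. *)
Definition defect_form h : C :=
  (Num.sqrt defect_gap)%:C%C * ip (lift beta) (lift h).

Lemma defect_gap_ge0 : 0 <= defect_gap.
Proof. by rewrite subr_ge0 sq_eta_le1. Qed.

(** The correction of [beta] itself is [defect_gap] times [beta]. *)
Lemma ran_beta : defect_gap != 0 -> ran beta.
Proof.
move=> q0; have [rq _] := ran_correction ran_shift_beta.
have -> : beta = (defect_gap^-1)%:C%C *: (beta - ip eta eta *: beta) + 0.
  rewrite addr0 ip_sq -[X in X - _]scale1r -scalerBl scalerA.
  by rewrite -[1](rmorph1 (real_complex R)) -rmorphB -rmorphM mulVf // scale1r.
by apply: ran_lin => //; exists 0; exact: lifts0.
Qed.

Lemma sqrt_gap_sqr : (Num.sqrt defect_gap)%:C%C * (Num.sqrt defect_gap)%:C%C =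
  defect_gap%:C%C :> C.
Proof. by rewrite -rmorphM -expr2 sqr_sqrtr // defect_gap_ge0. Qed.

Lemma ip_eta_xi h : ran h ->
  ip eta (xi h) = (Num.sqrt defect_gap)%:C%C * defect_form h.
Proof.
move=> rh; rewrite mulrA sqrt_gap_sqr.
have := ip_lift_correction ran_shift_beta rh.
have -> : beta - ip eta eta *: beta = defect_gap%:C%C *: beta.
  rewrite ip_sq -[X in X - _]scale1r -scalerBl.
  by rewrite -[1](rmorph1 (real_complex R)) -rmorphB.
have [->|q0] := eqVneq defect_gap 0.
  rewrite scale0r (liftE Dlin Dsa (lifts0 Dlin)) ip0r mul0r => e.
  by rewrite ipC -e conjc0.
have -> : defect_gap%:C%C *: beta = defect_gap%:C%C *: beta + 0 by rewrite addr0.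
rewrite lift_lin //; [|exact: ran_beta|by exists 0; exact: lifts0].
rewrite (liftE Dlin Dsa (lifts0 Dlin)) addr0 ipZr => e.
by rewrite ipC -e conjcM conjc_real -ipC.
Qed.

(** The correction of [f] is [f] minus a multiple of [beta], and the multiple is
proportional to [defect_form f]; expanding [ip_lift_correction] gives the
rank-one term.  When the gap vanishes the correction is [f] itself. *)
Theorem lift_colligation f h : ran f -> ran h -> ip (lift h) (lift f) =
  ip (xi h) (xi f) + (defect_form h)^*%C * defect_form f.
Proof.
move=> rf rh; have rSf : shifts_ran f by move=> k; exact: ran_shift.
have := ip_lift_correction rSf rh.
rewrite ip_eta_xi //.
have [q0|q0] := eqVneq defect_gap 0.
  by rewrite /defect_form q0 sqrtr0 !mul0r scale0r subr0 conjc0 mul0r addr0.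
have rb := ran_beta q0.
have -> : f - (Num.sqrt defect_gap)%:C%C * defect_form f *: beta =
  - ((Num.sqrt defect_gap)%:C%C * defect_form f) *: beta + f by vec.
rewrite lift_lin // ipDr ipZr => <-.
rewrite [defect_form h]/defect_form conjcM conjc_real -ipC.
set r := _%:C%C; ring.
Qed.

Lemma ip_xi f h : ip (xi f) (xi h) =
  (ev f)^*%C * ev h + \sum_k ip (lift (S k f)) (lift (S k h)).
Proof.
rewrite ip_split !ev_join; congr (_ + _).
by apply: eq_bigr => k _; rewrite !S_join.
Qed.

End Colligation.

(** * Finite-dimensional subspaces *)

Section FiniteDimension.
Variables (R : realType) (H : hilbert R).
Local Notation C := R[i].
Variables (W : lmodType C) (J : H -> W).
Hypotheses (J_lin : linear J) (J_inj : injective J).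
Variables (P : H -> Prop) (I : finType) (m : I -> W).
Hypotheses (P_lin : forall c x y, P x -> P y -> P (c *: x + y))
  (P_span : forall x, P x -> exists c : I -> C, J x = \sum_i c i *: m i).

Definition orthonormal r (e : nat -> H) :=
  forall i j, (i < r)%N -> (j < r)%N -> ip (e i) (e j) = (i == j)%:R.

(** [J] allows the spanning family to live in a larger space, which need not
carry an inner product. *)
Lemma orthonormal_size r e : orthonormal r e ->
  (forall i, (i < r)%N -> P (e i)) -> (r <= #|I|)%N.
Proof.
move=> oe Pe; rewrite leqNgt; apply/negP => Ir.
have /choice[c cP] (i : 'I_r) : exists c : I -> C, J (e i) = \sum_j c j *: m j.
  by apply: P_span; exact: Pe.
pose A := \matrix_(i < r, j < #|I|) c i (enum_val j).
have : kermx A != 0.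
  rewrite kermx_eq0 /row_free neq_ltn; apply/orP; left.
  exact: leq_ltn_trans (rank_leq_col A) Ir.
move=> /rowV0Pn[v /sub_kermxP vA v0].
have ve : \sum_i v 0 i *: e i = 0.
  apply: J_inj; rewrite (lin0 J_lin).
  have -> : J (\sum_i v 0 i *: e i) = \sum_i v 0 i *: J (e i).
    elim/big_rec2: _ => [|i z y _ <-]; [exact: lin0|exact: J_lin].
  under eq_bigr => i _ do rewrite cP scaler_sumr.
  rewrite exchange_big big1 //= => j _.
  under eq_bigr => i _ do rewrite scalerA.
  rewrite -scaler_suml; have /matrixP/(_ 0 (enum_rank j)) := vA.
  rewrite !mxE => e0; rewrite (_ : \sum_i v 0 i * c i j = 0) ?scale0r //.
  by apply: etrans e0; apply: eq_bigr => i _; rewrite mxE enum_rankK.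
case/negP: v0; apply/eqP/rowP => k; rewrite mxE.
have := congr1 (ip (e k)) ve; rewrite ip0r ip_sumr (bigD1 k) //=.
rewrite ipZr oe // eqxx mulr1 big1 ?addr0 // => i ik.
by rewrite ipZr oe // eq_sym (negbTE (ik : val i != val k)) mulr0.
Qed.

Lemma exists_orthonormal_basis : exists r (e : nat -> H), [/\ orthonormal r e,
  forall i, (i < r)%N -> P (e i) &
  forall x, P x -> x = \sum_(i < r) ip (e i) x *: e i].
Proof.
apply: contrapT => noB.
have big r : exists e, orthonormal r e /\ forall i, (i < r)%N -> P (e i).
  elim: r => [|r [e [oe Pe]]]; first by exists (fun=> 0).
  have : exists x, P x /\ x != \sum_(i < r) ip (e i) x *: e i.
    apply: contrapT => nx; apply: noB; exists r, e; split=> // x Px.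
    by apply/eqP; apply: contrapT => /negP ne; apply: nx; exists x.
  move=> [x [Px]]; rewrite -subr_eq0; set y := x - _ => y0.
  have Py : P y.
    have -> : y = (-1) *: \sum_(i < r) ip (e i) x *: e i + x.
      by rewrite /y scaleN1r addrC.
    rewrite scaler_sumr; elim/big_rec: _ => [|i z _ Pz]; first by rewrite add0r.
    by rewrite scalerA -addrA; apply: P_lin => //; exact: Pe.
  have ye i : (i < r)%N -> ip (e i) y = 0.
    move=> ir; rewrite /y ipBr ip_sumr (bigD1 (Ordinal ir)) //= ipZr oe // eqxx mulr1.
    rewrite big1 ?addr0 ?subrr // => j ji; rewrite ipZr oe // eq_sym.
    by rewrite (negbTE (ji : val j != val (Ordinal ir))) mulr0.
  have hy : 0 < hn y.
    by rewrite lt_def hn_ge0 andbT; apply: contra_neq y0 => /hn_eq0.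
  pose z := ((hn y)^-1)%:C%C *: y.
  have ez i : (i < r)%N -> ip (e i) z = 0 by move=> ir; rewrite ipZr ye ?mulr0.
  have P0 : P 0 by have := P_lin (-1) Py Py; rewrite scaleN1r addNr.
  exists (fun i => if i == r then z else e i); split; last first.
    move=> i; rewrite ltnS leq_eqVlt => /orP[->|ir].
      by rewrite /z -[_ *: y]addr0; exact: P_lin.
    by rewrite (ltn_eqF ir); exact: Pe.
  move=> i j; rewrite !ltnS [(i <= r)%N]leq_eqVlt [(j <= r)%N]leq_eqVlt.
  move=> /orP[/eqP ->|ir] /orP[/eqP ->|jr].
  - rewrite !eqxx /z ipZl ipZr ip_sq conjc_real -hn_sq -!rmorphM mulrA.
    by rewrite expr2 mulrACA mulVf ?mulr1 ?rmorph1 // gt_eqF.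
  - by rewrite eqxx (ltn_eqF jr) ipC ez // conjc0 gtn_eqF.
  - by rewrite eqxx (ltn_eqF ir) ez.
  - by rewrite (ltn_eqF ir) (ltn_eqF jr) oe.
have [e [oe Pe]] := big #|I|.+1.
by have := orthonormal_size oe Pe; rewrite ltnn.
Qed.

(** Expanding in an orthonormal basis bounds [T x] by the sum of the norms of
the images of the basis vectors. *)
Lemma finite_dim_bounded (K : hilbert R) (T : H -> K) :
  (forall c x y, P x -> P y -> T (c *: x + y) = c *: T x + T y) ->
  exists M, 0 <= M /\ forall x, P x -> hn (T x) <= M * hn x.
Proof.
move=> T_lin; have [r [e [oe Pe eB]]] := exists_orthonormal_basis.
exists (\sum_(i < r) hn (T (e i))); split; first by apply: sumr_ge0 => i _; exact: hn_ge0.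
move=> x Px.
have P0 : P 0 by have := P_lin (-1) Px Px; rewrite scaleN1r addNr.
have T0 : T 0 = 0.
  by have := T_lin (-1) 0 0 P0 P0; rewrite scaler0 addr0 scaleN1r addNr.
have sums (c : 'I_r -> C) : P (\sum_i c i *: e i) /\
    T (\sum_i c i *: e i) = \sum_i c i *: T (e i).
  elim/big_rec2: _ => [|i z y _ [Pz Tz]]; first by [].
  have Pei := Pe i (ltn_ord i).
  by split; [exact: P_lin|rewrite T_lin // Tz].
have -> : T x = \sum_(i < r) ip (e i) x *: T (e i).
  by rewrite {1}(eB x Px); have [_ ->] := sums (fun i => ip (e i) x).
rewrite mulr_suml; elim/big_rec2: _ => [|i z y _ h]; first by rewrite hn0.
apply: (le_trans (hnD _ _)); rewrite lerD // hnZ mulrC ler_wpM2l ?hn_ge0 //.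
apply: (le_trans (sqrt_absq_ip _ _)).
by rewrite -[leRHS]mul1r ler_wpM2r ?hn_ge0 // /hn /sq oe // eqxx /= sqrtr1.
Qed.

End FiniteDimension.

(** * The Fock space as a Hilbert space *)

Section FockHilbert.
Variables (R : realType) (d : nat).
Local Notation C := R[i].
Local Notation series := (word d -> C).

Definition fock_pred : {pred series} := fun f => `[< @fock R d f >].

Lemma fock_predP f : reflect (fock f) (f \in fock_pred).
Proof. exact: asboolP. Qed.

Lemma fock_submod_closed : submod_closed fock_pred.
Proof.
split; first by apply/fock_predP; exact: fock0.
by move=> c f g /fock_predP ff /fock_predP fg; apply/fock_predP; exact: fock_lin.
Qed.

HB.instance Definition _ := GRing.isSubmodClosed.Build C series fock_pred fock_submod_closed.

Definition fockT := {f : series | f \in fock_pred}.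
HB.instance Definition _ := SubChoice.on fockT.
HB.instance Definition _ := [SubChoice_isSubLmodule of fockT by <:].

Implicit Types (x y z : fockT).

Lemma fockV x : fock (val x).
Proof. exact/fock_predP/(valP x). Qed.

Definition mkfock f (ff : @fock R d f) : fockT := Sub f (introT (fock_predP f) ff).

Lemma val_lin c x y : val (c *: x + y) = (fun w => c * val x w + val y w).
Proof. by rewrite GRing.valD GRing.valZ. Qed.

Lemma val_sub x y : val (x - y) = (fun w => val x w - val y w).
Proof. by rewrite GRing.valB. Qed.

Definition ipF x y : C := dot (val x) (val y).

Lemma ipF_linr c x y z : ipF x (c *: y + z) = c * ipF x y + ipF x z.
Proof. by rewrite /ipF val_lin dot_lin //; exact: fockV. Qed.

Lemma ipFC x y : ipF y x = (ipF x y)^*%C.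
Proof. by rewrite /ipF dotJ //; exact: fockV. Qed.

Lemma ReipF x : complex.Re (ipF x x) = nsq (val x).
Proof. by rewrite /ipF dot_nsq //; exact: fockV. Qed.

Lemma ipF_ge0 x : 0 <= complex.Re (ipF x x).
Proof. by rewrite ReipF nsq_ge0. Qed.

Lemma ipF_eq0 x : complex.Re (ipF x x) = 0 -> x = 0.
Proof.
rewrite ReipF => x0; apply/val_inj/funext => w; apply: absq_eq0; apply/eqP.
by rewrite eq_le absq_ge0 andbT -x0; apply: absq_le_nsq; exact: fockV.
Qed.

Lemma cvg_sumr (I : Type) (r : seq I) (u : I -> nat -> R) (l : I -> R) :
  (forall i, u i @ \oo --> l i) ->
  (fun n => \sum_(i <- r) u i n) @ \oo --> \sum_(i <- r) l i.
Proof.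
move=> ul; elim: r => [|i r IHr].
  by rewrite big_nil; under eq_fun do rewrite big_nil; exact: cvg_cst.
by rewrite big_cons; under eq_fun do rewrite big_cons; exact: cvgD.
Qed.

Lemma cvg_nsqn (g : nat -> series) (f : series) M :
  (forall w, cvgC (fun m => g m w) (f w)) ->
  (fun m => nsqn M (g m)) @ \oo --> nsqn M f.
Proof.
move=> gf; have absf w : (fun m => absq (g m w)) @ \oo --> absq (f w).
  have [g1 g2] := gf w; rewrite /absq !expr2.
  by under eq_fun do rewrite !expr2; apply: cvgD; apply: cvgM.
rewrite /nsqn /trunc_sum; apply: cvg_sumr => i.
by rewrite /level_sum; apply: cvg_sumr => t.
Qed.

Lemma real_cauchy_cvg (u : nat -> R) :
  (forall e, 0 < e -> exists N, forall m n, (N <= m)%N -> (N <= n)%N ->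
     `|u m - u n| < e) -> exists l : R, u @ \oo --> l.
Proof.
move=> uC; suff : cvgn u by move/cvg_ex.
apply/cauchy_cvgP/cauchy_exP => e e0.
have [N NP] := uC e e0; exists (u N).
exists N => // n /= Nn; exact: NP.
Qed.

Lemma ipF_complete (u : nat -> fockT) :
  (forall e, 0 < e -> exists N, forall m n, (N <= m)%N -> (N <= n)%N ->
     complex.Re (ipF (u m - u n) (u m - u n)) < e) ->
  exists x, forall e, 0 < e -> exists N, forall n, (N <= n)%N ->
     complex.Re (ipF (u n - x) (u n - x)) < e.
Proof.
move=> uC.
have coord w : exists z : C, cvgC (fun n => val (u n) w) z.
  have part (p : C -> R) : (forall a b, p (a - b) = p a - p b) ->
      (forall a, p a ^+ 2 <= absq a) ->
      exists l : R, (fun n => p (val (u n) w)) @ \oo --> l.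
    move=> pB pabs; apply: real_cauchy_cvg => e e0.
    have [N NP] := uC _ (exprn_gt0 2 e0); exists N => m n Nm Nn.
    rewrite -pB -(@ltr_pXn2r _ 2) ?nnegrE ?normr_ge0 ?(ltW e0) // -normrX ger0_norm ?sqr_ge0 //.
    apply: (le_lt_trans (pabs _)); apply: le_lt_trans (NP m n Nm Nn).
    rewrite ReipF; apply: (le_trans _ (absq_le_nsq w (fockV (u m - u n)))).
    by rewrite val_sub.
  have [|a|a aP] := part (@complex.Re R).
  - by move=> a b; rewrite ReD ReN.
  - by rewrite /absq lerDl sqr_ge0.
  have [|b|b bP] := part (@complex.Im R).
  - by move=> [? ?] [? ?].
  - by rewrite /absq lerDr sqr_ge0.
  by exists (Complex a b).
have /choice[f fP] := coord.
have close e : 0 < e -> exists N, forall n, (N <= n)%N ->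
    forall M, nsqn M (fun w => val (u n) w - f w) <= e.
  move=> e0; have [N NP] := uC e e0; exists N => n Nn M.
  have cv : (fun m => nsqn M (fun w => val (u n) w - val (u m) w)) @ \oo -->
      nsqn M (fun w => val (u n) w - f w).
    apply: cvg_nsqn => w; have := cvgCD (cvgC_cst (val (u n) w)) (cvgCZ (-1) (fP w)).
    by under eq_fun do rewrite mulN1r; rewrite mulN1r.
  rewrite -(cvg_lim (@norm_hausdorff _ _) cv).
  apply: limr_le; first by apply/cvg_ex; eexists; exact: cv.
  exists N => // m /= Nm; apply: ltW; apply: le_lt_trans (NP n m Nn Nm).
  by rewrite ReipF -val_sub; apply: nsqn_le; exact: fockV.
have ff : fock f.
  have [N NP] := close 1 ltr01.
  have fd : fock (fun w => val (u N) w - f w).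
    by apply: (@fock_bounded _ _ _ 1) => M; exact: NP.
  have := fock_lin (-1) fd (fockV (u N)).
  by congr (fock _); apply/funext => w; ring.
exists (mkfock ff) => e e0; have e2 : 0 < e / 2 by lra.
have [N NP] := close _ e2; exists N => n Nn.
rewrite ReipF val_sub; apply: (@le_lt_trans _ _ (e / 2)); last by lra.
by apply: nsq_bounded => M; exact: NP.
Qed.

Definition fockH : hilbert R :=
  @Hilbert R fockT ipF ipF_linr ipFC ipF_ge0 ipF_eq0 ipF_complete.

Lemma sq_fock (x : fockH) : sq x = nsq (val (x : fockT)).
Proof. exact: ReipF. Qed.

End FockHilbert.

(** * Multiplication and shifts of series *)

Section WordCalculus.
Variables (R : realType) (d : nat).
Local Notation C := R[i].
Local Notation fps := (word d -> C).
Implicit Types (f g h : fps) (w v : word d) (k : 'I_d).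

Local Notation mono := (@smono R d).

Definition wshift w f : fps := fun v => f (w ++ v).

Lemma smul_nil f g : smul f g [::] = f [::] * g [::].
Proof. by rewrite /smul big_ord1. Qed.

Lemma smul_cons f g k w :
  smul f g (k :: w) = f [::] * g (k :: w) + smul (lshift k f) g w.
Proof. by rewrite /smul big_ord_recl. Qed.

Lemma lshift_smul k f g :
  lshift k (smul f g) = (fun w => f [::] * lshift k g w + smul (lshift k f) g w).
Proof. by apply/funext => w; rewrite /lshift smul_cons. Qed.

Lemma smulDl f f' g : smul (fun w => f w + f' w) g = (fun w => smul f g w + smul f' g w).
Proof.
apply/funext => w; elim: w f f' g => [|k w IHw] f f' g.
  by rewrite !smul_nil mulrDl.
by rewrite !smul_cons IHw mulrDl addrACA.
Qed.

Lemma smulZl c f g : smul (fun w => c * f w) g = (fun w => c * smul f g w).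
Proof.
apply/funext => w; elim: w f g => [|k w IHw] f g.
  by rewrite !smul_nil mulrA.
by rewrite !smul_cons IHw mulrDr mulrA.
Qed.

Lemma smul0l g : smul (fun=> 0 : C) g = (fun=> 0).
Proof.
apply/funext => w; elim: w g => [|k w IHw] g.
  by rewrite smul_nil mul0r.
by rewrite smul_cons IHw mul0r addr0.
Qed.

Lemma smulDr f g g' : smul f (fun w => g w + g' w) = (fun w => smul f g w + smul f g' w).
Proof.
apply/funext => w; elim: w f g g' => [|k w IHw] f g g'.
  by rewrite !smul_nil mulrDr.
by rewrite !smul_cons IHw mulrDr addrACA.
Qed.

Lemma smulZr c f g : smul f (fun w => c * g w) = (fun w => c * smul f g w).
Proof.
apply/funext => w; elim: w f g => [|k w IHw] f g.
  by rewrite !smul_nil mulrCA.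
by rewrite !smul_cons IHw mulrDr mulrCA.
Qed.

Lemma smulA f g h : smul f (smul g h) = smul (smul f g) h.
Proof.
apply/funext => w; elim: w f g h => [|k w IHw] f g h.
  by rewrite !smul_nil mulrA.
rewrite !smul_cons smul_nil lshift_smul smulDl smulZl IHw.
by rewrite /lshift; ring.
Qed.

Lemma lshift_smono_nil k : lshift k (mono [::] : fps) = (fun=> 0).
Proof. by []. Qed.

Lemma lshift_smono_cons k j w :
  lshift k (mono (j :: w) : fps) = (fun v => (k == j)%:R * mono w v).
Proof.
apply/funext => v; rewrite /lshift /smono eqseq_cons.
by case: (k == j); rewrite ?mul1r ?mul0r.
Qed.

Lemma smul1l g : smul (mono [::]) g = g.
Proof.
apply/funext => -[|k w]; first by rewrite smul_nil mul1r.
by rewrite smul_cons lshift_smono_nil smul0l mul1r addr0.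
Qed.

Lemma smul_smono w g v : smul (mono w) g v =
  if prefix w v then g (drop (size w) v) else 0.
Proof.
elim: w v => [|k w IHw] v; first by rewrite smul1l prefix0s drop0.
case: v => [|j v]; first by rewrite smul_nil /smono mul0r.
rewrite smul_cons {1}/smono mul0r add0r lshift_smono_cons smulZl IHw prefix_cons.
by rewrite eq_sym; case: (k == j); rewrite ?mul1r ?mul0r.
Qed.

Lemma smul_smonoS k w : smul (mono [:: k]) (mono w) = (mono (k :: w) : fps).
Proof.
apply/funext => v; rewrite smul_smono; case: v => [|j v] //=.
rewrite eq_sym drop0 /smono eqseq_cons.
by case: (j == k); rewrite ?prefix0s ?prefix0.
Qed.

Lemma str_smul f g : str (smul f g) = smul (str g) (str f).
Proof.
apply/funext => w; rewrite /str /smul size_rev.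
rewrite (reindex_inj rev_ord_inj) /=; apply: eq_bigr => i _.
have iw : (i <= size w)%N by rewrite -ltnS.
by rewrite subSS take_rev drop_rev subKn // mulrC.
Qed.

Lemma strK f : str (str f) = f.
Proof. by apply/funext => w; rewrite /str revK. Qed.

(** Reversal exchanges the factors, so [opR F] multiplies on the right by the reversed series. *)
Lemma opRE F h : opR F h = smul h (str F).
Proof. by rewrite /opR /opL str_smul strK. Qed.

Lemma smul1r f : smul f (mono [::]) = f.
Proof.
have str1 : str (mono [::]) = mono [::] :> fps.
  by apply/funext => w; rewrite /str /smono -(inj_eq (inv_inj (@revK _))) revK.
by rewrite -[LHS]strK str_smul str1 smul1l strK.
Qed.

Lemma normsq_str f : normsq (str f) = normsq f.
Proof.
apply: (cvg_unique (@ereal_hausdorff R) (@cvg_normsq _ _ (str f))).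
rewrite (_ : (fun N => (nsqn N (str f))%:E) = (fun N => (nsqn N f)%:E)).
  exact: cvg_normsq.
by apply/funext => N; rewrite /nsqn /str (trunc_sum_rev N (fun w => absq (f w))).
Qed.

Lemma fock_str f : fock f -> fock (str f).
Proof. by rewrite /fock normsq_str. Qed.

Lemma Hinf1_opR F : Hinf1 F <-> forall h, fock h -> (normsq (opR F h) <= normsq h)%E.
Proof.
split=> FH h fh.
  by rewrite /opR normsq_str -(normsq_str h); apply/FH/fock_str.
by have := FH _ (fock_str fh); rewrite /opR strK !normsq_str.
Qed.

Lemma fock_smono w : fock (mono w : fps).
Proof.
elim: w => [|k w IHw].
  apply: (@fock_bounded _ _ _ 1) => -[|N].
    by rewrite /nsqn trunc_sum0.
  rewrite nsqnS /smono eqxx /absq /= big1.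
    by rewrite expr1n expr0n !addr0.
  by move=> k _; rewrite /lshift /nsqn /trunc_sum big1 // => m _;
     rewrite /level_sum big1 // => t _; rewrite /absq /= expr0n addr0.
apply: (@fock_bounded _ _ _ (nsq (mono w : fps))) => -[|N].
  by rewrite /nsqn trunc_sum0 nsq_ge0.
rewrite nsqnS {1}/smono absq0 add0r (bigD1 k) //= big1.
  rewrite lshift_smono_cons eqxx addr0.
  by under eq_fun do rewrite mul1r; exact: nsqn_le.
move=> j /negbTE jk; rewrite lshift_smono_cons jk nsqnZ.
by rewrite absq0 mul0r.
Qed.

End WordCalculus.

Section FockOperators.
Variables (R : realType) (d : nat).
Local Notation C := R[i].
Local Notation fps := (word d -> C).
Local Notation H := (fockH R d).
Local Notation mono := (@smono R d).
Implicit Types (x y z : H) (w v : word d) (k : 'I_d).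

Definition coefs x : fps := val (x : fockT R d).

Lemma fock_coefs x : fock (coefs x). Proof. exact: fockV. Qed.

Lemma coefs_inj : injective coefs. Proof. exact: val_inj. Qed.

Definition vec_of f (ff : @fock R d f) : H := mkfock ff.

Lemma coefsK f (ff : fock f) : coefs (vec_of ff) = f. Proof. by []. Qed.

Lemma ip_coefs x y : ip x y = dot (coefs x) (coefs y). Proof. by []. Qed.

Lemma coefs_lin c x y : coefs (c *: x + y) = (fun w => c * coefs x w + coefs y w).
Proof. exact: val_lin. Qed.

Lemma coefsB x y : coefs (x - y) = (fun w => coefs x w - coefs y w).
Proof. exact: val_sub. Qed.

Lemma coefsZ c x : coefs (c *: x) = (fun w => c * coefs x w).
Proof. by rewrite /coefs GRing.valZ. Qed.

Lemma coefs0 : coefs 0 = (fun=> 0).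
Proof. by rewrite /coefs GRing.val0. Qed.

Lemma sq_coefs x : sq x = nsq (coefs x). Proof. exact: sq_fock. Qed.

Definition evF x : C := coefs x [::].
Definition shF k x : H := vec_of (fock_lshift k (fock_coefs x)).

Definition join_seq (c : C) (v : 'I_d -> H) : fps :=
  fun w => if w is k :: u then coefs (v k) u else c.

Lemma fock_join (c : C) (v : 'I_d -> H) : fock (join_seq c v).
Proof.
apply: (@fock_bounded _ _ _ (absq c + \sum_k nsq (coefs (v k)))) => -[|N].
  rewrite /nsqn trunc_sum0 addr_ge0 ?absq_ge0 //.
  by apply: sumr_ge0 => k _; exact: nsq_ge0.
rewrite nsqnS lerD2l; apply: ler_sum => k _.
by apply: (@nsqn_le _ _ N (coefs (v k))); exact: fock_coefs.
Qed.

Definition joinF (c : C) (v : 'I_d -> H) : H := vec_of (fock_join c v).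

Lemma evF_lin c x y : evF (c *: x + y) = c * evF x + evF y.
Proof. by rewrite /evF coefs_lin. Qed.

Lemma shF_lin k : linear (shF k).
Proof.
by move=> c x y; apply: coefs_inj; rewrite coefs_lin !coefsK coefs_lin.
Qed.

Lemma evF_join (c : C) (v : 'I_d -> H) : evF (joinF c v) = c. Proof. by []. Qed.

Lemma shF_join (c : C) (v : 'I_d -> H) k : shF k (joinF c v) = v k.
Proof. exact: coefs_inj. Qed.

Lemma ip_splitF x y :
  ip x y = (evF x)^*%C * evF y + \sum_k ip (shF k x) (shF k y).
Proof. by rewrite ip_coefs dot_shift //; exact: fock_coefs. Qed.

Definition monoF w : H := vec_of (fock_smono R w).

Lemma shF_mono_nil k : shF k (monoF [::]) = 0.
Proof. by apply: coefs_inj; rewrite coefs0. Qed.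

Lemma shF_mono_cons k j w : shF k (monoF (j :: w)) = (k == j)%:R *: monoF w.
Proof. by apply: coefs_inj; rewrite coefsZ !coefsK lshift_smono_cons. Qed.

Lemma ip_mono w x : ip (monoF w) x = coefs x w.
Proof.
elim: w x => [|k w IHw] x; rewrite ip_splitF.
  have -> : evF (monoF [::]) = 1 by [].
  rewrite conjc1 mul1r big1 ?addr0 // => k _.
  by rewrite shF_mono_nil ip0l.
have -> : evF (monoF (k :: w)) = 0 by [].
rewrite conjc0 mul0r add0r (bigD1 k) // shF_mono_cons eqxx scale1r IHw.
rewrite big1 => [|j /negbTE jk]; first exact: addr0.
by rewrite shF_mono_cons jk scale0r ip0l.
Qed.

Lemma dot_smono w (f : fps) : fock f -> dot (mono w) f = f w.
Proof. by move=> ff; rewrite -{2}(coefsK ff) -ip_mono. Qed.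

Lemma adj_shiftL k (f : fps) : fock f -> adj (shiftL k) f = lshift k f.
Proof.
move=> ff; apply/funext => w.
by rewrite /adj /shiftL /opL smul_smonoS dot_smono.
Qed.

Definition wshF w x : H := foldl (fun y k => shF k y) x w.

Lemma coefs_wshF w x : coefs (wshF w x) = wshift w (coefs x).
Proof. by elim: w x => //= k w IHw x; rewrite IHw. Qed.

Lemma wshF_rcons w k x : wshF (rcons w k) x = shF k (wshF w x).
Proof. by rewrite /wshF foldl_rcons. Qed.

Lemma wshF_lin w : linear (wshF w).
Proof.
by move=> c x y; elim: w x y => //= k w IHw x y; rewrite shF_lin IHw.
Qed.

(** The operators of [bshift] are applied from the last letter on, so they
remove the reversed word. *)
Lemma bshiftE w x : bshift w (coefs x) = coefs (wshF (rev w) x).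
Proof.
elim: w => [|k w IHw] //=.
by rewrite IHw rev_cons wshF_rcons adj_shiftL //; exact: fock_coefs.
Qed.

Lemma level_sum_split m (F : H -> R) :
  forall x, level_sum m.+1 (fun w => F (wshF w x)) =
    \sum_k level_sum m (fun w => F (wshF w (shF k x))).
Proof. by move=> x; rewrite level_sumS. Qed.

(** The part of the norm of [x] carried by words of length at least [N] is
the norm of the [N]-fold shifts. *)
Lemma sq_tail N x : sq x = nsqn N (coefs x) + level_sum N (fun w => sq (wshF w x)).
Proof.
elim: N x => [|N IHN] x; first by rewrite /nsqn trunc_sum0 level_sum0 add0r.
rewrite nsqnS level_sum_split -addrA -big_split /=.
rewrite (sq_split ip_splitF); congr (_ + _); apply: eq_bigr => k _.
exact: IHN.
Qed.

Lemma tail_cvg0 x : forall e, 0 < e -> exists N, level_sum N (fun w => sq (wshF w x)) < e.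
Proof.
move=> e e0; have /cvgrPdist_lt/(_ e e0)[N _ NP] := cvg_nsq (fock_coefs x).
exists N; have := NP N (leqnn N); rewrite -sq_coefs (sq_tail N).
by rewrite addrC addKr ger0_norm // level_sum_ge0 // => w; exact: sq_ge0.
Qed.

Lemma tail_nonincr x m n : (m <= n)%N ->
  level_sum n (fun w => sq (wshF w x)) <= level_sum m (fun w => sq (wshF w x)).
Proof.
move=> mn; have := sq_tail n x; rewrite (sq_tail m x).
by have := @nsqn_nd _ _ (coefs x) _ _ mn; lra.
Qed.

End FockOperators.

(** * The defect of a contractive multiplication *)

Section AdjointTools.
Variables (R : realType) (H : hilbert R).
Local Notation C := R[i].
Implicit Types (x y z : H).

Lemma ImE (z : C) : complex.Im z = complex.Re (- 'i%C * z).
Proof. by case: z => a b /=; ring. Qed.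

Lemma adjoint_of_Re (T T' : H -> H) : linear T' ->
  (forall x y, complex.Re (ip (T x) y) = complex.Re (ip x (T' y))) ->
  forall x y, ip (T x) y = ip x (T' y).
Proof.
move=> T'l TT' x y; apply: complex_eqP; first exact: TT'.
by rewrite !ImE -!ipZr TT' (linZ T'l).
Qed.

Lemma selfadjoint_of_real (T : H -> H) : linear T ->
  (forall x, complex.Im (ip x (T x)) = 0) -> forall x y, ip (T x) y = ip x (T y).
Proof.
move=> Tl Tr x y; rewrite ipC.
have sym u v : complex.Im (ip u (T v)) + complex.Im (ip v (T u)) = 0.
  have := Tr (u + v); rewrite (linD Tl) ipDl !ipDr !ImD !Tr; lra.
have s1 := sym x y; have := sym ('i%C *: x) y.
rewrite (linZ Tl) ipZl ipZr.
move: s1; move: (ip x (T y)) (ip y (T x)) => [a b] [a' b'] /= s1 s2.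
by congr Complex; lra.
Qed.

End AdjointTools.

Section Truncation.
Variables (R : realType) (d : nat).
Local Notation C := R[i].
Local Notation fps := (word d -> C).
Local Notation H := (fockH R d).
Implicit Types (f : fps).

Definition truncate N f : fps := fun w => if (size w < N)%N then f w else 0.

Lemma nsqn_truncate M N f : nsqn M (truncate N f) <= nsqn N f.
Proof.
elim: N M f => [|N IHN] M f.
  rewrite {2}/nsqn trunc_sum0 (_ : truncate 0 f = (fun w => 0 * 0)).
    by rewrite nsqnZ absq0 mul0r.
  by apply/funext => w; rewrite mul0r.
case: M => [|M]; first by rewrite {1}/nsqn trunc_sum0 nsqn_ge0.
rewrite !nsqnS {1}/truncate /= lerD2l; apply: ler_sum => k _.
exact: IHN.
Qed.

Lemma fock_truncate N f : fock (truncate N f).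
Proof. by apply: (@fock_bounded _ _ _ (nsqn N f)) => M; exact: nsqn_truncate. Qed.

Definition truncF N f : H := vec_of (fock_truncate N f).

Lemma sq_truncF N f : sq (truncF N f) = nsqn N f.
Proof.
rewrite sq_coefs; apply/eqP; rewrite eq_le; apply/andP; split.
  by apply: nsq_bounded => M; exact: nsqn_truncate.
apply: le_trans (nsqn_le N (fock_truncate N f)).
rewrite le_eqVlt; apply/orP; left; apply/eqP.
by apply: eq_trunc_sum => w wN; rewrite /truncate wN.
Qed.

Lemma wshF_truncF N f w : (N <= size w)%N -> wshF w (truncF N f) = 0.
Proof.
move=> Nw; apply: coefs_inj; rewrite coefs_wshF coefs0; apply/funext => v.
by rewrite /wshift coefsK /truncate size_cat ltnNge (leq_trans Nw) ?leq_addr.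
Qed.

Lemma sqB_truncF N (x : H) :
  sq (x - truncF N (coefs x)) = level_sum N (fun w => sq (wshF w x)).
Proof.
rewrite (sq_tail N) (_ : nsqn N _ = 0) ?add0r.
  apply: eq_bigr => t _; congr sq; rewrite (linB (@wshF_lin _ _ t)).
  by rewrite wshF_truncF ?subr0 // size_tuple.
rewrite /nsqn -[RHS](trunc_sum0 (fun w : word d => absq (0 : C))).
rewrite (@eq_trunc_sum _ _ _ _ (fun w : word d => 0)); last first.
  by move=> w wN; rewrite coefsB coefsK /truncate wN subrr absq0.
rewrite trunc_sum0 /trunc_sum big1 // => m _.
by rewrite /level_sum big1.
Qed.

End Truncation.

Section Multiplication.
Variables (R : realType) (d : nat).
Local Notation C := R[i].
Local Notation fps := (word d -> C).
Local Notation H := (fockH R d).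
Variables (b : fps) (hb : @Hinf1 R d b).
Implicit Types (x y : H).

Lemma fock_opR h : fock h -> fock (opR b h).
Proof.
by move=> fh; apply: le_lt_trans (fh : (normsq h < +oo)%E); exact: (Hinf1_opR b).1.
Qed.

Lemma fock_str_b : fock (str b).
Proof. by have := fock_opR (fock_smono R [::]); rewrite opRE smul1l. Qed.

Definition betaF : H := vec_of fock_str_b.
Definition mulF x : H := vec_of (fock_opR (fock_coefs x)).

Lemma coefs_mulF x : coefs (mulF x) = smul (coefs x) (str b).
Proof. by rewrite coefsK opRE. Qed.

Lemma mulF_lin : linear mulF.
Proof.
move=> c x y; apply: coefs_inj.
by rewrite coefs_lin !coefs_mulF coefs_lin smulDl smulZl.
Qed.

Lemma shF_mulF k x : shF k (mulF x) = evF x *: shF k betaF + mulF (shF k x).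
Proof.
apply: coefs_inj; rewrite coefs_lin coefs_mulF !coefsK.
by rewrite opRE lshift_smul.
Qed.

Lemma evF_mulF x : evF (mulF x) = evF x * evF betaF.
Proof. by rewrite /evF coefs_mulF smul_nil. Qed.

Lemma hn_mulF x : hn (mulF x) <= hn x.
Proof.
have /Hinf1_opR/(_ _ (fock_coefs x)) := hb.
rewrite le_hn !sq_coefs coefsK normsqE ?normsqE ?lee_fin //; first exact: fock_coefs.
exact: fock_opR (fock_coefs x).
Qed.

Lemma ip_mulF_step x y : ip (mulF x) y =
  (evF x)^*%C * ip betaF y + \sum_k ip (mulF (shF k x)) (shF k y).
Proof.
rewrite ip_splitF evF_mulF conjcM [ip betaF y]ip_splitF mulrDr -addrA mulrA.
congr (_ + _); rewrite mulr_sumr -big_split; apply: eq_bigr => k _.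
by rewrite shF_mulF ipDl ipZl.
Qed.

Definition adj_seq y : fps := fun w => ip betaF (wshF w y).

Lemma ip_mulF_iter N x y : ip (mulF x) y = dotn N (coefs x) (adj_seq y) +
  level_sum N (fun w => ip (mulF (wshF w x)) (wshF w y)).
Proof.
elim: N x y => [|N IHN] x y; first by rewrite /dotn trunc_sum0 level_sum0 add0r.
rewrite dotnS level_sumS -addrA -big_split ip_mulF_step; congr (_ + _).
by apply: eq_bigr => k _; exact: IHN.
Qed.

(** The truncation [t] of the would-be adjoint [adj_seq y] satisfies
[ip (mulF t) y = sq t], and [mulF] is contractive. *)
Lemma nsqn_adj_seq N y : nsqn N (adj_seq y) <= sq y.
Proof.
set v := nsqn N _; set t := truncF N (adj_seq y).
have tv : ip (mulF t) y = v%:C%C.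
  rewrite (ip_mulF_iter N) [level_sum _ _]big1 ?addr0.
    rewrite -dotn_nsqn; apply: eq_trunc_sum => w wN.
    by rewrite coefsK /truncate wN.
  by move=> s _; rewrite wshF_truncF ?size_tuple // (lin0 mulF_lin) ip0l //.
have v0 : 0 <= v := nsqn_ge0 _ _.
have : v ^+ 2 <= v * sq y.
  rewrite -absqR -tv; apply: (le_trans (cauchy_schwarz _ _)).
  by rewrite ler_wpM2r ?sq_ge0 // -[leRHS](sq_truncF N) -le_hn hn_mulF.
rewrite expr2; have [-> _|vn0] := eqVneq v 0; first exact: sq_ge0.
by rewrite ler_pM2l // lt_def vn0.
Qed.

Lemma fock_adj_seq y : fock (adj_seq y).
Proof. by apply: (@fock_bounded _ _ _ (sq y)) => N; exact: nsqn_adj_seq. Qed.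

Definition mulF_adj y : H := vec_of (fock_adj_seq y).

Lemma mulF_adj_lin : linear mulF_adj.
Proof.
move=> c x y; apply: coefs_inj; rewrite coefs_lin !coefsK.
by apply/funext => w; rewrite /adj_seq wshF_lin ipDr ipZr.
Qed.

Lemma hn_mulF_adj y : hn (mulF_adj y) <= hn y.
Proof.
by rewrite le_hn sq_coefs; apply: nsq_bounded => N; exact: nsqn_adj_seq.
Qed.

Lemma shF_mulF_adj k y : shF k (mulF_adj y) = mulF_adj (shF k y).
Proof. exact: coefs_inj. Qed.

Lemma wshF_mulF_adj w y : wshF w (mulF_adj y) = mulF_adj (wshF w y).
Proof. by elim: w y => //= k w IHw y; rewrite shF_mulF_adj IHw. Qed.

Lemma ip_iter N x y : ip x y = dotn N (coefs x) (coefs y) +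
  level_sum N (fun w => ip (wshF w x) (wshF w y)).
Proof.
elim: N x y => [|N IHN] x y; first by rewrite /dotn trunc_sum0 level_sum0 add0r.
rewrite dotnS level_sumS -addrA -big_split ip_splitF; congr (_ + _).
by apply: eq_bigr => k _; exact: IHN.
Qed.

(** Both sides agree on words shorter than [N], and what is left is bounded by
the tails of [x] and [y]. *)
Lemma mulF_adjP x y : ip (mulF x) y = ip x (mulF_adj y).
Proof.
apply: adjoint_of_Re => {x y}[|x y]; first exact: mulF_adj_lin.
apply/eqP; rewrite -subr_eq0 -normr_le0; apply/ler_addgt0Pr => e e0; rewrite add0r.
have e4 : 0 < e / 4 by lra.
have [N1 N1P] := tail_cvg0 x e4; have [N2 N2P] := tail_cvg0 y e4.
set N := maxn N1 N2.
have t1 := le_lt_trans (tail_nonincr x (leq_maxl N1 N2)) N1P.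
have t2 := le_lt_trans (tail_nonincr y (leq_maxr N1 N2)) N2P.
rewrite -ReN -ReD (ip_mulF_iter N) (ip_iter N x (mulF_adj y)).
rewrite opprD addrACA subrr add0r ReD ReN.
rewrite !(@raddf_level_sum _ C R (@complex.Re R)) //; try exact: ReD.
rewrite -sumrB; apply: (le_trans (ler_norm_sum _ _ _)).
apply: (@le_trans _ _ (2 * level_sum N (fun w => sq (wshF w x)) +
   2 * level_sum N (fun w => sq (wshF w y)))); last by rewrite -/N in t1 t2; lra.
rewrite /level_sum !mulr_sumr -big_split; apply: ler_sum => t _.
apply: (le_trans (ler_normB _ _)).
have h1 := normRe_ip (mulF (wshF t x)) (wshF t y).
have h2 := normRe_ip (wshF t x) (wshF t (mulF_adj y)).
have h3 := hn_mulF (wshF t x); have h4 := hn_mulF_adj (wshF t y).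
rewrite wshF_mulF_adj in h2 *.
have h5 := ler_wpM2r (hn_ge0 (wshF t y)) h3.
have h6 := ler_wpM2l (hn_ge0 (wshF t x)) h4.
rewrite -!hn_sq [leRHS]/=.
have := sqr_ge0 (hn (wshF t x) - hn (wshF t y)).
by have := sqr_ge0 (hn (wshF t x)); have := sqr_ge0 (hn (wshF t y)); lra.
Qed.

Lemma adj_opR x : adj (opR b) (coefs x) = coefs (mulF_adj x).
Proof.
apply/funext => w; rewrite /adj -(ip_mono w) -mulF_adjP.
by rewrite ip_coefs coefsK.
Qed.

Lemma opR_coefs x : opR b (coefs x) = coefs (mulF x).
Proof. by []. Qed.

Lemma mulFmulF_adj_sa x y :
  ip (mulF (mulF_adj x)) y = ip x (mulF (mulF_adj y)).
Proof. by rewrite mulF_adjP [RHS]ipC mulF_adjP -ipC. Qed.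

Definition adj_defect h : fps := h - opR b (adj (opR b) h).

Lemma adj_defectE x : adj_defect (coefs x) = coefs (x - mulF (mulF_adj x)).
Proof. by rewrite /adj_defect adj_opR opR_coefs coefsB. Qed.

(** Operators on the Hilbert space are extended by zero to all series; only
their values on square-summable series count. *)
Lemma exists_positive_sqrt : exists D, is_positive_sqrt (@adj_defect) D.
Proof.
have [||x|D [Dl Dsa Db Dp DD]] := @exists_sqrt R H (fun x => mulF (mulF_adj x)).
- by move=> c x y; rewrite mulF_adj_lin mulF_lin.
- exact: mulFmulF_adj_sa.
- exact: le_trans (hn_mulF _) (hn_mulF_adj _).
pose Dt (f : Defs.fps R d) : Defs.fps R d :=
  if pselect (fock f) is left ff then coefs (D (vec_of ff)) else fun=> 0.
have DtE x : Dt (coefs x) = coefs (D x).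
  rewrite /Dt; case: pselect => [ff|]; last by move/(_ (fock_coefs x)).
  by congr (coefs (D _)); exact: coefs_inj.
exists Dt; split.
- exists 4 => h fh; rewrite -(coefsK fh) DtE; set x := vec_of fh.
  rewrite !normsqE; try exact: fock_coefs.
  rewrite -EFinM lee_fin -!sq_coefs -!hn_sq.
  by have := Db x; have := hn_ge0 (D x); have := hn_ge0 x; nra.
- move=> c f g ff fg.
  rewrite -(coefsK ff) -(coefsK fg) -coefs_lin !DtE Dl.
  by rewrite coefs_lin.
- move=> h fh; rewrite -(coefsK fh) DtE -ip_coefs lecE /= Dp andbT.
  have := congr1 (@complex.Im R) (ipC (vec_of fh) (D (vec_of fh))).
  rewrite Dsa ImJ => /eqP; rewrite -addr_eq0 -mulr2n mulrn_eq0 /=.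
  by [].
- by move=> h fh; rewrite -(coefsK fh) !DtE DD adj_defectE.
Qed.

Lemma dBR_sqrtP : is_positive_sqrt (@adj_defect) (dBR_sqrt b).
Proof.
have [D DP] := exists_positive_sqrt.
exact: (@xgetPex _ (fun h : Defs.fps R d => h) [set D | is_positive_sqrt adj_defect D] (ex_intro _ D DP)).
Qed.

Lemma fock_dBR_sqrt h : fock h -> fock (dBR_sqrt b h).
Proof.
move=> fh; have [[M Mb] _ _ _] := dBR_sqrtP.
apply: le_lt_trans (Mb h fh) _; rewrite normsqE // -EFinM ltry //.
Qed.

Definition rootF x : H := vec_of (fock_dBR_sqrt (fock_coefs x)).

Lemma rootF_lin : linear rootF.
Proof.
have [_ Dl _ _] := dBR_sqrtP => c x y; apply: coefs_inj.
by rewrite coefs_lin !coefsK coefs_lin Dl //; exact: fock_coefs.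
Qed.

Lemma rootF_sa x y : ip (rootF x) y = ip x (rootF y).
Proof.
apply: selfadjoint_of_real => {x y} [|x]; first exact: rootF_lin.
have [_ _ Dp _] := dBR_sqrtP; have := Dp _ (fock_coefs x).
by rewrite ip_coefs lecE => /andP[/eqP].
Qed.

Lemma rootF_sqr x : rootF (rootF x) = x - mulF (mulF_adj x).
Proof.
have [_ _ _ DD] := dBR_sqrtP; apply: coefs_inj.
by rewrite !coefsK DD ?adj_defectE //; exact: fock_coefs.
Qed.

Lemma sq_rootF x : sq (rootF x) = sq x - sq (mulF_adj x).
Proof.
rewrite {1}/sq rootF_sa rootF_sqr ipBr ReD ReN; congr (_ - _).
by rewrite [ip x _]ipC ReJ mulF_adjP.
Qed.

(** The adjoint of the multiplication commutes with the shifts, and the constant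
term of [mulF_adj g] is [ip betaF g]. *)
Lemma rootF_defect g : sq (rootF g) =
  absq (evF g) + \sum_k sq (rootF (shF k g)) - absq (ip betaF g).
Proof.
under eq_bigr => k _ do rewrite sq_rootF -shF_mulF_adj.
rewrite sumrB sq_rootF (sq_split (@ip_splitF R d) g) (sq_split (@ip_splitF R d) (mulF_adj g)).
rewrite [evF (mulF_adj g)](_ : _ = ip betaF g) //; ring.
Qed.

(** Being orthogonal to the kernel singles out one preimage, and the vectors in
the closure of the range are orthogonal to the kernel. *)
Lemma dBR_liftE x : ran rootF x -> dBR_lift b (coefs x) = coefs (lift rootF x).
Proof.
move=> rx; have [cl Dx] := lift_lifts rx.
pose Q := [set y : Defs.fps R d | [/\ fock y, dBR_sqrt b y = coefs x &
    forall z, fock z -> dBR_sqrt b z = (fun=> 0) -> dot z y = 0]].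
have rootE z : dBR_sqrt b (coefs z) = coefs (rootF z) by [].
have Ql : Q (coefs (lift rootF x)).
  split; [exact: fock_coefs|by rewrite rootE Dx|].
  move=> z fz z0; rewrite -(coefsK fz) -ip_coefs.
  apply: (clran_orth_ker rootF_sa cl); apply: coefs_inj.
  by rewrite -rootE coefsK z0 coefs0.
have [fy Dy yo] : Q (dBR_lift b (coefs x)) by apply: (xgetPex _ (ex_intro _ _ Ql)).
rewrite -(coefsK fy); congr coefs; set y := vec_of fy.
apply/eqP; rewrite -subr_eq0; apply/eqP/ip_eq0.
have ker : rootF (y - lift rootF x) = 0.
  rewrite (linB rootF_lin) Dx.
  apply/eqP; rewrite subr_eq0; apply/eqP/coefs_inj.
  by rewrite -rootE coefsK.
rewrite ipBr (clran_orth_ker rootF_sa cl ker) subr0.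
rewrite ip_coefs [coefs y]coefsK yo //; first exact: fock_coefs.
by rewrite rootE ker coefs0.
Qed.

End Multiplication.

(** * Recognizable series *)

Section SeriesAlgebra.
Variables (R : realType) (d : nat).
Local Notation C := R[i].
Local Notation fps := (word d -> C).
Local Notation mono := (@smono R d).
Implicit Types (f g h : fps) (w v : word d) (k : 'I_d) (c : C).

Lemma smul_addl f f' g : smul (f + f') g = smul f g + smul f' g.
Proof. exact: smulDl. Qed.

Lemma smul_addr f g g' : smul f (g + g') = smul f g + smul f g'.
Proof. exact: smulDr. Qed.

Lemma smul_scalel c f g : smul (c *: f) g = c *: smul f g.
Proof. exact: smulZl. Qed.

Lemma smul_scaler c f g : smul f (c *: g) = c *: smul f g.
Proof. exact: smulZr. Qed.

Lemma smul_zerol g : smul (0 : fps) g = 0.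
Proof. exact: smul0l. Qed.

Lemma smul_zeror f : smul f (0 : fps) = 0.
Proof. by have := smul_scaler 0 f 0; rewrite !scale0r. Qed.

Lemma smul_suml (I : Type) (r : seq I) (F : I -> fps) g :
  smul (\sum_(i <- r) F i) g = \sum_(i <- r) smul (F i) g.
Proof.
exact: (big_morph (fun f => smul f g) (fun f f' => smul_addl f f' g) (smul_zerol g)).
Qed.

Lemma smul_sumr (I : Type) (r : seq I) (F : I -> fps) f :
  smul f (\sum_(i <- r) F i) = \sum_(i <- r) smul f (F i).
Proof. exact: (big_morph (smul f) (smul_addr f) (smul_zeror f)). Qed.

Lemma lshift_smulE k f g :
  lshift k (smul f g) = f [::] *: lshift k g + smul (lshift k f) g.
Proof. exact: lshift_smul. Qed.

Lemma str_mono1 : str (mono [::]) = mono [::].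
Proof. by apply/funext => w; rewrite /str /smono -(inj_eq (inv_inj (@revK _))) revK. Qed.

Lemma str_monoX k : str (mono [:: k]) = mono [:: k].
Proof. by apply/funext => w; rewrite /str /smono -(inj_eq (inv_inj (@revK _))) revK. Qed.

(** The right quotient [h f^-1], as a recursion over the word that carries the
numerator along: the inverse itself does not satisfy a structural recursion. *)
Fixpoint rdiv f w h : C :=
  if w is k :: w' then
    rdiv f w' (lshift k h) - h [::] / f [::] * rdiv f w' (lshift k f)
  else h [::] / f [::].

Definition sinv f : fps := fun w => rdiv f w (mono [::]).

Lemma rdiv0 f w : rdiv f w 0 = 0.
Proof.
elim: w => [|k w IHw] /=; first by rewrite mul0r.
by rewrite -[lshift k 0]/(0 : fps) IHw !mul0r subr0.
Qed.

Lemma rdivE f w h : rdiv f w h = smul h (sinv f) w.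
Proof.
elim: w h => [|k w IHw] h /=; first by rewrite smul_nil /sinv /= mul1r.
rewrite smul_cons -IHw {1}/sinv /= lshift_smono_nil rdiv0 mul1r sub0r.
by rewrite mulrN mulrA addrC.
Qed.

Lemma sinv_nil f : sinv f [::] = (f [::])^-1.
Proof. by rewrite /sinv /= mul1r. Qed.

Lemma smul_sinvr f : f [::] != 0 -> smul f (sinv f) = mono [::].
Proof.
move=> f0; apply/funext => -[|k w]; rewrite -rdivE /=.
  by rewrite divff.
by rewrite divff // mul1r subrr.
Qed.

(** The right inverse of [f] has a right inverse in turn, which must be [f] by
associativity. *)
Lemma smul_sinvl f : f [::] != 0 -> smul (sinv f) f = mono [::].
Proof.
move=> f0; have g0 : sinv f [::] != 0 by rewrite sinv_nil invr_eq0.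
have gg := smul_sinvr g0.
have fE : f = sinv (sinv f).
  by rewrite -[LHS]smul1r -gg smulA smul_sinvr // smul1l.
by rewrite {2}fE.
Qed.

Definition span (I : finType) (m : I -> fps) f := exists c : I -> C, f = \sum_i c i *: m i.

Definition shift_closed (I : finType) (m : I -> fps) :=
  forall k i, span m (lshift k (m i)).

(** Equivalent to a linear representation [f w = u S_w v] of the coefficients;
in the form of an invariant space, closure under an operation amounts to
exhibiting a spanning family. *)
Definition recognizable f := exists (I : finType) (m : I -> fps),
  shift_closed m /\ span m f.

Section Span.
Variables (I : finType) (m : I -> fps).

Lemma span0 : span m 0.
Proof. by exists (fun=> 0); rewrite big1 // => i _; rewrite scale0r. Qed.

Lemma span_lin c f g : span m f -> span m g -> span m (c *: f + g).
Proof.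
move=> [a ->] [a' ->]; exists (fun i => c * a i + a' i).
rewrite scaler_sumr -big_split; apply: eq_bigr => i _ /=.
by rewrite scalerDl scalerA.
Qed.

Lemma span_sum (J : finType) (c : J -> C) (n : J -> fps) :
  (forall j, span m (n j)) -> span m (\sum_j c j *: n j).
Proof.
move=> mn; elim/big_rec: _ => [|j f _ mf]; first exact: span0.
exact: span_lin.
Qed.

Lemma span_mem i : span m (m i).
Proof.
exists (fun j => (j == i)%:R); rewrite (bigD1 i) //= eqxx scale1r big1 ?addr0 //.
by move=> j /negbTE ->; rewrite scale0r.
Qed.

Lemma span_trans (J : finType) (n : J -> fps) f :
  (forall j, span m (n j)) -> span n f -> span m f.
Proof. by move=> mn [c ->]; exact: span_sum. Qed.

Lemma lshift_sum k (c : I -> C) : lshift k (\sum_i c i *: m i) = \sum_i c i *: lshift k (m i).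
Proof.
apply/funext => w; rewrite /lshift !fct_sumE.
by apply: eq_bigr.
Qed.

Lemma span_shift k f : shift_closed m -> span m f -> span m (lshift k f).
Proof. by move=> mk [c ->]; rewrite lshift_sum; apply: span_sum. Qed.

End Span.

Lemma recognizable_mono w : recognizable (mono w).
Proof.
pose m (i : 'I_(size w).+1) := mono (drop i w).
exists _, m; split; last first.
  by have := span_mem m ord0; rewrite /m drop0.
move=> k i; rewrite /m; case E : (drop i w) => [|j v].
  rewrite lshift_smono_nil; exact: span0.
have iw : (i < size w)%N.
  by rewrite ltnNge; apply/negP => h; move: E; rewrite drop_oversize.
have -> : v = drop i.+1 w by rewrite -add1n -drop_drop E /= drop0.
rewrite lshift_smono_cons.
have := span_lin (k == j)%:R (span_mem m (Ordinal (iw : (i.+1 < (size w).+1)%N))) (span0 m).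
by rewrite addr0.
Qed.

Lemma recognizableD f g : recognizable f -> recognizable g -> recognizable (f + g).
Proof.
move=> [I [m [mk mf]]] [J [n [nk ng]]].
pose p (x : I + J) := match x with inl i => m i | inr j => n j end.
have pm : forall i, span p (m i) by move=> i; exact: (span_mem p (inl i)).
have pn : forall j, span p (n j) by move=> j; exact: (span_mem p (inr j)).
exists _, p; split.
  by move=> k [i|j]; [apply: span_trans pm (mk k i)|apply: span_trans pn (nk k j)].
by have := span_lin 1 (span_trans pm mf) (span_trans pn ng); rewrite scale1r.
Qed.

Lemma recognizableZ c f : recognizable f -> recognizable (c *: f).
Proof.
move=> [I [m [mk mf]]]; exists _, m; split=> //.
by have := span_lin c mf (span0 m); rewrite addr0.
Qed.

Lemma recognizableM f g : recognizable f -> recognizable g -> recognizable (smul f g).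
Proof.
move=> [I [m [mk mf]]] [J [n [nk ng]]].
pose p (x : I + J) := match x with inl i => smul (m i) g | inr j => n j end.
have pn : forall j, span p (n j) by move=> j; exact: (span_mem p (inr j)).
have pm h : span m h -> span p (smul h g).
  move=> [c ->]; rewrite smul_suml.
  under eq_bigr => i _ do rewrite smul_scalel.
  by apply: span_sum => i; exact: (span_mem p (inl i)).
exists _, p; split; last exact: pm.
move=> k [i|j]; last exact: span_trans pn (nk k j).
rewrite lshift_smulE; apply: span_lin (pm _ (mk k i)).
exact: span_trans pn (span_shift k nk ng).
Qed.

(** Shifting [f g = 1] expresses the shifts of [g] by products of shifts of [f]
with [g], so these products and [g] span an invariant space. *)
Lemma recognizableV f g : f [::] != 0 -> smul f g = mono [::] ->
  recognizable f -> recognizable g.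
Proof.
move=> f0 fg [I [m [mk mf]]].
pose p (x : option I) := if x is Some i then smul (m i) g else g.
have pm h : span m h -> span p (smul h g).
  move=> [c ->]; rewrite smul_suml.
  under eq_bigr => i _ do rewrite smul_scalel.
  by apply: span_sum => i; exact: (span_mem p (Some i)).
have pg k : span p (lshift k g).
  have := congr1 (lshift k) fg; rewrite lshift_smulE lshift_smono_nil => /eqP.
  rewrite addr_eq0 => /eqP e.
  have -> : lshift k g = (- (f [::])^-1) *: smul (lshift k f) g + 0.
    by rewrite addr0 scaleNr -scalerN -e scalerA mulVf // scale1r.
  by apply: span_lin (span0 p); apply: pm; exact: span_shift.
exists _, p; split; last exact: (span_mem p None).
move=> k [i|] //; rewrite lshift_smulE; apply: span_lin (pm _ (mk k i)).
exact: pg.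
Qed.

End SeriesAlgebra.

(** * Isometric columns *)

Section ColumnIsometry.
Variables (R : realType) (d : nat).
Local Notation C := R[i].
Local Notation fps := (word d -> C).
Local Notation H := (fockH R d).
Implicit Types (f g h : fps) (x y : H).

Lemma smul_truncate N f g w : (size w < N)%N ->
  smul (truncate N f) g w = smul f g w.
Proof.
elim: N f w => // N IHN f [|k w] wN; first by rewrite !smul_nil.
by rewrite !smul_cons -(IHN (lshift k f)).
Qed.

(** The product of a polynomial with [x], presented by components so that it is
visibly square-summable before any boundedness is known. *)
Fixpoint poly_mul N f x : H :=
  if N is N'.+1 then
    f [::] *: x + joinF 0 (fun k => poly_mul N' (lshift k f) x)
  else 0.

Lemma coefs_poly_mul N f x : coefs (poly_mul N f x) = smul (truncate N f) (coefs x).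
Proof.
elim: N f => [|N IHN] f /=.
  rewrite coefs0 (_ : truncate 0 f = fun=> 0) ?smul0l //.
rewrite coefs_lin; apply/funext => -[|k w]; rewrite coefsK /=.
  by rewrite smul_nil addr0.
by rewrite smul_cons IHN.
Qed.

Lemma ip_join0 x (v : 'I_d -> H) : ip x (joinF 0 v) = \sum_k ip (shF k x) (v k).
Proof.
rewrite ip_splitF evF_join mulr0 add0r.
by apply: eq_bigr => k _; rewrite shF_join.
Qed.

Lemma sq_join0 (v : 'I_d -> H) : sq (joinF 0 v) = \sum_k sq (v k).
Proof.
rewrite (sq_split (@ip_splitF R d)) evF_join absq0 add0r.
by apply: eq_bigr => k _; rewrite shF_join.
Qed.

Variables (beta alpha : H).
(** Equivalently, the vectors obtained from the column by left multiplication
with distinct words are orthonormal. *)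
Hypothesis orth : forall v, ip beta (wshF v beta) + ip alpha (wshF v alpha) =
  (v == [::])%:R.

Lemma poly_mul_orth N f v : v != [::] ->
  ip (wshF v beta) (poly_mul N f beta) + ip (wshF v alpha) (poly_mul N f alpha) = 0.
Proof.
elim: N f v => [|N IHN] f v v0; first by rewrite !ip0r addr0.
rewrite /= !ipDr !ipZr !ip_join0 addrACA -mulrDr -big_split.
rewrite [ip (wshF v beta) beta]ipC [ip (wshF v alpha) alpha]ipC -conjcD orth.
rewrite (negbTE v0) conjc0 mulr0 add0r big1 // => k _.
by rewrite -!wshF_rcons; apply: IHN; case: (v).
Qed.

Lemma sq_poly_mul N f :
  sq (poly_mul N f beta) + sq (poly_mul N f alpha) = nsqn N f.
Proof.
elim: N f => [|N IHN] f; first by rewrite /= !sq0 /nsqn trunc_sum0 addr0.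
rewrite nsqnS /= !sqD !sq_join0 !sqZ !ipZl.
under eq_bigr => k _ do rewrite -IHN.
have cross : complex.Re ((f [::])^*%C * ip beta
    (joinF 0 (fun k => poly_mul N (lshift k f) beta))) +
  complex.Re ((f [::])^*%C * ip alpha
    (joinF 0 (fun k => poly_mul N (lshift k f) alpha))) = 0.
  rewrite -ReD -mulrDr !ip_join0 -big_split big1 ?mulr0 // => k _.
  by rewrite /= (@poly_mul_orth N (lshift k f) [:: k]).
have one : sq beta + sq alpha = 1.
  have := orth [::]; rewrite /= !ip_sq -rmorphD => /(congr1 (@complex.Re R)).
  by [].
rewrite [X in _ = _ + X]big_split [X in _ = _ + X]/=; move: one cross.
move: (complex.Re _) (complex.Re _) => u v one cross.
have := congr1 ( *%R (absq (f [::]))) one; rewrite mulr1 => e; lra.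
Qed.

(** The coefficients of a product on short words only involve the coefficients
of the factors on short words, so truncation reduces to polynomials. *)
Lemma column_nsqn N f : nsqn N (smul f (coefs beta)) + nsqn N (smul f (coefs alpha))
  <= nsqn N f.
Proof.
rewrite -(sq_poly_mul N f) !sq_coefs lerD //.
  apply: le_trans (nsqn_le N (fock_coefs _)); rewrite coefs_poly_mul.
  by rewrite le_eqVlt; apply/orP; left; apply/eqP/eq_trunc_sum => w wN; rewrite smul_truncate.
apply: le_trans (nsqn_le N (fock_coefs _)); rewrite coefs_poly_mul.
by rewrite le_eqVlt; apply/orP; left; apply/eqP/eq_trunc_sum => w wN; rewrite smul_truncate.
Qed.

Lemma fock_mul_beta h : fock h -> fock (smul h (coefs beta)).
Proof.
move=> fh; apply: (@fock_bounded _ _ _ (nsq h)) => N.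
apply: le_trans (nsqn_le N fh); apply: le_trans (column_nsqn N h).
by rewrite lerDl nsqn_ge0.
Qed.

Lemma fock_mul_alpha h : fock h -> fock (smul h (coefs alpha)).
Proof.
move=> fh; apply: (@fock_bounded _ _ _ (nsq h)) => N.
apply: le_trans (nsqn_le N fh); apply: le_trans (column_nsqn N h).
by rewrite lerDr nsqn_ge0.
Qed.

Definition mul_beta x : H := vec_of (fock_mul_beta (fock_coefs x)).
Definition mul_alpha x : H := vec_of (fock_mul_alpha (fock_coefs x)).

Lemma mul_beta_lin : linear mul_beta.
Proof.
move=> c x y; apply: coefs_inj.
by rewrite coefs_lin !coefsK coefs_lin smulDl smulZl.
Qed.

Lemma mul_alpha_lin : linear mul_alpha.
Proof.
move=> c x y; apply: coefs_inj.
by rewrite coefs_lin !coefsK coefs_lin smulDl smulZl.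
Qed.

Lemma column_le x : sq (mul_beta x) + sq (mul_alpha x) <= sq x.
Proof.
rewrite !sq_coefs !coefsK.
have fb := fock_mul_beta (fock_coefs x); have fa := fock_mul_alpha (fock_coefs x).
have cv : (fun N => nsqn N (smul (coefs x) (coefs beta)) +
    nsqn N (smul (coefs x) (coefs alpha))) @ \oo -->
    nsq (smul (coefs x) (coefs beta)) + nsq (smul (coefs x) (coefs alpha)).
  by apply: cvgD; exact: cvg_nsq.
rewrite -(cvg_lim (@norm_hausdorff _ _) cv).
apply: limr_le; first by apply/cvg_ex; eexists; exact: cv.
apply: nearW => N; apply: (le_trans (column_nsqn N _)).
exact: nsqn_le (fock_coefs x).
Qed.

Lemma column_truncF N f : sq (mul_beta (truncF N f)) + sq (mul_alpha (truncF N f)) = nsqn N f.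
Proof.
rewrite -(sq_poly_mul N); congr (_ + _); congr sq; apply: coefs_inj;
  by rewrite coefs_poly_mul !coefsK.
Qed.

(** The column is contractive and isometric on the truncations of [x], which
tend to [x]. *)
Theorem column_isometry x : sq (mul_beta x) + sq (mul_alpha x) = sq x.
Proof.
apply/eqP; rewrite eq_le column_le /=; apply/ler_addgt0Pr => e e0.
have x5 : 0 < 5 * hn x + 1 by have := hn_ge0 x; lra.
have [N NP] := tail_cvg0 x (exprn_gt0 2 (divr_gt0 e0 x5)).
set t := truncF N (coefs x); set y := x - t.
have y_lt : hn y * (5 * hn x + 1) < e.
  rewrite -ltr_pdivlMr // -(@ltr_pXn2r _ 2) ?nnegrE ?hn_ge0 ?(ltW (divr_gt0 e0 x5)) //.
  by rewrite hn_sq sqB_truncF.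
have sqx : sq x = sq t + sq y by rewrite sq_truncF sqB_truncF -sq_tail.
have xty : x = t + y by rewrite /y addrC subrK.
have yx : hn y <= hn x by rewrite le_hn sqx lerDr sq_ge0.
have tx : hn t <= hn x by rewrite le_hn sqx lerDl sq_ge0.
have split_sq (T : H -> H) : linear T -> (forall z, hn (T z) <= hn z) ->
    sq (T t) - 2 * hn x * hn y <= sq (T x).
  move=> Tl Tc; rewrite [in X in _ <= X]xty (linD Tl) sqD.
  have h1 := sq_ge0 (T y).
  have h2 : `|complex.Re (ip (T t) (T y))| <= hn x * hn y.
    apply: (le_trans (normRe_ip _ _)); apply: ler_pM; rewrite ?hn_ge0 //.
    exact: le_trans (Tc _) tx.
  have := ler_norm (- complex.Re (ip (T t) (T y))); rewrite normrN => h3; lra.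
have cb z : hn (mul_beta z) <= hn z.
  by rewrite le_hn; have := column_le z; have := sq_ge0 (mul_alpha z); lra.
have ca z : hn (mul_alpha z) <= hn z.
  by rewrite le_hn; have := column_le z; have := sq_ge0 (mul_beta z); lra.
have h1 := split_sq _ mul_beta_lin cb; have h2 := split_sq _ mul_alpha_lin ca.
have h3 := column_truncF N (coefs x); rewrite -/t -(sq_truncF N (coefs x)) -/t in h3.
have h4 : sq y <= hn x * hn y by rewrite -hn_sq expr2 ler_wpM2r ?hn_ge0.
have := hn_ge0 y; lra.
Qed.

End ColumnIsometry.

(** * The Sarason column of a recognizable series *)

Section RationalColumn.
Variables (R : realType) (d : nat).
Local Notation C := R[i].
Local Notation fps := (word d -> C).
Local Notation H := (fockH R d).
Variables (b : fps) (hb : @Hinf1 R d b).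
Variables (I : finType) (m : I -> fps).
Hypotheses (m_closed : shift_closed m) (b_span : span m (str b)).
Implicit Types (x y : H).

Local Notation beta := (betaF hb).
Local Notation D := (rootF hb).
Local Notation xiF := (xi (@evF R d) (@shF R d) (@joinF R d) D).
Local Notation q := (defect_gap (@evF R d) (@shF R d) (@joinF R d) D beta).
Local Notation phi := (defect_form (@evF R d) (@shF R d) (@joinF R d) D beta).
Local Notation Dlin := (rootF_lin hb).
Local Notation Dsa := (rootF_sa hb).

(** A shift-invariant space, finite-dimensional because the spanning family is
finite, on which the norm of the range space is defined. *)
Definition in_model x := ran D x /\ span m (coefs x).

Lemma coefs_linear : linear (@coefs R d : H -> fps).
Proof. by move=> c x y; rewrite coefs_lin. Qed.

Lemma in_model_lin c x y : in_model x -> in_model y -> in_model (c *: x + y).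
Proof.
move=> [rx sx] [ry sy]; split; first exact: ran_lin Dlin _ _ _ rx ry.
by rewrite coefs_linear; exact: span_lin.
Qed.

Lemma in_model_shift k x : in_model x -> in_model (shF k x).
Proof.
move=> [rx sx]; split; last by rewrite coefsK; exact: span_shift.
exact: (ran_shift (@evF_join R d) (@shF_join R d) (@ip_splitF R d) Dlin Dsa (rootF_defect hb)).
Qed.

Lemma in_model_shift_beta k : in_model (shF k beta).
Proof.
split; last first.
  by rewrite coefsK; exact: span_shift.
exact: (ran_shift_beta (@evF_join R d) (@shF_join R d) (@ip_splitF R d) Dlin Dsa (rootF_defect hb)).
Qed.

Lemma in_model_wshift w x : in_model x -> in_model (wshF w x).
Proof. by elim: w x => //= k w IHw x gx; apply/IHw/in_model_shift. Qed.

Lemma in_model_wshift_beta w : w != [::] -> in_model (wshF w beta).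
Proof. by case: w => //= k w _; apply/in_model_wshift/in_model_shift_beta. Qed.

Lemma lift_bounded : exists M, 0 <= M /\ forall x, in_model x -> hn (lift D x) <= M * hn x.
Proof.
apply: (finite_dim_bounded coefs_linear (@coefs_inj R d) in_model_lin (m := m)).
  by move=> x [].
by move=> c x y [rx _] [ry _]; exact: (lift_lin Dlin Dsa).
Qed.

Definition defect_series x : fps := fun w => phi (wshF w x).

Lemma lift_step x y : in_model x -> in_model y -> ip (lift D x) (lift D y) =
  (evF x)^*%C * evF y + (phi x)^*%C * phi y +
  \sum_k ip (lift D (shF k x)) (lift D (shF k y)).
Proof.
move=> [rx _] [ry _].
rewrite (lift_colligation (@evF_lin R d) (@shF_lin R d) (@evF_join R d)
  (@shF_join R d) (@ip_splitF R d) Dlin Dsa (rootF_defect hb) ry rx).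
rewrite (ip_xi (@evF_join R d) (@shF_join R d) (@ip_splitF R d)); ring.
Qed.

Lemma lift_iter N x y : in_model x -> in_model y -> ip (lift D x) (lift D y) =
  dotn N (coefs x) (coefs y) + dotn N (defect_series x) (defect_series y) +
  level_sum N (fun w => ip (lift D (wshF w x)) (lift D (wshF w y))).
Proof.
elim: N x y => [|N IHN] x y gx gy.
  by rewrite /dotn !trunc_sum0 level_sum0 !add0r.
rewrite !dotnS level_sumS lift_step // addrACA -!addrA; congr (_ + (_ + _)).
rewrite -!big_split; apply: eq_bigr => k _ /=.
by rewrite IHN -?addrA //; exact: in_model_shift.
Qed.

Lemma nsqn_defect N x : in_model x -> nsqn N (defect_series x) <= sq (lift D x).
Proof.
move=> gx; have := lift_iter N gx gx; rewrite !dotn_nsqn => /(congr1 (@complex.Re R)).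
rewrite -/(sq (lift D x)) !ReD (@raddf_level_sum _ C R (@complex.Re R)) //=; last exact: ReD.
move=> ->.
have : 0 <= level_sum N (fun w => sq (lift D (wshF w x))).
  by apply: level_sum_ge0 => w; exact: sq_ge0.
have := nsqn_ge0 N (coefs x); rewrite /sq; lra.
Qed.

Lemma fock_defect x : in_model x -> fock (defect_series x).
Proof.
by move=> gx; apply: (@fock_bounded _ _ _ (sq (lift D x))) => N; exact: nsqn_defect.
Qed.

Lemma cvgC0_bound (v : nat -> C) (t : nat -> R) :
  (forall N, `|complex.Re (v N)| <= t N) -> (forall N, `|complex.Im (v N)| <= t N) ->
  t @ \oo --> 0 -> cvgC v 0.
Proof.
move=> v1 v2 t0; have tN : (fun N => - t N) @ \oo --> (0 : R) by rewrite -[0]oppr0; exact: cvgN.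
split => /=; apply: (squeeze_cvgr _ tN t0); apply: nearW => N.
  by rewrite -ler_norml.
by rewrite -ler_norml.
Qed.

(** The remainder in [lift_iter] measures shifts by long words in the norm of
the range space.  On a finite-dimensional space that norm is dominated by the
Fock norm, in which the shifts by long words form the tail of a convergent
series. *)
Lemma lift_dot x y : in_model x -> in_model y -> ip (lift D x) (lift D y) =
  ip x y + dot (defect_series x) (defect_series y).
Proof.
move=> gx gy.
have c1 := cvg_dot (fock_coefs x) (fock_coefs y).
have c2 := cvg_dot (fock_defect gx) (fock_defect gy).
pose rem N := level_sum N (fun w => ip (lift D (wshF w x)) (lift D (wshF w y))).
have [M [M0 MP]] := lift_bounded.
pose t N := M ^+ 2 * (sq x - nsqn N (coefs x) + (sq y - nsqn N (coefs y))).
have tail z : in_model z -> forall N,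
    level_sum N (fun w => sq (lift D (wshF w z))) <= M ^+ 2 * (sq z - nsqn N (coefs z)).
  move=> gz N; rewrite [sq z](sq_tail N) [X in _ * X]addrC addKr.
  rewrite /level_sum mulr_sumr; apply: ler_sum => w _.
  rewrite -!hn_sq -exprMn ler_pXn2r ?nnegrE ?mulr_ge0 ?hn_ge0 //.
  exact/MP/in_model_wshift.
have bound N (p : C -> R) : (forall a b, p (a + b) = p a + p b) -> p 0 = 0 ->
    (forall v z : H, `|p (ip v z)| <= hn v * hn z) -> `|p (rem N)| <= t N.
  move=> pD p0 pip; rewrite /rem (@raddf_level_sum _ C R p) //.
  apply: (le_trans (ler_norm_sum _ _ _)); rewrite /t mulrDr.
  apply: le_trans (lerD (tail x gx N) (tail y gy N)).
  rewrite /level_sum -big_split; apply: ler_sum => w _ /=.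
  apply: (le_trans (pip _ _)); rewrite -!hn_sq.
  set X := hn _; set Y := hn _; have := sqr_ge0 (X - Y); have := sqr_ge0 (X + Y); lra.
have t0 : t @ \oo --> 0.
  rewrite -(mulr0 (M ^+ 2)); apply: cvgMr; rewrite -[X in _ --> X](addr0 0).
  apply: cvgD.
    by rewrite -(subrr (sq x)); apply: cvgB; [exact: cvg_cst|rewrite sq_coefs; exact: cvg_nsq (fock_coefs x)].
  by rewrite -(subrr (sq y)); apply: cvgB; [exact: cvg_cst|rewrite sq_coefs; exact: cvg_nsq (fock_coefs y)].
have c3 : cvgC rem 0.
  apply: cvgC0_bound t0 => N.
    by apply: bound => //; [exact: ReD|exact: normRe_ip].
  apply: bound => //; first exact: ImD.
  by move=> v z; rewrite ImE -ipZr; apply: (le_trans (normRe_ip _ _));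
    rewrite hnZ (_ : absq _ = 1) ?sqrtr1 ?mul1r // /absq /=; ring.
have := cvgCD (cvgCD c1 c2) c3; rewrite addr0 => cc.
apply: cvgC_unique cc; rewrite (_ : (fun N => _) = fun=> ip (lift D x) (lift D y)).
  exact: cvgC_cst.
by apply/funext => N; rewrite (lift_iter N gx gy).
Qed.

Definition defectF x : H :=
  if pselect (fock (defect_series x)) is left fx then vec_of fx else 0.

Lemma coefs_defectF x : in_model x -> coefs (defectF x) = defect_series x.
Proof.
by move=> gx; rewrite /defectF; case: pselect => // /(_ (fock_defect gx)).
Qed.

Lemma shF_defectF k x : in_model x -> shF k (defectF x) = defectF (shF k x).
Proof.
move=> gx; apply: coefs_inj; rewrite coefs_defectF; last exact: in_model_shift.
by rewrite coefsK coefs_defectF.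
Qed.

Lemma wshF_defectF w x : in_model x -> wshF w (defectF x) = defectF (wshF w x).
Proof.
by elim: w x => //= k w IHw x gx; rewrite shF_defectF // IHw //; exact: in_model_shift.
Qed.

Lemma evF_opp x : evF (- x) = - evF x.
Proof. by rewrite /evF -scaleN1r coefsZ mulN1r. Qed.

Lemma shF_opp k x : shF k (- x) = - shF k x.
Proof. by have := linZ (@shF_lin R d k) (-1) x; rewrite !scaleN1r. Qed.

Lemma wshF_opp w x : wshF w (- x) = - wshF w x.
Proof. by have := linZ (@wshF_lin R d w) (-1) x; rewrite !scaleN1r. Qed.

(** The reversed Sarason function, given by its constant term and its shifts. *)
Definition alphaF : H :=
  joinF (Num.sqrt q)%:C%C (fun k => - defectF (shF k beta)).

Lemma wshF_alphaF k w : wshF (k :: w) alphaF = - defectF (wshF (k :: w) beta).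
Proof.
rewrite /= shF_join wshF_opp wshF_defectF //; exact: in_model_shift_beta.
Qed.

(** Let [h] be the shift of [beta] by [v].  By [lift_dot], [ip beta h] and the
inner products of the shifts of [alphaF] add up to the inner product of
[xi beta] and [xi h].  For non-empty [v] the product of the constant terms of
[alphaF] and its shift cancels this by [ip_eta_xi]; for empty [v] the square of
the constant term completes it to [1]. *)
Lemma column_orthonormal v :
  ip beta (wshF v beta) + ip alphaF (wshF v alphaF) = (v == [::])%:R.
Proof.
have sums (h : H) : (forall k, in_model (shF k h)) ->
    ip beta h + \sum_k ip (shF k alphaF) (- defectF (shF k h)) = ip (xiF beta) (xiF h).
  move=> gh; rewrite ip_splitF (ip_xi (@evF_join R d) (@shF_join R d) (@ip_splitF R d)).
  rewrite -addrA -big_split; congr (_ + _); apply: eq_bigr => k _ /=.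
  rewrite shF_join ipNl ipNr opprK lift_dot //; last exact: in_model_shift_beta.
  congr (_ + _); rewrite ip_coefs !coefs_defectF //; exact: in_model_shift_beta.
case: v => [|k v] /=.
  rewrite [ip alphaF alphaF]ip_splitF evF_join addrCA.
  under eq_bigr => j _ do rewrite [X in ip _ X]shF_join.
  rewrite sums; last exact: in_model_shift_beta.
  rewrite conjc_real (sqrt_gap_sqr (@evF_lin R d) (@shF_lin R d) (@evF_join R d)
    (@shF_join R d) (@ip_splitF R d) Dlin Dsa (rootF_defect hb)).
  by rewrite ip_sq -rmorphD /= /defect_gap subrK.
set h := wshF v (shF k beta).
have gh : in_model h by apply/in_model_wshift/in_model_shift_beta.
have -> : wshF v (shF k alphaF) = - defectF h by exact: wshF_alphaF.
rewrite [ip alphaF _]ip_splitF evF_join addrCA.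
under eq_bigr => j _.
  rewrite shF_opp shF_defectF //; over.
rewrite sums; last by move=> j; exact: in_model_shift.
have [rh _] := gh.
rewrite (ip_eta_xi (@evF_lin R d) (@shF_lin R d) (@evF_join R d)
    (@shF_join R d) (@ip_splitF R d) Dlin Dsa (rootF_defect hb) rh).
have -> : evF (- defectF h) = - phi h.
  by rewrite evF_opp /evF coefs_defectF.
by rewrite conjc_real mulrN addNr.
Qed.

Lemma lift_shift_beta k : dBR_lift b (adj (shiftL k) (str b)) = coefs (lift D (shF k beta)).
Proof.
rewrite -[str b](coefsK (fock_str_b hb)) adj_shiftL; last exact: fock_coefs.
rewrite -[lshift _ _]/(coefs (shF k beta)).
by apply: dBR_liftE; have [] := in_model_shift_beta k.
Qed.

Lemma sarason0E : sarason0 b = Num.sqrt q.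
Proof.
rewrite /sarason0; congr Num.sqrt; rewrite /defect_gap.
rewrite (_ : sq (xiF beta) = absq (b [::]) +
    \sum_(k < d) dBR_normsq b (adj (shiftL k) (str b))); first by ring.
rewrite (sq_split (@ip_splitF R d)) evF_join; congr (_ + _).
apply: eq_bigr => k _.
by rewrite shF_join /dBR_normsq /dBR_dot lift_shift_beta -ip_coefs.
Qed.

Lemma sarasonE : sarason b = str (coefs alphaF).
Proof.
apply/funext => w; rewrite /sarason /str; case: w => [|k w].
  by rewrite sarason0E.
rewrite sarason0E; case E : (rev (k :: w)) => [|j v].
  by have := congr1 size E; rewrite size_rev.
rewrite -[LHS]/(_ * dBR_dot b (str b) (bshift (k :: w) (coefs beta))) bshiftE E.
have gw : in_model (wshF (j :: v) beta) by exact: in_model_wshift_beta.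
rewrite coefsK /= -/(coefs _) -[shF j beta]/(wshF [:: j] beta).
have -> : coefs (- defectF (wshF [:: j] beta)) v = - phi (wshF (j :: v) beta).
  rewrite -[- defectF _](wshF_alphaF j [::]).
  rewrite -[LHS]/(coefs (shF j alphaF) v) shF_join.
  rewrite -scaleN1r coefsZ coefs_defectF; last exact: in_model_shift_beta.
  by rewrite mulN1r.
rewrite /defect_form; have [->|q0] := eqVneq q 0.
  by rewrite sqrtr0 oppr0 !mul0r oppr0.
have rb := ran_beta (@evF_lin R d) (@shF_lin R d) (@evF_join R d)
    (@shF_join R d) (@ip_splitF R d) Dlin Dsa (rootF_defect hb) q0.
rewrite mulNr /dBR_dot -[str b](coefsK (fock_str_b hb)) !dBR_liftE //.
by case: gw.
Qed.

Lemma defect_series_sum (r : nat) (c : 'I_r -> C) (e : 'I_r -> H) :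
  (forall i, in_model (e i)) -> in_model (\sum_i c i *: e i) /\
  defect_series (\sum_i c i *: e i) = \sum_i c i *: defect_series (e i).
Proof.
have phi_lin c' x y : in_model x -> in_model y -> phi (c' *: x + y) = c' * phi x + phi y.
  move=> [rx _] [ry _]; rewrite /defect_form (lift_lin Dlin Dsa) // ipDr ipZr; ring.
have phi_0 : phi 0 = 0.
  by rewrite /defect_form (liftE Dlin Dsa (lifts0 Dlin)) ip0r mulr0.
have in_model0 : in_model 0.
  split; first by exists 0; exact: (lifts0 Dlin).
  by rewrite coefs0; exact: span0.
move=> ge; elim/big_rec2: _ => [|i f x _ [gx <-]].
  by split=> //; apply/funext => w; rewrite /defect_series (lin0 (@wshF_lin R d w)) phi_0.
split; first exact: in_model_lin.
apply/funext => w; rewrite /defect_series wshF_lin phi_lin //; exact: in_model_wshift.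
Qed.

(** The defect series of an orthonormal basis of the model span the defect
series of all of its vectors. *)
Lemma defect_series_family : exists r (m' : 'I_r -> fps),
  shift_closed m' /\ forall x, in_model x -> span m' (defect_series x).
Proof.
have [|r [e [_ ge eB]]] := exists_orthonormal_basis coefs_linear (@coefs_inj R d) in_model_lin (m := m).
  by move=> x [].
have ge' (i : 'I_r) : in_model (e i) by exact: ge.
have expand x : in_model x -> span (fun i : 'I_r => defect_series (e i)) (defect_series x).
  move=> gx; exists (fun i : 'I_r => ip (e i) x); rewrite {1}(eB x gx).
  by have [_ ->] := @defect_series_sum r (fun i => ip (e i) x) (fun i => e i) ge'.
exists r, (fun i => defect_series (e i)); split=> // k i.
rewrite -[lshift _ _]/(defect_series (shF k (e i))).
by apply: expand; exact: in_model_shift.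
Qed.

Lemma lshift_alphaF k : lshift k (coefs alphaF) = - defect_series (shF k beta).
Proof.
rewrite -[lshift _ _]/(coefs (shF k alphaF)) shF_join -scaleN1r coefsZ.
rewrite coefs_defectF; last exact: in_model_shift_beta.
by apply/funext => w; rewrite mulN1r.
Qed.

Lemma alphaF_eq0 : q = 0 -> alphaF = 0.
Proof.
move=> q0; apply: coefs_inj; rewrite coefs0; apply/funext => -[|k w].
  by rewrite -[LHS]/((Num.sqrt q)%:C%C) q0 sqrtr0.
rewrite -[LHS]/(lshift k (coefs alphaF) w) lshift_alphaF.
by rewrite -[LHS]/(- defect_series (shF k beta) w) /defect_series /defect_form q0 sqrtr0 mul0r oppr0.
Qed.

Lemma gap_ge0 : 0 <= q.
Proof.
apply: defect_gap_ge0; first [exact: evF_lin | exact: evF_join | exact: shF_join |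
  exact: ip_splitF | exact: Dlin | exact: Dsa | exact: rootF_defect | exact: shF_lin].
Qed.

End RationalColumn.

(** * Series of rational expressions *)

Section FormalSeries.
Variables (R : realType) (d : nat).
Local Notation C := R[i].
Local Notation fps := (word d -> C).
Local Notation mono := (@smono R d).
Implicit Types (e : ncexpr R d) (f g : fps).

Fixpoint formal_series e : fps :=
  match e with
  | NCvar k => mono [:: k]
  | NCconst c => c *: mono [::]
  | NCadd e1 e2 => formal_series e1 + formal_series e2
  | NCmul e1 e2 => smul (formal_series e1) (formal_series e2)
  | NCinv e1 => sinv (formal_series e1)
  end.

Fixpoint regular e : bool :=
  match e with
  | NCvar _ | NCconst _ => true
  | NCadd e1 e2 | NCmul e1 e2 => regular e1 && regular e2
  | NCinv e1 => regular e1 && (formal_series e1 [::] != 0)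
  end.

(** The value at the origin is the constant term, so the domain condition at the
origin says that all constant terms to be inverted are non-zero. *)
Lemma regular_dom e : nc_dom (fun=> 0 : 'M[C]_1) e = regular e.
Proof.
have W : nc_dom (fun=> 0 : 'M[C]_1) e = regular e /\
   (regular e -> nc_eval (fun=> 0 : 'M[C]_1) e = (formal_series e [::])%:M).
  elim: e => [k|c|e1 [d1 v1] e2 [d2 v2]|e1 [d1 v1] e2 [d2 v2]|e1 [d1 v1]] /=.
  - split=> // _; apply/matrixP => i j.
    by rewrite !mxE /smono /= mul0rn.
  - by split=> // _; rewrite -[(c *: _) [::]]/(c * 1) mulr1.
  - rewrite d1 d2; split=> // /andP[r1 r2].
    by rewrite v1 // v2 // -raddfD.
  - rewrite d1 d2; split=> // /andP[r1 r2].
    by rewrite v1 // v2 // smul_nil scalar_mxM.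
  - have unitE : regular e1 ->
        (nc_eval (fun=> 0 : 'M[C]_1) e1 \in unitmx) = (formal_series e1 [::] != 0).
      by move=> r1; rewrite v1 // unitmxE det_scalar1 unitfE.
    rewrite d1; split; first by case E : (regular e1) => //=; exact: unitE.
    by move=> /andP[r1 s0]; rewrite v1 // sinv_nil invmx_scalar.
by case: W.
Qed.

Lemma recognizable_formal_series e : regular e -> recognizable (formal_series e) /\ recognizable (str (formal_series e)).
Proof.
have str_lin c f g : str (c *: f + g) = c *: str f + str g by [].
elim: e => [k|c|e1 IH1 e2 IH2|e1 IH1 e2 IH2|e1 IH1] /=.
- by move=> _; rewrite str_monoX; split; exact: recognizable_mono.
- move=> _; have -> : str (c *: mono [::]) = c *: mono [::].
    by rewrite -{2}(str_mono1 R d).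
  by split; apply/recognizableZ/recognizable_mono.
- move=> /andP[/IH1[r1 s1] /IH2[r2 s2]]; split; first exact: recognizableD.
  by rewrite -[str _]/(str (formal_series e1) + str (formal_series e2)); exact: recognizableD.
- move=> /andP[/IH1[r1 s1] /IH2[r2 s2]]; split; first exact: recognizableM.
  by rewrite str_smul; exact: recognizableM.
- move=> /andP[/IH1[r1 s1] f0]; split.
    exact: recognizableV f0 (smul_sinvr f0) r1.
  apply: (@recognizableV _ _ (str (formal_series e1))) => //.
  by rewrite -str_smul smul_sinvl // str_mono1.
Qed.

(** The reversal makes families invariant under left shifts satisfy linear
systems whose coefficients stand on the left. *)
Definition rational f := exists2 e, regular e & formal_series e = str f.

Lemma rationalC c : rational (c *: mono [::]).
Proof.
by exists (NCconst d c) => //=; rewrite -[in LHS](str_mono1 R d).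
Qed.

Lemma rationalX k : rational (mono [:: k]).
Proof.
by exists (NCvar R k) => //=; rewrite str_monoX.
Qed.

Lemma rationalD f g : rational f -> rational g -> rational (f + g).
Proof.
move=> [e1 r1 s1] [e2 r2 s2]; exists (NCadd e1 e2); first by rewrite /= r1.
by rewrite /= s1 s2.
Qed.

Lemma rationalM f g : rational f -> rational g -> rational (smul f g).
Proof.
move=> [e1 r1 s1] [e2 r2 s2]; exists (NCmul e2 e1); first by rewrite /= r1 r2.
by rewrite /= s1 s2 str_smul.
Qed.

Lemma rational0 : rational 0.
Proof. by have := rationalC 0; rewrite scale0r. Qed.

Lemma rational1 : rational (mono [::]).
Proof. by have := rationalC 1; rewrite scale1r. Qed.

Lemma rationalZ c f : rational f -> rational (c *: f).
Proof.
move=> rf; have := rationalM (rationalC c) rf.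
by rewrite smul_scalel smul1l.
Qed.

Lemma rational_sum (I : finType) (F : I -> fps) :
  (forall i, rational (F i)) -> rational (\sum_i F i).
Proof.
move=> rF; elim/big_rec: _ => [|i f _ rf]; first exact: rational0.
exact: rationalD.
Qed.

Lemma rationalV f : f [::] != 0 -> rational f -> rational (sinv f).
Proof.
move=> f0 [e1 r1 s1]; exists (NCinv e1); first by rewrite /= r1 s1.
have s0 : str f [::] != 0 by [].
rewrite /= s1 -[LHS]smul1r -(str_mono1 R d) -(smul_sinvl f0) str_smul smulA.
by rewrite smul_sinvl // smul1l.
Qed.

(** Gaussian elimination: the last equation is solved for the last unknown,
which only inverts a series with constant term [1], and the solution is
substituted in the other equations. *)
Lemma rational_system N (x c : 'I_N -> fps) (P : 'I_N -> 'I_N -> fps) :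
  (forall i, rational (c i)) -> (forall i j, rational (P i j)) ->
  (forall i j, P i j [::] = 0) ->
  (forall i, x i = c i + \sum_j smul (P i j) (x j)) ->
  forall i, rational (x i).
Proof.
elim: N x c P => [|N IHN] x c P rc rP P0 xE; first by case.
pose w (j : 'I_N) : 'I_N.+1 := widen_ord (leqnSn N) j.
pose p := P ord_max ord_max.
pose g := sinv (mono [::] - p).
have p1 : (mono [::] - p) [::] != 0.
  rewrite -[(mono [::] - p) [::]]/(mono [::] [::] - P ord_max ord_max [::]) P0 subr0.
  exact: oner_neq0.
have rg : rational g.
  apply: rationalV => //; apply: rationalD; first exact: rational1.
  by rewrite -scaleN1r; apply: rationalZ; exact: rP.
have xmax : x ord_max = smul g (c ord_max + \sum_j smul (P ord_max (w j)) (x (w j))).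
  rewrite -[LHS]smul1l -(smul_sinvl p1) -smulA; congr smul.
  rewrite smul_addl -[- p]scaleN1r smul_scalel scaleN1r smul1l {1}xE.
  by rewrite big_ord_recr /= addrA addrK.
pose q i j := P (w i) (w j) + smul (P (w i) ord_max) (smul g (P ord_max (w j))).
pose c' i := c (w i) + smul (P (w i) ord_max) (smul g (c ord_max)).
have rx : forall i, rational (x (w i)).
  apply: (IHN _ c' q).
  - by move=> i; apply: rationalD => //; apply: rationalM => //; exact: rationalM.
  - by move=> i j; apply: rationalD => //; apply: rationalM => //; exact: rationalM.
  - move=> i j; rewrite -[q i j [::]]/(P (w i) (w j) [::] + smul _ _ [::]).
    by rewrite smul_nil !P0 mul0r addr0.
  - move=> i; rewrite {1}xE big_ord_recr /= xmax.
    rewrite !smul_addr !smul_sumr /c' -!addrA; congr (_ + _).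
    rewrite addrCA; congr (_ + _); rewrite -big_split; apply: eq_bigr => j _ /=.
    by rewrite smul_addl -!smulA.
move=> i; have [iN|] := ltnP i N.
  by rewrite (_ : i = w (Ordinal iN)) //; apply: val_inj.
move=> Ni; have -> : i = ord_max.
  by apply: val_inj => /=; apply/eqP; rewrite eqn_leq Ni -ltnS ltn_ord.
rewrite xmax; apply: rationalM => //; apply: rationalD => //.
by apply: rational_sum => j; exact: rationalM.
Qed.

Lemma series_decomp f : f = f [::] *: mono [::] + \sum_k smul (mono [:: k]) (lshift k f).
Proof.
apply/funext => -[|j w].
  rewrite -[RHS]/(f [::] * mono [::] [::] + (\sum_k smul (mono [:: k]) (lshift k f)) [::]).
  rewrite fct_sumE big1 ?addr0 ?mulr1 // => k _.
  by rewrite smul_smono.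
rewrite -[RHS]/(f [::] * mono [::] (j :: w) + (\sum_k smul (mono [:: k]) (lshift k f)) (j :: w)).
rewrite {1}/smono mulr0 add0r fct_sumE (bigD1 j) //= big1 => [|k /negbTE kj].
  by rewrite smul_smono /= eqxx prefix0s drop0 addr0.
by rewrite smul_smono /= kj.
Qed.

Lemma rational_family N (m : 'I_N -> fps) f :
  shift_closed m -> span m f -> rational f.
Proof.
move=> mk [c ->]; apply: rational_sum => i; apply: rationalZ; move: i {c}.
have /choice[s sP] : forall x : 'I_d * 'I_N, exists c : 'I_N -> C,
    lshift x.1 (m x.2) = \sum_i c i *: m i by move=> x; exact: mk.
apply: (@rational_system _ m (fun i => m i [::] *: mono [::])
   (fun i j => \sum_k s (k, i) j *: mono [:: k])).
- by move=> i; exact: rationalC.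
- by move=> i j; apply: rational_sum => k; apply: rationalZ; exact: rationalX.
- move=> i j; rewrite fct_sumE big1 // => k _.
  by rewrite -[LHS]/(_ * mono [:: k] [::]) mulr0.
- move=> i; rewrite {1}[m i]series_decomp; congr (_ + _).
  under eq_bigr => k _ do rewrite (sP (k, i)) smul_sumr.
  rewrite exchange_big; apply: eq_bigr => j _ /=.
  rewrite smul_suml; apply: eq_bigr => k _.
  by rewrite smul_scaler smul_scalel.
Qed.

End FormalSeries.

(** * Convergence of expressions near the origin *)

Section ComplexAbs.
Variable R : realType.
Local Notation C := R[i].
Implicit Types (z w : C).

Definition cabs z : R := Num.sqrt (absq z).

Lemma normcE z : `|z| = (cabs z)%:C%C.
Proof. exact: normc_def. Qed.

Lemma cabs_ge0 z : 0 <= cabs z. Proof. exact: sqrtr_ge0. Qed.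

Lemma cabsM z w : cabs (z * w) = cabs z * cabs w.
Proof. by rewrite /cabs absqM sqrtrM ?absq_ge0. Qed.

Lemma cabsD z w : cabs (z + w) <= cabs z + cabs w.
Proof. by rewrite -lecR rmorphD /= -!normcE ler_normD. Qed.

Lemma cabs0 : cabs 0 = 0. Proof. by rewrite /cabs absq0 sqrtr0. Qed.

Lemma cabsN z : cabs (- z) = cabs z. Proof. by rewrite /cabs absqN. Qed.

Lemma cabs_eq0 z : cabs z = 0 -> z = 0.
Proof. by move=> z0; apply/eqP; rewrite -normr_eq0 normcE z0. Qed.

Lemma cabs_sum (I : Type) (r : seq I) (F : I -> C) :
  cabs (\sum_(i <- r) F i) <= \sum_(i <- r) cabs (F i).
Proof.
elim/big_rec2: _ => [|i y z _ h]; first by rewrite cabs0.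
by apply: (le_trans (cabsD _ _)); rewrite lerD2l.
Qed.

End ComplexAbs.

Section MatrixNorm.
Variables (R : realType) (n : nat).
Local Notation C := R[i].
Implicit Types (A B : 'M[C]_n).

Definition mnorm A : R := \sum_i \sum_j cabs (A i j).

Lemma mnorm_ge0 A : 0 <= mnorm A.
Proof. by apply: sumr_ge0 => i _; apply: sumr_ge0 => j _; exact: cabs_ge0. Qed.

Lemma mnorm_entry A i j : cabs (A i j) <= mnorm A.
Proof.
rewrite /mnorm (bigD1 i) //= (bigD1 j) //= -addrA lerDl addr_ge0 //.
  by apply: sumr_ge0 => k _; exact: cabs_ge0.
by apply: sumr_ge0 => k _; apply: sumr_ge0 => l _; exact: cabs_ge0.
Qed.

Lemma mnorm_eq0 A : mnorm A = 0 -> A = 0.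
Proof.
move=> A0; apply/matrixP => i j; rewrite mxE; apply/cabs_eq0/eqP.
by rewrite eq_le cabs_ge0 andbT -A0 mnorm_entry.
Qed.

Lemma mnormD A B : mnorm (A + B) <= mnorm A + mnorm B.
Proof.
rewrite /mnorm -big_split; apply: ler_sum => i _ /=.
rewrite -big_split; apply: ler_sum => j _ /=.
by rewrite mxE cabsD.
Qed.

Lemma mnormN A : mnorm (- A) = mnorm A.
Proof. by apply: eq_bigr => i _; apply: eq_bigr => j _; rewrite mxE cabsN. Qed.

Lemma mnormB A B : mnorm (A - B) <= mnorm A + mnorm B.
Proof. by apply: (le_trans (mnormD _ _)); rewrite mnormN. Qed.

Lemma mnorm0 : mnorm 0 = 0.
Proof. by rewrite /mnorm big1 // => i _; rewrite big1 // => j _; rewrite mxE cabs0. Qed.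

Lemma mnormM A B : mnorm (A *m B) <= mnorm A * mnorm B.
Proof.
apply: (@le_trans _ _ (\sum_i \sum_j \sum_k cabs (A i k) * cabs (B k j))).
  apply: ler_sum => i _; apply: ler_sum => j _; rewrite mxE.
  apply: (le_trans (cabs_sum _ _)); rewrite le_eqVlt; apply/orP; left; apply/eqP.
  by apply: eq_bigr => k _; rewrite cabsM.
rewrite /mnorm mulr_suml; apply: ler_sum => i _.
rewrite exchange_big mulr_suml; apply: ler_sum => k _ /=.
rewrite -mulr_sumr ler_wpM2l ?cabs_ge0 //.
rewrite [leRHS](bigD1 k) //= lerDl; apply: sumr_ge0 => l _.
by apply: sumr_ge0 => j _; exact: cabs_ge0.
Qed.

Lemma mnormZ c A : mnorm (c *: A) = cabs c * mnorm A.
Proof.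
rewrite /mnorm mulr_sumr; apply: eq_bigr => i _; rewrite mulr_sumr.
by apply: eq_bigr => j _; rewrite mxE cabsM.
Qed.

Lemma mnorm_sum (I : Type) (r : seq I) (F : I -> 'M[C]_n) :
  mnorm (\sum_(i <- r) F i) <= \sum_(i <- r) mnorm (F i).
Proof.
elim/big_rec2: _ => [|i y z _ h]; first by rewrite mnorm0.
by apply: (le_trans (mnormD _ _)); rewrite lerD2l.
Qed.

End MatrixNorm.

Section Growth.
Variables (R : realType) (d : nat).
Local Notation C := R[i].
Local Notation fps := (word d -> C).
Implicit Types (f g : fps) (K rho : R).

Definition growth K rho f := forall w, cabs (f w) <= K * rho ^+ size w.

Lemma growth_le K rho K' rho' f : 0 <= K -> 0 <= rho -> K <= K' -> rho <= rho' ->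
  growth K rho f -> growth K' rho' f.
Proof.
move=> K0 r0 KK rr fg w; apply: (le_trans (fg w)); apply: ler_pM => //.
  exact: exprn_ge0.
by rewrite lerXn2r ?nnegrE // (le_trans r0).
Qed.

Lemma growth_lshift K rho k f : growth K rho f -> growth (K * rho) rho (lshift k f).
Proof. by move=> fg w; have := fg (k :: w); rewrite /= exprS mulrA. Qed.

(** The shifts act on a finite spanning family by matrices, so each letter
multiplies the size of the coefficients by at most a constant. *)
Lemma recognizable_growth f : recognizable f ->
  exists K rho, [/\ 0 <= K, 0 <= rho & growth K rho f].
Proof.
move=> [I [m [mk [u fu]]]].
have /choice[s sP] : forall x : 'I_d * I, exists c : I -> C,
    lshift x.1 (m x.2) = \sum_i c i *: m i by move=> x; exact: mk.
pose S : R := \sum_k \sum_i \sum_j cabs (s (k, i) j).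
have S0 : 0 <= S.
  apply: sumr_ge0 => k _; apply: sumr_ge0 => i _.
  by apply: sumr_ge0 => j _; exact: cabs_ge0.
pose B : R := \sum_i cabs (m i [::]).
pose bnd w := \sum_i cabs (m i w).
have step k w : bnd (k :: w) <= S * bnd w.
  apply: (@le_trans _ _ (\sum_i \sum_j cabs (s (k, i) j) * cabs (m j w))).
    apply: ler_sum => i _; rewrite -[m i (k :: w)]/(lshift k (m i) w) (sP (k, i)) fct_sumE.
    apply: (le_trans (cabs_sum _ _)); rewrite le_eqVlt; apply/orP; left; apply/eqP.
    by apply: eq_bigr => j _; rewrite -cabsM.
  have row i : \sum_j cabs (s (k, i) j) * cabs (m j w) <= (\sum_j cabs (s (k, i) j)) * bnd w.
    rewrite mulr_suml; apply: ler_sum => j _; rewrite ler_wpM2l ?cabs_ge0 //.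
    rewrite /bnd (bigD1 j) //= lerDl; apply: sumr_ge0 => l _; exact: cabs_ge0.
  apply: (le_trans (ler_sum _ (fun i _ => row i))); rewrite -mulr_suml ler_wpM2r //.
    by apply: sumr_ge0 => i _; exact: cabs_ge0.
  rewrite /S [leRHS](bigD1 k) //= lerDl; apply: sumr_ge0 => l _; apply: sumr_ge0 => i _.
  by apply: sumr_ge0 => j _; exact: cabs_ge0.
have bndP w : bnd w <= B * S ^+ size w.
  elim: w => [|k w IHw]; first by rewrite mulr1.
  by apply: (le_trans (step _ _)); rewrite exprS mulrCA ler_wpM2l.
have U0 : 0 <= \sum_i cabs (u i) by apply: sumr_ge0 => i _; exact: cabs_ge0.
exists ((\sum_i cabs (u i)) * B), S; split=> //.
  by rewrite mulr_ge0 //; apply: sumr_ge0 => i _; exact: cabs_ge0.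
move=> w; rewrite -mulrA; apply: le_trans (ler_wpM2l U0 (bndP w)).
rewrite fu fct_sumE mulr_suml; apply: (le_trans (cabs_sum _ _)); apply: ler_sum => i _.
rewrite -[(u i *: m i) w]/(u i * m i w) cabsM ler_wpM2l ?cabs_ge0 //.
rewrite /bnd (bigD1 i) //= lerDl; apply: sumr_ge0 => l _; exact: cabs_ge0.
Qed.

End Growth.

Lemma subr_telescope3 (V : zmodType) (p q r s : V) :
  p - s = (p - q) + ((q - r) + (r - s)).
Proof. by rewrite (addrA (q - r)) subrK addrA subrK. Qed.

Section Evaluation.
Variables (R : realType) (d n : nat).
Local Notation C := R[i].
Local Notation fps := (word d -> C).
Local Notation M := 'M[C]_n.+1.
Local Notation mono := (@smono R d).
Variable X : 'I_d -> M.
Implicit Types (f g : fps) (K rho : R).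

Definition term f (w : word d) : M := f w *: \prod_(k <- w) X k.
Definition psum N f : M := trunc_sum N (term f).
Definition homog N f : M := level_sum N (term f).

Lemma term_cons f k w : term f (k :: w) = X k *m term (lshift k f) w.
Proof. by rewrite /term big_cons -scalemxAr. Qed.

Lemma homogS N f : homog N.+1 f = \sum_k X k *m homog N (lshift k f).
Proof.
rewrite /homog level_sumS; apply: eq_bigr => k _.
rewrite /level_sum mulmx_sumr; apply: eq_bigr => t _; exact: term_cons.
Qed.

Lemma psumS N f : psum N.+1 f = f [::] *: 1%:M + \sum_k X k *m psum N (lshift k f).
Proof.
rewrite /psum trunc_sumS {1}/term big_nil; congr (_ + _); apply: eq_bigr => k _.
rewrite (raddf_trunc_sum N _ (mulmx0 _ (X k)) (mulmxDr (X k))).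
by apply: eq_trunc_sum => w _; exact: term_cons.
Qed.

Lemma psumSr N f : psum N.+1 f = psum N f + homog N f.
Proof. exact: trunc_sumSr. Qed.

Lemma psum0 f : psum 0 f = 0. Proof. exact: trunc_sum0. Qed.

Lemma psum_lin N c f g : psum N (c *: f + g) = c *: psum N f + psum N g.
Proof.
rewrite /psum (raddf_trunc_sum N _ (scaler0 _ c) (scalerDr c)) -trunc_sumD.
by apply: eq_trunc_sum => w _; rewrite /term scalerA -scalerDl.
Qed.

Lemma psum_zero N : psum N (0 : fps) = 0.
Proof.
rewrite /psum /trunc_sum big1 // => i _; rewrite /level_sum big1 // => t _.
by rewrite /term scale0r.
Qed.

Lemma psum_const N c : psum N.+1 (c *: mono [::]) = c%:M.
Proof.
rewrite psumS big1 => [|k _]; last first.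
  rewrite (_ : lshift k _ = 0) ?psum_zero ?mulmx0 //.
  by apply/funext => w; rewrite /lshift -[LHS]/(c * mono [::] (k :: w)) mulr0.
by rewrite addr0 -[(c *: _) [::]]/(c * 1) mulr1 scalemx1.
Qed.

Lemma psum1 N : psum N.+1 (mono [::]) = 1%:M.
Proof. by rewrite -[mono _]scale1r psum_const. Qed.

Local Notation tau := (\sum_k mnorm (X k)).
Local Notation c1 := (mnorm (1%:M : M)).

Lemma tau_ge0 : 0 <= tau.
Proof. by apply: sumr_ge0 => k _; exact: mnorm_ge0. Qed.

Lemma homog_bound K rho f N : growth K rho f -> 0 <= rho ->
  mnorm (homog N f) <= K * c1 * (rho * tau) ^+ N.
Proof.
move=> fg r0; elim: N K f fg => [|N IHN] K f fg.
  rewrite /homog level_sum0 /term big_nil mnormZ mulr1.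
  by rewrite ler_wpM2r ?mnorm_ge0 //; have := fg [::]; rewrite mulr1.
rewrite homogS; apply: (le_trans (mnorm_sum _ _)).
apply: (@le_trans _ _ (\sum_k mnorm (X k) * (K * rho * c1 * (rho * tau) ^+ N))).
  apply: ler_sum => k _; apply: (le_trans (mnormM _ _)).
  by rewrite ler_wpM2l ?mnorm_ge0 //; apply/IHN/growth_lshift.
rewrite -mulr_suml exprS le_eqVlt; apply/orP; left; apply/eqP; ring.
Qed.

Lemma half_pow_ge0 N : 0 <= (1 / 2) ^+ N :> R.
Proof. by rewrite exprn_ge0 // divr_ge0. Qed.

Lemma psum_bound K rho f N : growth K rho f -> 0 <= K -> 0 <= rho -> rho * tau <= 4^-1 ->
  mnorm (psum N f) <= 2 * (K * c1).
Proof.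
move=> fg K0 r0 th; have th0 : 0 <= rho * tau by rewrite mulr_ge0 // tau_ge0.
have A0 : 0 <= K * c1 by rewrite mulr_ge0 // mnorm_ge0.
suff W : mnorm (psum N f) <= K * c1 * (2 - 2 * (1 / 2) ^+ N).
  apply: (le_trans W); rewrite mulrC ler_wpM2r // gerBl mulr_ge0 // half_pow_ge0.
elim: N => [|N IHN]; first by rewrite psum0 mnorm0 expr0; lra.
rewrite psumSr; apply: (le_trans (mnormD _ _)).
apply: (le_trans (lerD IHN (homog_bound N fg r0))).
rewrite -mulrDr ler_wpM2l // exprS.
have h : (rho * tau) ^+ N <= (1 / 2) ^+ N by rewrite lerXn2r ?nnegrE //; lra.
lra.
Qed.

(** The partial sum of a product and the product of the partial sums differ by
terms of total length at least [N]; the recursion over [N] peels off the first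
letter of [f]. *)
Lemma psum_smul_bound K K' rho f g N : growth K rho f -> growth K' rho g ->
  0 <= K -> 0 <= K' -> 0 <= rho -> rho * tau <= 4^-1 ->
  mnorm (psum N (smul f g) - psum N f *m psum N g) <=
    2 * c1 ^+ 2 * K' * K * (N%:R * (rho * tau) ^+ N).
Proof.
move=> fg gg K0 K'0 r0 th; have th0 : 0 <= rho * tau by rewrite mulr_ge0 // tau_ge0.
have c0 : 0 <= c1 := mnorm_ge0 _.
elim: N K f fg K0 => [|N IHN] K f fg K0.
  by rewrite !psum0 mulmx0 subr0 mnorm0 mul0r mulr0.
have -> : psum N.+1 (smul f g) - psum N.+1 f *m psum N.+1 g =
  \sum_k X k *m (psum N (smul (lshift k f) g) - psum N (lshift k f) *m psum N g
     - psum N (lshift k f) *m homog N g).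
  rewrite [psum N.+1 f]psumS mulmxDl -scalemxAl mul1mx mulmx_suml.
  rewrite [psum N.+1 (smul f g)]psumS smul_nil.
  under eq_bigr => k _ do rewrite lshift_smulE psum_lin mulmxDr -scalemxAr.
  rewrite big_split -scaler_sumr addrA /= -scalerA -scalerDr -psumS.
  rewrite opprD addrACA subrr add0r -sumrB; apply: eq_bigr => k _.
  by rewrite [psum N.+1 g]psumSr -mulmxA mulmxDr -addrA -opprD -mulmxBr.
apply: (le_trans (mnorm_sum _ _)).
apply: (@le_trans _ _ (\sum_k mnorm (X k) * (2 * c1 ^+ 2 * K' * K * rho *
    (N.+1%:R * (rho * tau) ^+ N)))).
  apply: ler_sum => k _; apply: (le_trans (mnormM _ _)).
  rewrite ler_wpM2l ?mnorm_ge0 //; apply: (le_trans (mnormB _ _)).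
  have fk := growth_lshift k fg; have K1 : 0 <= K * rho by rewrite mulr_ge0.
  have h1 := IHN _ _ fk K1.
  have h2 := le_trans (mnormM (psum N (lshift k f)) (homog N g))
    (ler_pM (mnorm_ge0 _) (mnorm_ge0 _) (psum_bound N fk K1 r0 th) (homog_bound N gg r0)).
  apply: (le_trans (lerD h1 h2)); rewrite le_eqVlt; apply/orP; left; apply/eqP.
  rewrite -[N.+1]addn1 natrD; ring.
rewrite -mulr_suml [(_ * _) ^+ N.+1]exprS le_eqVlt; apply/orP; left; apply/eqP; ring.
Qed.

Lemma decay_bound (t : R) N : 0 <= t -> t <= 4^-1 -> N%:R * t ^+ N <= (1 / 2) ^+ N.
Proof.
move=> t0 t4; have h : t ^+ N <= (1 / 2) ^+ N * (1 / 2) ^+ N.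
  by rewrite -exprMn lerXn2r ?nnegrE //; lra.
have N2 : N%:R * (1 / 2) ^+ N <= 1 :> R.
  rewrite mul1r exprVn ler_pdivrMr ?exprn_gt0 // mul1r -natrX ler_nat.
  exact: ltnW (ltn_expl _ _).
apply: (@le_trans _ _ (N%:R * ((1 / 2) ^+ N * (1 / 2) ^+ N))); first by rewrite ler_wpM2l.
by rewrite mulrA -[leRHS]mul1r ler_wpM2r // half_pow_ge0.
Qed.

Definition conv f (A : M) := (fun N => mnorm (psum N f - A)) @ \oo --> (0 : R).

Lemma cvg_half : (fun N => (1 / 2 : R) ^+ N) @ \oo --> (0 : R).
Proof. by apply: cvg_expr; rewrite ger0_norm ?divr_ge0 //; lra. Qed.

Lemma conv_bound f A (t : nat -> R) : (forall N, mnorm (psum N f - A) <= t N) ->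
  t @ \oo --> (0 : R) -> conv f A.
Proof.
move=> ft t0; apply: (squeeze_cvgr _ (cvg_cst 0) t0).
by apply: nearW => N; rewrite mnorm_ge0 ft.
Qed.

Lemma conv_shift f A : (fun N => mnorm (psum N.+1 f - A)) @ \oo --> (0 : R) -> conv f A.
Proof. by move=> h; rewrite /conv -(cvg_shiftS (fun N => mnorm (psum N f - A))). Qed.

Lemma conv_lin c f g A B : conv f A -> conv g B -> conv (c *: f + g) (c *: A + B).
Proof.
move=> fA gB; apply: (@conv_bound _ _ (fun N =>
   cabs c * mnorm (psum N f - A) + mnorm (psum N g - B))).
  move=> N; rewrite psum_lin opprD addrACA -scalerBr -mnormZ.
  exact: mnormD.
rewrite -[0](addr0 0) -{1}(mulr0 (cabs c)); apply: cvgD => //.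
exact: cvgMr.
Qed.

Lemma conv_smul K K' rho f g A B : growth K rho f -> growth K' rho g ->
  0 <= K -> 0 <= K' -> 0 <= rho -> rho * tau <= 4^-1 ->
  conv f A -> conv g B -> conv (smul f g) (A *m B).
Proof.
move=> fg gg K0 K'0 r0 th fA gB.
have th0 : 0 <= rho * tau by rewrite mulr_ge0 // tau_ge0.
apply: (@conv_bound _ _ (fun N => 2 * c1 ^+ 2 * K' * K * (1 / 2) ^+ N +
  (2 * (K' * c1) * mnorm (psum N f - A) + mnorm A * mnorm (psum N g - B)))).
  move=> N; have -> : psum N (smul f g) - A *m B =
     (psum N (smul f g) - psum N f *m psum N g) +
     ((psum N f - A) *m psum N g + A *m (psum N g - B)).
    by rewrite mulmxBl mulmxBr; exact: subr_telescope3.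
  apply: (le_trans (mnormD _ _)); apply: lerD.
    apply: (le_trans (psum_smul_bound N fg gg K0 K'0 r0 th)).
    by rewrite ler_wpM2l ?decay_bound // !mulr_ge0 ?exprn_ge0 ?mnorm_ge0.
  apply: (le_trans (mnormD _ _)); apply: lerD; apply: (le_trans (mnormM _ _)) => //.
  by rewrite mulrC ler_wpM2r ?mnorm_ge0 // (psum_bound _ gg).
rewrite -[0](addr0 0); apply: cvgD.
  by rewrite -{1}(mulr0 (2 * c1 ^+ 2 * K' * K)); apply: cvgMr; exact: cvg_half.
rewrite -[0](addr0 0); apply: cvgD.
  by rewrite -{1}(mulr0 (2 * (K' * c1))); exact: cvgMr.
by rewrite -{1}(mulr0 (mnorm A)); exact: cvgMr.
Qed.

(** The partial sums of [g] multiply the value of [f] to matrices that tend to the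
identity, so the kernel of this value is trivial. *)
Lemma conv_inv K K' rho f g A : growth K rho f -> growth K' rho g ->
  0 <= K -> 0 <= K' -> 0 <= rho -> rho * tau <= 4^-1 ->
  smul f g = mono [::] -> conv f A -> A \in unitmx /\ conv g (invmx A).
Proof.
move=> fg gg K0 K'0 r0 th fg1 fA.
have th0 : 0 <= rho * tau by rewrite mulr_ge0 // tau_ge0.
have AG : (fun N => mnorm (A *m psum N.+1 g - 1%:M)) @ \oo --> (0 : R).
  have t0 : (fun N => 2 * c1 ^+ 2 * K' * K * (1 / 2) ^+ N.+1 +
     2 * (K' * c1) * mnorm (psum N.+1 f - A)) @ \oo --> (0 : R).
    rewrite -[0](addr0 0); apply: cvgD.
      rewrite -{1}(mulr0 (2 * c1 ^+ 2 * K' * K)); apply: cvgMr.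
      by rewrite (cvg_shiftS (fun N => (1 / 2 : R) ^+ N)); exact: cvg_half.
    rewrite -{1}(mulr0 (2 * (K' * c1))); apply: cvgMr.
    by rewrite (cvg_shiftS (fun N => mnorm (psum N f - A))).
  apply: (squeeze_cvgr _ (cvg_cst 0) t0); apply: nearW => N.
  rewrite mnorm_ge0 /=.
  have -> : A *m psum N.+1 g - 1%:M =
     - (psum N.+1 (smul f g) - psum N.+1 f *m psum N.+1 g) - (psum N.+1 f - A) *m psum N.+1 g.
    by rewrite -(psum1 N) -fg1 mulmxBl !opprB [RHS]addrC addrA subrK.
  apply: (le_trans (mnormB _ _)); rewrite mnormN; apply: lerD.
    apply: (le_trans (psum_smul_bound _ fg gg K0 K'0 r0 th)).
    by rewrite ler_wpM2l ?decay_bound // !mulr_ge0 ?exprn_ge0 ?mnorm_ge0.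
  apply: (le_trans (mnormM _ _)).
  by rewrite mulrC ler_wpM2r ?mnorm_ge0 // (psum_bound _ gg).
have Aunit : A \in unitmx.
  rewrite -row_free_unit -kermx_eq0; apply/eqP/mnorm_eq0.
  apply/eqP; rewrite eq_le mnorm_ge0 andbT; set k := kermx A.
  have k0 : (fun N => mnorm k * mnorm (A *m psum N.+1 g - 1%:M)) @ \oo --> (0 : R).
    by rewrite -(mulr0 (mnorm k)); exact: cvgMr.
  rewrite -(cvg_lim (@norm_hausdorff _ _) k0).
  apply: limr_ge; first by apply/cvg_ex; eexists; exact: k0.
  apply: nearW => N; apply: le_trans (mnormM _ _).
  by rewrite mulmxBr mulmxA mulmx_ker mul0mx sub0r mulmx1 mnormN.
split=> //; apply: conv_shift.
have t0 : (fun N => mnorm (invmx A) * mnorm (A *m psum N.+1 g - 1%:M)) @ \oo --> (0 : R).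
  by rewrite -(mulr0 (mnorm (invmx A))); exact: cvgMr.
apply: (squeeze_cvgr _ (cvg_cst 0) t0); apply: nearW => N.
rewrite mnorm_ge0 /=; apply: le_trans (mnormM _ _).
by rewrite mulmxBr mulKmx // mulmx1.
Qed.

End Evaluation.

Section ExpressionEvaluation.
Variables (R : realType) (d : nat).
Local Notation C := R[i].
Local Notation fps := (word d -> C).
Local Notation mono := (@smono R d).
Implicit Types (e : ncexpr R d) (f g : fps).

Lemma small_tau n rho : 0 <= rho -> exists2 eps : R, 0 < eps &
  forall X : 'I_d -> 'M[C]_n.+1, (forall k i j, `|X k i j| < eps%:C%C) ->
    rho * (\sum_k mnorm (X k)) <= 4^-1.
Proof.
move=> r0; pose B : R := (rho + 1) * (d%:R * (n.+1%:R * n.+1%:R) + 1).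
have D0 : 0 <= d%:R * (n.+1%:R * n.+1%:R) :> R by rewrite !mulr_ge0.
have B0 : 0 < B by rewrite mulr_gt0 //; lra.
exists (4^-1 / B) => [|X Xe]; first by rewrite divr_gt0 // invr_gt0.
have e0 : 0 <= 4^-1 / B by rewrite divr_ge0 ?invr_ge0 // ltW.
have h : \sum_k mnorm (X k) <= d%:R * (n.+1%:R * n.+1%:R) * (4^-1 / B).
  apply: (@le_trans _ _ (\sum_(k < d) n.+1%:R * n.+1%:R * (4^-1 / B))).
    apply: ler_sum => k _; apply: (@le_trans _ _ (\sum_(i < n.+1) \sum_(j < n.+1) 4^-1 / B)).
      apply: ler_sum => i _; apply: ler_sum => j _.
      by have := Xe k i j; rewrite normcE ltcR => /ltW.
    by rewrite !sumr_const !card_ord -[X in X <= _]mulr_natl -[X in _ * X]mulr_natl mulrA.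
  by rewrite sumr_const card_ord -[X in X <= _]mulr_natl mulrA.
have hB : (4^-1 / B) * B = 4^-1 :> R by rewrite divfK // gt_eqF.
rewrite /B in hB; set q := 4^-1 / _ in h hB e0.
apply: (le_trans (ler_wpM2l r0 h)); rewrite -hB.
move: (d%:R * _) D0 e0 => D D0 e0.
have -> : q * ((rho + 1) * (D + 1)) = rho * (D * q) + q * (rho + D + 1) by ring.
by rewrite lerDl mulr_ge0 // !addr_ge0.
Qed.

Lemma growth_ser e : regular e -> exists K rho, [/\ 0 <= K, 0 <= rho & growth K rho (formal_series e)].
Proof. by move=> /recognizable_formal_series[r _]; exact: recognizable_growth. Qed.

(** The series of the subexpressions grow geometrically, so that products and
inverses converge once the matrices are small compared with the growth rates. *)
Theorem conv_ser e : regular e -> forall n, exists2 eps : R, 0 < eps &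
  forall X : 'I_d -> 'M[C]_n.+1, (forall k i j, `|X k i j| < eps%:C%C) ->
    nc_dom X e /\ conv X (formal_series e) (nc_eval X e).
Proof.
have mins (e1 e2 : R) n (X : 'I_d -> 'M[C]_n.+1) :
    (forall k i j, `|X k i j| < (Num.min e1 e2)%:C%C) ->
    (forall k i j, `|X k i j| < e1%:C%C) /\ (forall k i j, `|X k i j| < e2%:C%C).
  move=> Xe; split=> k i j; apply: (lt_le_trans (Xe k i j)); rewrite lecR ge_min lexx ?orbT //.
elim: e => [k|c|e1 IH1 e2 IH2|e1 IH1 e2 IH2|e1 IH1] /=.
- move=> _ n; exists 1 => // X _; split=> //.
  apply: conv_shift; rewrite -(cvg_shiftS (fun N => mnorm (psum X N.+1 _ - _))).
  rewrite (_ : (fun N => _) = fun=> 0); first exact: cvg_cst.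
  apply/funext => N; rewrite psumS {1}/smono scale0r add0r (bigD1 k) //=.
  rewrite lshift_smono_cons eqxx (_ : (fun v => _) = 1 *: mono [::]); last first.
    by apply/funext.
  rewrite psum_const mulmx1 big1 ?addr0 ?subrr ?mnorm0 // => j /negbTE jk.
  rewrite lshift_smono_cons jk (_ : (fun v => _) = 0 *: mono [::]); last first.
    by apply/funext.
  by rewrite psum_const raddf0 mulmx0.
- move=> _ n; exists 1 => // X _; split=> //; apply: conv_shift.
  by under eq_fun do rewrite psum_const subrr mnorm0; exact: cvg_cst.
- move=> /andP[r1 r2] n; have [p1 p10 h1] := IH1 r1 n; have [p2 p20 h2] := IH2 r2 n.
  exists (Num.min p1 p2); first by rewrite lt_min p10.
  move=> X /mins[X1 X2]; have [d1 c1] := h1 X X1; have [d2 c2] := h2 X X2.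
  rewrite d1 d2; split=> //.
  by have := conv_lin 1 c1 c2; rewrite !scale1r.
- move=> /andP[r1 r2] n; have [p1 p10 h1] := IH1 r1 n; have [p2 p20 h2] := IH2 r2 n.
  have [K1 [q1 [K10 q10 g1]]] := growth_ser r1; have [K2 [q2 [K20 q20 g2]]] := growth_ser r2.
  have q0 : 0 <= q1 + q2 by rewrite addr_ge0.
  have [p3 p30 h3] := small_tau n q0.
  exists (Num.min (Num.min p1 p2) p3); first by rewrite !lt_min p10 p20.
  move=> X /mins[/mins[X1 X2] X3]; have [d1 c1] := h1 X X1; have [d2 c2] := h2 X X2.
  rewrite d1 d2; split=> //.
  have g1' : growth K1 (q1 + q2) (formal_series e1) by apply: growth_le g1; rewrite ?lerDl.
  have g2' : growth K2 (q1 + q2) (formal_series e2) by apply: growth_le g2; rewrite ?lerDr.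
  exact: conv_smul g1' g2' K10 K20 q0 (h3 X X3) c1 c2.
- move=> /andP[r1 s0] n; have [p1 p10 h1] := IH1 r1 n.
  have r2 : regular (NCinv e1) by rewrite /= r1.
  have [K1 [q1 [K10 q10 g1]]] := growth_ser r1; have [K2 [q2 [K20 q20 g2]]] := growth_ser r2.
  have q0 : 0 <= q1 + q2 by rewrite addr_ge0.
  have [p3 p30 h3] := small_tau n q0.
  exists (Num.min p1 p3); first by rewrite !lt_min p10.
  move=> X /mins[X1 X3]; have [d1 c1] := h1 X X1.
  have g1' : growth K1 (q1 + q2) (formal_series e1) by apply: growth_le g1; rewrite ?lerDl.
  have g2' : growth K2 (q1 + q2) (sinv (formal_series e1)) by apply: growth_le g2; rewrite ?lerDr.
  have [u c2] := conv_inv g1' g2' K10 K20 q0 (h3 X X3) (smul_sinvr s0) c1.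
  by rewrite d1 u.
Qed.

Lemma conv_entries n (X : 'I_d -> 'M[C]_n.+1) f A i j : conv X f A ->
  (fun N => series_partial f X N i j : C^o) @ \oo --> (A i j : C^o).
Proof.
move=> fA; apply/cvgrPdist_lt => e e0.
have eE : e = (complex.Re e)%:C%C by rewrite RRe_real // gtr0_real.
have re0 : 0 < complex.Re e by rewrite -ltcR -eE.
have /cvgrPdist_lt/(_ _ re0)[N _ NP] := fA; exists N => // m /= Nm.
have := NP m Nm; rewrite sub0r normrN ger0_norm ?mnorm_ge0 // => h.
rewrite eE -normrN opprB normcE ltcR; apply: le_lt_trans h.
by have := mnorm_entry (psum X m f - A) i j; rewrite !mxE.
Qed.

Theorem nc_power_series_ser e : regular e -> nc_power_series_at0 e (formal_series e).
Proof.
move=> re n; have [p p0 h] := conv_ser re n; exists p => // X Xp.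
have [dX cX] := h X Xp; split=> // i j; exact: conv_entries.
Qed.

End ExpressionEvaluation.

(** * Uniqueness of power series and rational columns *)

Section PowerSeriesUniqueness.
Variables (R : realType) (d : nat).
Local Notation C := R[i].
Local Notation fps := (word d -> C).

Lemma trunc_sum_single (V : nmodType) (u : word d -> V) w N :
  (forall v, v != w -> u v = 0) -> (size w < N)%N -> trunc_sum N u = u w.
Proof.
move=> uw wN; rewrite /trunc_sum (bigD1 (Ordinal wN)) //= big1 ?addr0; last first.
  move=> m mw; rewrite /level_sum big1 // => t _; apply: uw.
  by apply: contra_neq mw => tw; apply: val_inj; rewrite /= -tw size_tuple.
rewrite /level_sum (bigD1 (in_tuple w)) //= big1 ?addr0 // => t tw.
by apply: uw; apply: contra_neq tw => tw; exact: val_inj.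
Qed.

(** Among the products of these nilpotent matrices, the one along [w] is the only
one with a non-zero corner entry. *)
Definition path_mx (w : word d) (z : C) (k : 'I_d) : 'M[C]_((size w).+1) :=
  \matrix_(i, j) if (j == i.+1 :> nat) && (nth k w i == k) then z else 0.

(** A product of these matrices walks along [w] one letter at a time, starting
at the position given by the row. *)
Lemma path_mx_prod w z (v : word d) i j :
  (\prod_(k <- v) path_mx w z k) i j =
  if (j == i + size v :> nat)%N && prefix v (drop i w) then z ^+ size v else 0.
Proof.
elim: v i => [|k v IHv] i.
  rewrite big_nil mxE addn0 prefix0s andbT eq_sym.
  by rewrite -(inj_eq val_inj); case: eqP.
rewrite big_cons mxE; move: (\prod_(l <- v) _) IHv => P IHv.
have [iw|wi] := ltnP i (size w).
  rewrite (bigD1 (Ordinal (iw : (i.+1 < (size w).+1)%N))) //= big1 ?addr0; last first.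
    move=> l li; rewrite mxE ifF ?mul0r //; apply/negbTE.
    by rewrite negb_and (_ : val l != i.+1) //.
  rewrite mxE eqxx IHv /= (drop_nth k iw) prefix_cons addSnnS.
  rewrite [k == _]eq_sym exprS.
  by case: (nth k w i == k); case: (_ == _) => //=;
     rewrite ?mul0r // ?mulr0 //; case: ifP => // _; rewrite mulr0.
rewrite drop_oversize // big1 ?andbF //= => l _.
rewrite mxE ifF ?mul0r //; apply/negbTE; rewrite negb_and; apply/orP; left.
by rewrite neq_ltn (leq_ltn_trans (ltnSE (ltn_ord l))) // ltnS.
Qed.

Lemma series_partial_path (s : fps) w z N : (size w < N)%N ->
  series_partial s (path_mx w z) N ord0 ord_max = s w * z ^+ size w.
Proof.
move=> wN; rewrite -[series_partial _ _ _]/(trunc_sum N (term (path_mx w z) s)).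
rewrite (@raddf_trunc_sum _ _ C (fun A : 'M[C]_((size w).+1) => A ord0 ord_max)).
- rewrite (trunc_sum_single (w := w)) //.
    by rewrite mxE path_mx_prod /= drop0 add0n eqxx prefix_refl.
  move=> v vw; rewrite mxE path_mx_prod /= drop0 add0n; case: eqP => [wv|_] /=; last by rewrite mulr0.
  rewrite ifF ?mulr0 //; apply/negbTE; apply: contra vw => /prefixP[t wt].
  move: wv; rewrite wt size_cat => /eqP; rewrite -[X in _ == X]addn0 eqn_add2l size_eq0 => /eqP ->.
  by rewrite cats0.
- by rewrite mxE.
- by move=> A B; rewrite mxE.
Qed.

(** At small multiples of the path matrices of [w] the partial sums are
eventually constant, and one entry is a multiple of the coefficient at [w]. *)
Theorem power_series_unique e (s s' : fps) :
  nc_power_series_at0 e s -> nc_power_series_at0 e s' -> s = s'.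
Proof.
move=> es es'; apply/funext => w.
have [p p0 h] := es (size w); have [p' p'0 h'] := es' (size w).
pose t : R := Num.min p p' / 2.
have t0 : 0 < t by rewrite divr_gt0 // lt_min p0.
have tp : t < p /\ t < p'.
  have : Num.min p p' <= p /\ Num.min p p' <= p' by rewrite !ge_min !lexx orbT.
  have : 0 < Num.min p p' by rewrite lt_min p0.
  by rewrite /t => ? [? ?]; split; lra.
pose X := path_mx w t%:C%C.
have small p1 : 0 < p1 -> t < p1 -> forall k i j, `|X k i j| < p1%:C%C.
  move=> p10 tp1 k i j; rewrite mxE; case: ifP => _.
    by rewrite normcE /cabs absqR sqrtr_sqr gtr0_norm // ltcR.
  by rewrite normr0 ltcR.
have [_ c] := h X (small p p0 tp.1); have [_ c'] := h' X (small p' p'0 tp.2).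
have val (s1 : fps) : (fun N => series_partial s1 X N ord0 ord_max : C^o) @ \oo -->
    (nc_eval X e ord0 ord_max : C^o) -> nc_eval X e ord0 ord_max = s1 w * t%:C%C ^+ size w.
  move=> c1; apply: (cvg_unique (@norm_hausdorff _ _) c1).
  apply: cvg_near_cst; exists (size w).+1 => // N /= wN.
  exact: series_partial_path.
have := val _ (c ord0 ord_max); rewrite (val _ (c' ord0 ord_max)) => /esym.
apply: mulIf; rewrite expf_neq0 //.
by rewrite -[0](rmorph0 (real_complex R)) (inj_eq (@complexI R)) gt_eqF.
Qed.

End PowerSeriesUniqueness.

Section MainTheorem.
Variables (R : realType) (d : nat).
Local Notation C := R[i].
Local Notation fps := (word d -> C).
Local Notation H := (fockH R d).

Lemma nc_rational_recognizable (b : fps) : nc_rational b -> recognizable (str b).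
Proof.
move=> [e []]; rewrite regular_dom => re eb.
have -> : b = formal_series e := power_series_unique eb (nc_power_series_ser re).
by have [] := recognizable_formal_series re.
Qed.

Lemma rational_nc_rational (f : fps) : rational (str f) -> nc_rational f.
Proof.
move=> [e re es]; exists e; rewrite regular_dom; split=> //.
have <- : formal_series e = f by rewrite es strK.
exact: nc_power_series_ser.
Qed.

Lemma Hinf1_Hinf (a : fps) : Hinf1 a -> Hinf a.
Proof. by move=> ha; exists 1 => h fh; rewrite mul1e; exact: ha. Qed.

Lemma column_inner_Hinf1 (b a : fps) : column_inner b a -> Hinf1 a.
Proof.
move=> ba; apply/Hinf1_opR => h fh; rewrite -(ba h fh).
by rewrite leeDr // normsq_ge0.
Qed.

(** Polarization of the isometry identity for the column. *)
Lemma column_inner_defect (b a : fps) : Hinf1 b -> column_inner b a ->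
  forall h, fock h -> h - adj (opR b) (opR b h) = adj (opR a) (opR a h).
Proof.
move=> hb ba h fh; have ha := column_inner_Hinf1 ba.
rewrite -(coefsK fh); set x := vec_of fh.
rewrite (opR_coefs hb) (opR_coefs ha) !adj_opR.
have iso (z : H) : sq (mulF hb z) + sq (mulF ha z) = sq z.
  have := ba _ (fock_coefs z); rewrite (opR_coefs hb) (opR_coefs ha).
  rewrite !normsqE; try exact: fock_coefs.
  by rewrite -!sq_coefs -EFinD => -[].
suff e : x - mulF_adj hb (mulF hb x) = mulF_adj ha (mulF ha x).
  by rewrite -e coefsB.
apply: ip_ext => z; rewrite ipBr ReD ReN -!mulF_adjP.
have := iso (z + x); rewrite !(linD (mulF_lin _)) !sqD.
have := iso z; have := iso x; lra.
Qed.

Lemma column_inner_factorable (b a : fps) : Hinf1 b -> column_inner b a ->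
  factorable (fun h : Defs.fps R d => h - adj (opR b) (opR b h)).
Proof.
move=> hb ba; have ha := column_inner_Hinf1 ba; split; last first.
  by exists a; [exact: Hinf1_Hinf|exact: column_inner_defect].
move=> h fh; rewrite (column_inner_defect hb ba fh) -(coefsK fh) (opR_coefs ha) adj_opR.
by rewrite -ip_coefs -mulF_adjP ip_sq lecR sq_ge0.
Qed.

(** The alternative is decided by [defect_gap]: if it vanishes then so does the
second entry of the column, and otherwise its square root is the constant term
of that entry. *)
Theorem rational_column (b : fps) (hb : Hinf1 b) : nc_rational b ->
  [/\ nc_rational (sarason b), column_inner b (sarason b) &
      inner b \/ sarason b [::] != 0].
Proof.
move=> /nc_rational_recognizable[I [m [mk mb]]].
have aE := sarasonE hb mk mb; set alpha := alphaF hb in aE.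
have orth := column_orthonormal hb mk mb.
have opRa h : opR (sarason b) h = smul h (coefs alpha) by rewrite opRE aE strK.
have iso : column_inner b (sarason b).
  move=> h fh; rewrite opRa opRE -(coefsK (fock_str_b hb)).
  have := column_isometry orth (vec_of fh).
  rewrite !sq_coefs /mul_beta /mul_alpha !coefsK => e.
  rewrite !normsqE //; first by rewrite -e EFinD.
    exact: fock_mul_alpha orth _ fh.
  exact: fock_mul_beta orth _ fh.
split=> //.
- apply: rational_nc_rational; rewrite aE strK [coefs alpha]series_decomp.
  apply: rationalD; first exact: rationalC.
  apply: rational_sum => k; apply: rationalM; first exact: rationalX.
  have [r [m' [mk' span']]] := defect_series_family hb mk.
  rewrite (lshift_alphaF hb mk mb) -scaleN1r; apply: rationalZ.
  by apply: rational_family mk' _; apply/span'/in_model_shift_beta.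
- set g := defect_gap (@evF R d) (@shF R d) (@joinF R d) (rootF hb) (betaF hb).
  have [q0|q0] := eqVneq g 0.
    have al0 : alpha = 0 by exact: (alphaF_eq0 mk mb q0).
    left=> h fh; have := iso h fh; rewrite opRa al0.
    rewrite coefs0 (_ : smul h _ = fun=> 0); last exact: smul_zeror.
    suff -> : normsq ((fun=> 0) : Defs.fps R d) = 0%E by rewrite adde0.
    by rewrite /normsq esum1 // => w _; rewrite absq0.
  right; rewrite aE -[str _ _]/((Num.sqrt g)%:C%C).
  rewrite -[0](rmorph0 (real_complex R)) (inj_eq (@complexI R)) gt_eqF //.
  by rewrite sqrtr_gt0 lt_def q0 gap_ge0.
Qed.

End MainTheorem.

Theorem theorem4 (R : realType) (d : nat) (b : fps R d)
    (hb : Hinf1 b) (hrat : nc_rational b) :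
  (inner b \/ ~ column_extreme b) /\
  (~ column_extreme b ->
     let a := sarason b in
     let T := fun h : fps R d => h - adj (opR b) (opR b h) in
     [/\ Hinf1 a, nc_rational a, column_inner b a,
         forall h, fock h -> T h = adj (opR a) (opR a h)
       & factorable T]).
Proof.
have [ra iso dich] := rational_column hb hrat.
have ha := column_inner_Hinf1 iso.
split; last first.
  move=> _ a T; split=> //; first exact: column_inner_defect.
  exact: (column_inner_factorable hb iso).
case: dich => [ib|a0]; [by left|right=> ce; apply: ce].
exists (sarason b); split; first exact: Hinf1_Hinf.
  by move=> z; move: a0; rewrite z eqxx.
by move=> h fh; rewrite iso.
Qed.
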